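(* Fix $m>0$ and $N>0$. For $c$ with $0<N^{2/3}<cN_*^{2/3}$ let $\rho_c$ be a minimizer of $E_c(N)$ whose compact support has radius $R_c$, and let $\rho_\infty$ be a minimizer of $E_\infty(N)$ whose compact support has radius $R_\infty$. Let $K_1>0$ be a constant independent of $c$ such that $B(R_c-\frac{K_1}{c^2})\subset B(R_c)\subset B(R_\infty)$ for all sufficiently large $c$. Then there is a constant $C>0$ independent of $c$ and $x$ such that for all sufficiently large $c$: (i) $\rho_\infty(x)\le \frac{C}{c^3}$ for all $x\in B(R_\infty)\setminus B(R_c)$; (ii) $\rho_c(x)\le\frac{C}{c^3}$ for all $x\in B(R_c)\setminus B\big(R_c-\frac{K_1}{c^2}\big)$.
   Context: $B(R)$ denotes the ball in $\mathbb{R}^3$ of radius $R$ centered at the origin. Fix constants $\kappa>0$ and $q\ge 1$. For a density $\rho\ge 0$ on $\mathbb{R}^3$ put $$j_{mc}(\rho(x))=\frac{q}{8\pi^3}\int_{|p|<(6\pi^2\rho(x)/q)^{1/3}}\left(\sqrt{c^2|p|^2+m^2c^4}-mc^2\right)dp,\qquad D(\rho,\rho)=\frac12\int_{\mathbb{R}^3}\int_{\mathbb{R}^3}\frac{\rho(x)\rho(y)}{|x-y|}\,dxdy,$$ $$j_\infty(\rho(x))=\frac{q}{8\pi^3}\int_{|p|<(6\pi^2\rho(x)/q)^{1/3}}\frac{|p|^2}{2m}\,dp=\frac{3}{10m}\Big(\frac{6\pi^2}{q}\Big)^{2/3}\rho(x)^{5/3},$$ where $p\in\mathbb{R}^3$.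 Define $\mathcal{E}_c(\rho)=\int_{\mathbb{R}^3}j_{mc}(\rho(x))\,dx-\kappa D(\rho,\rho)$ and $\mathcal{E}_\infty(\rho)=\int_{\mathbb{R}^3}j_\infty(\rho(x))\,dx-\kappa D(\rho,\rho)$, and $$E_c(N)=\inf\Big\{\mathcal{E}_c(\rho):0\le\rho\in L^1\cap L^{4/3}(\mathbb{R}^3),\ \int_{\mathbb{R}^3}\rho\,dx=N\Big\},$$ $$E_\infty(N)=\inf\Big\{\mathcal{E}_\infty(\rho):0\le\rho\in L^1\cap L^{5/3}(\mathbb{R}^3),\ \int_{\mathbb{R}^3}\rho\,dx=N\Big\}.$$ A minimizer of $E_c(N)$ (resp. $E_\infty(N)$) is an admissible $\rho$ attaining the infimum. The constant $N_*>0$ is the optimal (largest) constant such that $$\kappa N_*^{2/3}D(\rho,\rho)\le K_{cl}\|\rho\|_{L^{4/3}}^{4/3}\|\rho\|_{L^1}^{2/3}\quad\text{for all }0\le\rho\in L^1\cap L^{4/3}(\mathbb{R}^3),\qquad K_{cl}=\frac34\Big(\frac{6\pi^2}{q}\Big)^{1/3}.$$ The minimizers are taken to be symmetric decreasing (radial about the origin and nonincreasing in $|x|$) with compact support, and are represented by their continuous versions; their supports are closed balls centered at the origin, of radius $R_c$, resp. $R_\infty$. *)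

(* Defs.v *)
From HB Require Import structures.
From mathcomp Require Import all_boot all_order all_algebra.
From mathcomp Require Import all_classical all_reals all_analysis.
Import Order.TTheory GRing.Theory Num.Theory.
Import numFieldNormedType.Exports.

Set Implicit Arguments.
Unset Strict Implicit.
Unset Printing Implicit Defensive.

Local Open Scope classical_set_scope.
Local Open Scope ring_scope.

Definition R3 (R : realType) := (R * R * R)%type.

(* The library norm on a product is the max norm, hence this Euclidean one. *)
Definition enorm (R : realType) (x : R3 R) : R :=
  Num.sqrt (x.1.1 ^+ 2 + x.1.2 ^+ 2 + x.2 ^+ 2).

Definition eball (R : realType) (r : R) : set (R3 R) :=
  [set x | enorm x < r].

Definition leb3 {R : realType} :
    {measure set (measurableTypeR R * measurableTypeR R * measurableTypeR R)
     -> \bar R} :=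
  (@lebesgue_measure R \x @lebesgue_measure R \x @lebesgue_measure R)%E.

Definition fermi_momentum (R : realType) (q s : R) : R :=
  (6 * pi ^+ 2 * s / q) `^ 3^-1.

Definition jmc (R : realType) (q m c s : R) : R :=
  q / (8 * pi ^+ 3) *
  \int[leb3]_(p in eball (fermi_momentum q s))
    (Num.sqrt (c ^+ 2 * enorm p ^+ 2 + m ^+ 2 * c ^+ 4) - m * c ^+ 2).

Definition jinf (R : realType) (q m s : R) : R :=
  q / (8 * pi ^+ 3) *
  \int[leb3]_(p in eball (fermi_momentum q s)) (enorm p ^+ 2 / (2 * m)).

(* On the diagonal, a null set, the integrand is 0 since 0^-1 = 0. *)
Definition coulomb (R : realType) (rho : R3 R -> R) : \bar R :=
  ((2^-1)%:E * \int[leb3]_x \int[leb3]_y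
     (rho x * rho y / enorm (x - y))%:E)%E.

(* Both terms are finite on the admissible densities below, so that the
   subtraction in \bar R is the real one there. *)
Definition energy_c (R : realType) (kappa q m c : R) (rho : R3 R -> R)
    : \bar R :=
  (\int[leb3]_x (jmc q m c (rho x))%:E - kappa%:E * coulomb rho)%E.

Definition energy_inf (R : realType) (kappa q m : R) (rho : R3 R -> R)
    : \bar R :=
  (\int[leb3]_x (jinf q m (rho x))%:E - kappa%:E * coulomb rho)%E.

Definition density (R : realType) (p : R) (rho : R3 R -> R) : Prop :=
  [/\ measurable_fun [set: R3 R] rho,
      forall x, 0 <= rho x,
      finite_norm leb3 1%E rho &
      finite_norm leb3 p%:E rho].

Definition admissible (R : realType) (p N : R) : set (R3 R -> R) :=
  [set rho | density p rho /\ (\int[leb3]_x (rho x)%:E = N%:E)%E].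

Definition E_c (R : realType) (kappa q m c N : R) : \bar R :=
  ereal_inf (energy_c kappa q m c @` admissible (4 / 3) N).

Definition E_inf (R : realType) (kappa q m N : R) : \bar R :=
  ereal_inf (energy_inf kappa q m @` admissible (5 / 3) N).

Definition minimizer_c (R : realType) (kappa q m c N : R)
    (rho : R3 R -> R) : Prop :=
  admissible (4 / 3) N rho /\ energy_c kappa q m c rho = E_c kappa q m c N.

Definition minimizer_inf (R : realType) (kappa q m N : R)
    (rho : R3 R -> R) : Prop :=
  admissible (5 / 3) N rho /\ energy_inf kappa q m rho = E_inf kappa q m N.

Definition K_cl (R : realType) (q : R) : R :=
  3 / 4 * (6 * pi ^+ 2 / q) `^ 3^-1.

Definition GN_bound (R : realType) (kappa q M : R) : Prop :=
  forall rho : R3 R -> R, density (4 / 3) rho ->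
    ((kappa * M `^ (2 / 3))%:E * coulomb rho <=
     (K_cl q)%:E *
       ('N[leb3]_(4 / 3)%:E [EFin \o rho] `^ (4 / 3)) *
       ('N[leb3]_1 [EFin \o rho] `^ (2 / 3)))%E.

Definition is_N_star (R : realType) (kappa q Nstar : R) : Prop :=
  [/\ 0 < Nstar, GN_bound kappa q Nstar &
      forall M, 0 < M -> GN_bound kappa q M -> M <= Nstar].

Definition symmetric_decreasing (R : realType) (rho : R3 R -> R) : Prop :=
  (forall x y, enorm x = enorm y -> rho x = rho y) /\
  (forall x y, enorm x <= enorm y -> rho y <= rho x).

Definition support_radius (R : realType) (rho : R3 R -> R) (r : R) : Prop :=
  closure [set x | rho x != 0] = [set x | enorm x <= r].

(* The representative chosen for a minimizer: symmetric decreasing, continuous,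
   supported in the closed ball of radius r. *)
Definition regular_profile (R : realType) (rho : R3 R -> R) (r : R) : Prop :=
  [/\ symmetric_decreasing rho, continuous rho & support_radius rho r].

(* Main.v *)
Require Import Defs.
From HB Require Import structures.
From mathcomp Require Import all_boot all_order all_algebra.
From mathcomp Require Import all_classical all_reals all_analysis.
From mathcomp Require Import measurable_realfun ring lra.
Import Order.TTheory GRing.Theory Num.Theory.
Import numFieldNormedType.Exports.

(** Both minimizers are bounded densities minimizing a functional
<<integral of J(rho) - kappa D(rho, rho)>> at fixed mass N, where J is convex with
derivative phi: phi(s) is the kinetic energy of one particle at the Fermi
momentum eta(s), and s is proportional to eta(s)^3.  Three facts hold for
every such minimizer, with the relativistic and the nonrelativistic J alike.

- Euler-Lagrange.  Moving a little mass towards a point gives a multiplier mu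
  with kappa V <= phi(rho) + mu everywhere and equality where rho > 0, V being
  the Newtonian potential of rho ([euler_lagrange_le], [euler_lagrange_ge]).
- Virial identity.  Dilating rho at fixed mass gives
  3 (P - T) = kappa D(rho, rho), where T is the integral of J(rho) and P that of
  rho phi(rho) ([virial]).
- Newton's theorem.  A symmetric decreasing density is a superposition of
  balls (its level sets), so V(x) <= N / |x|, with equality outside the
  support ([newton_le], [newton_eq]).  At the edge of the support, whose
  radius is r, this identifies mu = kappa N / r ([multiplier_newton]), hence
    phi(rho(x)) <= kappa N (1/|x| - 1/r)          ([phi_axis_le]).

For (ii) this estimate is applied to rho_c at R_c - K_1/c^2 <= |x| < R_c.  The
right-hand side is O(c^-2) because R_c stays away from 0.  Since rho_c is
bounded uniformly in c ([eta_top_le]), phi_c(s) is at least a fixed multiple of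
eta(s)^2 there ([rel_disp_lower]), so eta = O(1/c) and rho_c = O(c^-3).

For (i) it suffices, by monotonicity, to consider |x| = R_c.  The estimate for
rho_inf then has right-hand side kappa N (1/R_c - 1/R_inf) = mu_c - mu_inf, and
phi_inf(s) = eta(s)^2 / 2m up to a positive factor, so that everything reduces
to mu_c - mu_inf <= O(c^-2).  Multiplying the Euler-Lagrange equation by rho
gives mu N = 2 kappa D - P, and with the virial identity mu is expressed
through T and P.  In the nonrelativistic case T = (3/5) P and therefore
mu_inf N = -(7/3) E_inf.  In the relativistic case the same
holds up to an error O(c^-2), because on bounded densities the relativistic
kinetic energy differs from p^2/2m by O(c^-2).  Finally E_inf <= E_c + O(c^-2),
rho_c being a trial density for E_inf ([multiplier_compare],
[multiplier_gap]).  The same inequality bounds 1/R_c, which keeps R_c away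
from 0. *)

Set Implicit Arguments.
Unset Strict Implicit.
Unset Printing Implicit Defensive.

Local Open Scope classical_set_scope.
Local Open Scope ring_scope.

(** * Affine changes of variables and iterated integrals *)

Section affine1.
Context {R : realType}.
Local Notation mu := (@lebesgue_measure R).

Lemma measurable_affine (k b : R) :
  measurable_fun [set: measurableTypeR R]
    (fun x : measurableTypeR R => (k * x + b : measurableTypeR R)).
Proof. by exact: measurable_funD. Qed.

(** The right-hand side is a measure giving half-open intervals their length, and
that property characterizes Lebesgue measure. *)
Lemma lebesgue_measure_affine (k b : R) (A : set (measurableTypeR R)) :
  0 < k -> measurable A ->
  (mu A = k%:E * pushforward mu (fun x : measurableTypeR R =>
    (k * x + b)%R : measurableTypeR R) A)%E.
Proof.
move=> k0 mA.
pose phi : measurableTypeR R -> measurableTypeR R := fun x => k * x + b.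
have mphi : measurable_fun setT phi by exact: measurable_affine.
pose M := isMeasurableFun.Build _ _ _ _ _ mphi.
pose f : {mfun measurableTypeR R >-> measurableTypeR R} := HB.pack phi M.
pose nu := pushforward mu f.
have k0' : 0 <= k by exact: ltW.
pose kn := NngNum k0'.
rewrite (_ : (k%:E * _)%E = mscale kn nu A); last first.
  by rewrite /mscale.
apply: lebesgue_measure_unique => // _ [[x y]] _ <-.
have nuE : nu `]x, y]%classic = mu `](x - b) / k, (y - b) / k]%classic.
  rewrite /nu /pushforward; congr (mu _).
  apply/seteqP; split => z /=; rewrite !in_itv /= /phi => /andP[xz zy].
    by rewrite ltr_pdivrMr// ler_pdivlMr// (mulrC z); lra.
  by move: xz zy; rewrite ltr_pdivrMr// ler_pdivlMr// (mulrC z); lra.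
rewrite -[RHS]/(k%:E * nu `]x, y]%classic)%E nuE /=.
rewrite !lebesgue_measure_itv/= !lte_fin.
rewrite ltr_pM2r ?invr_gt0// ltrD2r.
case: ifPn => _; last by rewrite mule0.
by rewrite -!EFinD -EFinM; congr EFin; field; lra.
Qed.

Lemma ge0_integral_affine_gt0 (k b : R) (F : measurableTypeR R -> \bar R) :
  0 < k -> measurable_fun setT F -> (forall x, 0 <= F x)%E ->
  (\int[mu]_x F x = k%:E * \int[mu]_x F (k * x + b)%R)%E.
Proof.
move=> k0 mF F0.
pose phi : measurableTypeR R -> measurableTypeR R := fun x => k * x + b.
have mphi : measurable_fun setT phi by exact: measurable_affine.
pose M := isMeasurableFun.Build _ _ _ _ _ mphi.
pose f : {mfun measurableTypeR R >-> measurableTypeR R} := HB.pack phi M.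
pose nu := pushforward mu f.
have k0' : 0 <= k by exact: ltW.
pose kn := NngNum k0'.
rewrite (eq_measure_integral (mscale kn nu)); last first.
  by move=> A mA _; exact: (lebesgue_measure_affine b k0 mA).
rewrite ge0_integral_mscale//.
by rewrite ge0_integral_pushforward// preimage_setT.
Qed.

Lemma ge0_integral_opp (F : measurableTypeR R -> \bar R) :
  measurable_fun setT F -> (forall x, 0 <= F x)%E ->
  (\int[mu]_x F x = \int[mu]_x F (- x)%R)%E.
Proof.
move=> mF F0.
have := @ge0_integral_pushforward _ _ _ _ _
  (-%R : measurableTypeR R -> measurableTypeR R) (@oppr_measurable R setT) mu
  setT F measurableT mF (fun y _ => F0 y).
rewrite preimage_setT => <-.
by apply: eq_measure_integral => A mA _; exact/esym/lebesgue_measureN.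
Qed.

Lemma ge0_integral_affine (k b : R) (F : measurableTypeR R -> \bar R) :
  k != 0 -> measurable_fun setT F -> (forall x, 0 <= F x)%E ->
  (\int[mu]_x F x = `|k|%:E * \int[mu]_x F (k * x + b)%R)%E.
Proof.
move=> k0 mF F0; have [kp|kn|] := ltgtP 0 k; last by move=> /eqP; rewrite eq_sym (negbTE k0).
  by rewrite gtr0_norm//; exact: ge0_integral_affine_gt0.
rewrite ltr0_norm// ge0_integral_opp// (@ge0_integral_affine_gt0 (- k) (- b))//; last 2 first.
- by rewrite oppr_gt0.
- exact: measurableT_comp.
by congr (_ * _)%E; apply: eq_integral => x _; rewrite mulNr -opprD opprK.
Qed.

End affine1.

Section sigma_finite_product.
Context d1 d2 (T1 : measurableType d1) (T2 : measurableType d2) (R : realType).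
Variables (m1 : {sigma_finite_measure set T1 -> \bar R})
          (m2 : {sigma_finite_measure set T2 -> \bar R}).

(** The product measure under its own name, so that it can carry the structure of
a sigma-finite measure: the triple product and the Fubini-Tonelli theorems on
R^3 x R^3 require it. *)
Definition sprod : set (T1 * T2) -> \bar R := (m1 \x m2)%E.

HB.instance Definition _ := Measure.on sprod.

Let sprod_sigma_finite : sigma_finite setT sprod.
Proof.
have /sigma_finiteP[F [TF ndF Fm]] := sigma_finiteT m1.
have /sigma_finiteP[G [TG ndG Gm]] := sigma_finiteT m2.
exists (fun n => F n `*` G n).
  apply/esym; rewrite -subTset => -[x y] _.
  have [i _ Fx] : (\bigcup_k F k) x by rewrite -TF.
  have [j _ Gy] : (\bigcup_k G k) y by rewrite -TG.
  exists (maxn i j) => //; split.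
    by move: x Fx; exact/subsetPset/ndF/leq_maxl.
  by move: y Gy; exact/subsetPset/ndG/leq_maxr.
move=> n; have [mF Fy] := Fm n; have [mG Gy] := Gm n.
split; first exact: measurableX.
by rewrite [ltLHS]product_measure1E// lte_mul_pinfty// ge0_fin_numE.
Qed.

HB.instance Definition _ :=
  Measure_isSigmaFinite.Build _ _ _ sprod sprod_sigma_finite.

End sigma_finite_product.

Section affine23.
Context {R : realType}.
Local Notation mu := (@lebesgue_measure R).
Local Notation mR := (measurableTypeR R).

Definition leb2 : {sigma_finite_measure set (mR * mR)%type -> \bar R} :=
  sprod mu mu.

Definition sleb3 : {sigma_finite_measure set (mR * mR * mR)%type -> \bar R} :=
  sprod leb2 mu.

Lemma leb2X (A B : set mR) : measurable A -> measurable B ->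
  (leb2 (A `*` B) = mu A * mu B)%E.
Proof. exact: product_measure1E. Qed.

Lemma leb3X (A : set (mR * mR)) (B : set mR) : measurable A -> measurable B ->
  (leb3 (A `*` B) = leb2 A * mu B)%E.
Proof. exact: (@product_measure1E _ _ _ _ _ leb2 mu). Qed.

Lemma integral_leb2 (F : mR * mR -> \bar R) :
  measurable_fun setT F -> (forall x, 0 <= F x)%E ->
  (\int[leb2]_x F x = \int[mu]_s \int[mu]_t F (s, t))%E.
Proof. by move=> mF F0; exact: (@fubini_tonelli1 _ _ _ _ R mu mu F mF F0). Qed.

Lemma measurable_integral_leb2 (F : mR * mR -> \bar R) :
  measurable_fun setT F -> (forall x, 0 <= F x)%E ->
  measurable_fun setT (fun s => \int[mu]_t F (s, t))%E.
Proof.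
move=> mF F0.
exact: (@measurable_fun_fubini_tonelli_F _ _ _ _ R mu F mF F0).
Qed.

Lemma integral_leb3 (F : mR * mR * mR -> \bar R) :
  measurable_fun setT F -> (forall x, 0 <= F x)%E ->
  (\int[leb3]_x F x = \int[leb2]_w \int[mu]_z F (w, z))%E.
Proof. by move=> mF F0; exact: (@fubini_tonelli1 _ _ _ _ R leb2 mu F mF F0). Qed.

Lemma integral_leb3_slices (F : mR * mR * mR -> \bar R) :
  measurable_fun setT F -> (forall x, 0 <= F x)%E ->
  (\int[leb3]_x F x = \int[mu]_z \int[leb2]_w F (w, z))%E.
Proof. by move=> mF F0; exact: (@fubini_tonelli2 _ _ _ _ R leb2 mu F mF F0). Qed.

Lemma measurable_integral_leb3 (F : mR * mR * mR -> \bar R) :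
  measurable_fun setT F -> (forall x, 0 <= F x)%E ->
  measurable_fun setT (fun w => \int[mu]_z F (w, z))%E.
Proof.
move=> mF F0.
exact: (@measurable_fun_fubini_tonelli_F _ _ _ _ R mu F mF F0).
Qed.

Lemma measurable_slices_leb3 (F : mR * mR * mR -> \bar R) :
  measurable_fun setT F -> (forall x, 0 <= F x)%E ->
  measurable_fun setT (fun z => \int[leb2]_w F (w, z))%E.
Proof.
move=> mF F0.
exact: (@measurable_fun_fubini_tonelli_G _ _ _ _ R leb2 F mF F0).
Qed.

Lemma measurable_affine2 (k b1 b2 : R) :
  measurable_fun setT
    (fun x : mR * mR => (k * x.1 + b1, k * x.2 + b2) : mR * mR).
Proof.
apply/measurable_fun_pair.
  exact: (measurableT_comp (measurable_affine k b1) measurable_fst).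
exact: (measurableT_comp (measurable_affine k b2) measurable_snd).
Qed.

Lemma measurable_affine3 (k b1 b2 b3 : R) :
  measurable_fun setT
    (fun x : mR * mR * mR =>
      (k * x.1.1 + b1, k * x.1.2 + b2, k * x.2 + b3) : mR * mR * mR).
Proof.
apply/measurable_fun_pair.
  exact: (measurableT_comp (measurable_affine2 k b1 b2) measurable_fst).
exact: (measurableT_comp (measurable_affine k b3) measurable_snd).
Qed.

Lemma ge0_integral_affine2 (k b1 b2 : R) (F : mR * mR -> \bar R) :
  k != 0 -> measurable_fun setT F -> (forall x, 0 <= F x)%E ->
  (\int[leb2]_x F x =
   (`|k| ^+ 2)%:E * \int[leb2]_x F (k * x.1 + b1, k * x.2 + b2)%R)%E.
Proof.
move=> k0 mF F0.
pose G x := F (k * x.1 + b1, k * x.2 + b2).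
have mG : measurable_fun setT G := measurableT_comp mF (measurable_affine2 k b1 b2).
have G0 x : (0 <= G x)%E by exact: F0.
rewrite (integral_leb2 mF F0) (integral_leb2 mG G0).
rewrite (@ge0_integral_affine R k b1 _ k0 (measurable_integral_leb2 mF F0)); last first.
  by move=> x; apply: integral_ge0 => y _.
have -> : (\int[mu]_s \int[mu]_t F (k * s + b1, t)%R =
           \int[mu]_s (`|k|%:E * \int[mu]_t G (s, t)))%E.
  apply: eq_integral => s _.
  by apply: (@ge0_integral_affine R k b2 (fun t => F (k * s + b1, t)) k0) => //;
     exact/measurable_fun_pair2.
rewrite (ge0_integralZl_EFin _ _ _ (measurable_integral_leb2 mG G0))//.
  by rewrite muleA -EFinM expr2.
by move=> x _; apply: integral_ge0 => y _.
Qed.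

Lemma ge0_integral_affine3 (k b1 b2 b3 : R) (F : mR * mR * mR -> \bar R) :
  k != 0 -> measurable_fun setT F -> (forall x, 0 <= F x)%E ->
  (\int[leb3]_x F x = (`|k| ^+ 3)%:E *
   \int[leb3]_x F (k * x.1.1 + b1, k * x.1.2 + b2, k * x.2 + b3)%R)%E.
Proof.
move=> k0 mF F0.
pose G x := F (k * x.1.1 + b1, k * x.1.2 + b2, k * x.2 + b3).
have mG : measurable_fun setT G :=
  measurableT_comp mF (measurable_affine3 k b1 b2 b3).
have G0 x : (0 <= G x)%E by exact: F0.
rewrite (integral_leb3 mF F0) (integral_leb3 mG G0).
rewrite (@ge0_integral_affine2 k b1 b2 _ k0 (measurable_integral_leb3 mF F0)); last first.
  by move=> x; apply: integral_ge0 => y _.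
have -> : (\int[leb2]_w \int[mu]_t F (k * w.1 + b1, k * w.2 + b2, t)%R =
           \int[leb2]_w (`|k|%:E * \int[mu]_t G (w, t)))%E.
  apply: eq_integral => s _.
  by apply: (@ge0_integral_affine R k b3
    (fun t => F (k * s.1 + b1, k * s.2 + b2, t)) k0) => //;
     exact/measurable_fun_pair2.
rewrite (ge0_integralZl_EFin _ _ _ (measurable_integral_leb3 mG G0))//.
  by rewrite muleA -EFinM -exprSr.
by move=> x _; apply: integral_ge0 => y _.
Qed.

End affine23.

(** * The plane measure of disks *)

Section disk.
Context {R : realType}.
Local Notation mu := (@lebesgue_measure R).
Local Notation mR := (measurableTypeR R).

Definition sqn2 (x : mR * mR) : mR := x.1 ^+ 2 + x.2 ^+ 2.

Lemma measurable_sqn2 : measurable_fun setT sqn2.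
Proof.
by apply: measurable_funD; apply: measurable_funX;
  [exact: measurable_fst|exact: measurable_snd].
Qed.

Lemma sqn2_ge0 x : 0 <= sqn2 x.
Proof. by rewrite addr_ge0// sqr_ge0. Qed.

Definition disk (w : R) : set (mR * mR) := [set x | sqn2 x <= w].

Lemma measurable_disk w : measurable (disk w).
Proof.
rewrite (_ : disk w = setT `&` sqn2 @^-1` `]-oo, w]%classic); last first.
  by rewrite setTI; apply/seteqP; split=> x; rewrite /disk /= in_itv.
exact: measurable_sqn2.
Qed.

(** The number pi, kept abstract: it cancels between the potential and the volume
of a ball. *)
Definition disk_area : R := fine (leb2 (disk 1)).

Lemma disk_lty : (leb2 (disk 1) < +oo)%E.
Proof.
have sub : disk 1 `<=` `[(-1)%R : R, 1%R]%classic `*` `[(-1)%R, 1%R]%classic.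
  move=> [s t]; rewrite /disk /sqn2 /= => H.
  by split; rewrite /= in_itv /=; apply/andP; split; nra.
apply: (@le_lt_trans _ _ (leb2 (`[(-1)%R : R, 1%R]%classic `*` `[(-1)%R, 1%R]%classic))).
  by apply: le_measure => //; rewrite inE;
    [exact: measurable_disk|exact: measurableX].
rewrite leb2X// !lebesgue_measure_itv /= lte_fin.
by case: ifPn => _; rewrite ?mule0// -EFinD -EFinM ltry.
Qed.

Lemma disk_areaE : leb2 (disk 1) = disk_area%:E.
Proof. by rewrite fineK// ge0_fin_numE// disk_lty. Qed.

Lemma disk_area_gt0 : 0 < disk_area.
Proof.
rewrite -lte_fin -disk_areaE.
have sub : `[0%R : R, 2^-1%R]%classic `*` `[0%R, 2^-1%R]%classic `<=` disk 1.
  move=> [s t] [] /=; rewrite !in_itv /= => /andP[a b] /andP[c d].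
  by rewrite /disk /sqn2 /=; nra.
apply: (@lt_le_trans _ _ (leb2 (`[0%R : R, 2^-1%R]%classic `*` `[0%R, 2^-1%R]%classic))).
  rewrite leb2X// !lebesgue_measure_itv /= lte_fin.
  have h : 0 < 2^-1 :> R by lra.
  by rewrite h -EFinD -EFinM lte_fin subr0 mulr_gt0.
by apply: le_measure => //; rewrite inE;
  [exact: measurableX|exact: measurable_disk].
Qed.

Lemma disk_scale w : 0 < w -> leb2 (disk w) = (w * disk_area)%:E.
Proof.
move=> w0.
have s0 : 0 < Num.sqrt w by rewrite sqrtr_gt0.
rewrite -[disk w]setIT -integral_indic//; last exact: measurable_disk.
have m1 : measurable_fun setT (fun x : mR * mR => (\1_(disk w) x)%:E : \bar R).
  by apply/measurable_EFinP/measurable_indic; exact: measurable_disk.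
rewrite (@ge0_integral_affine2 R (Num.sqrt w) 0 0 _ _ m1)//; last by rewrite gt_eqF.
rewrite -normrX (sqr_sqrtr (ltW w0)) gtr0_norm//.
have -> : (\int[leb2]_x (\1_(disk w) (Num.sqrt w * x.1 + 0, Num.sqrt w * x.2 + 0)%R)%:E
  = \int[leb2]_x (\1_(disk 1) x)%:E)%E.
  apply: eq_integral => x _; congr EFin; rewrite !indicE; congr ((nat_of_bool _)%:R).
  apply/idP/idP; rewrite !inE /disk /sqn2 /= !addr0 !exprMn (sqr_sqrtr (ltW w0)) => H.
    by rewrite -(ler_pM2l w0) mulr1 mulrDr.
  by rewrite -mulrDr -[leRHS]mulr1 ler_pM2l.
have -> : (\int[leb2]_x (\1_(disk 1) x)%:E = leb2 (disk 1))%E.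
  by rewrite integral_indic// ?setIT//; exact: measurable_disk.
by rewrite disk_areaE -EFinM.
Qed.

(** A limit of the scaling law, which itself says nothing at radius 0. *)
Lemma disk0 : leb2 (disk 0) = 0%E.
Proof.
apply/eqP; rewrite eq_le measure_ge0 andbT.
apply/lee_addgt0Pr => e e0; rewrite add0e.
have a0 := disk_area_gt0.
have e0' : 0 < e / disk_area by rewrite divr_gt0.
apply: (@le_trans _ _ (leb2 (disk (e / disk_area)))); last first.
  by rewrite disk_scale// lee_fin divfK// gt_eqF.
apply: le_measure; rewrite ?inE; [exact: measurable_disk|exact: measurable_disk|].
by move=> x; rewrite /disk /= => /le_trans; apply; exact: ltW.
Qed.

Lemma disk_measure w : leb2 (disk w) = (Num.max w 0 * disk_area)%:E.
Proof.
case: (ltP 0 w) => w0; first by rewrite disk_scale.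
rewrite mul0r; apply/eqP; rewrite eq_le measure_ge0 andbT -[leRHS]disk0.
apply: le_measure; rewrite ?inE; [exact: measurable_disk|exact: measurable_disk|].
by move=> x; rewrite /disk /= => /le_trans; exact.
Qed.

Lemma annulus_measure a b : a < b ->
  leb2 (sqn2 @^-1` `]a, b]%classic) =
  ((Num.max b 0 - Num.max a 0) * disk_area)%:E.
Proof.
move=> ab.
have -> : sqn2 @^-1` `]a, b]%classic = disk b `\` disk a.
  apply/seteqP; split=> x; rewrite /disk /= !in_itv /=.
    by move=> /andP[h1 h2]; split => //; apply/negP; rewrite -ltNge.
  by move=> [h1 /negP]; rewrite -ltNge => ->.
have mb := measurable_disk b; have ma := measurable_disk a.
have -> : (leb2 (disk b `\` disk a) = leb2 (disk b) - leb2 (disk b `&` disk a))%E.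
  by apply: measureD => //; rewrite [ltLHS]disk_measure ltry.
rewrite setIidr; last first.
  by move=> x; rewrite /disk /= => /le_trans; apply; exact: ltW.
by rewrite !disk_measure -EFinB mulrBl.
Qed.

(** Measures the part of an interval that the squared radius never reaches; see
[sqn2_pushforward]. *)
Lemma lebesgue_neg_part (x y : R) : x < y ->
  mu (`]x, y]%classic `&` `]-oo, 0%R[%classic) =
  (Num.min y 0 - Num.min x 0)%:E.
Proof.
move=> xy; case: (ltP x 0) => x0; case: (ltP y 0) => y0.
- rewrite (_ : `]x, y] `&` `]-oo, 0%R[ = `]x, y]%classic); last first.
    by apply/setIidl => z; rewrite /= !in_itv /= => /andP[_ zy]; exact: le_lt_trans y0.
  by rewrite lebesgue_measure_itv /= lte_fin xy EFinB.
- rewrite (_ : `]x, y] `&` `]-oo, 0%R[ = `]x, 0[%classic); last first.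
    apply/seteqP; split=> z /=; rewrite !in_itv /=; first by move=> [/andP[-> _] ->].
    by move=> /andP[-> z0]; rewrite z0 (le_trans (ltW z0)).
  by rewrite lebesgue_measure_itv /= lte_fin x0 EFinB.
- by exfalso; lra.
- rewrite (_ : `]x, y] `&` `]-oo, 0%R[ = set0) ?measure0 ?subrr//.
  rewrite -subset0 => z [] /=; rewrite !in_itv /= => /andP[xz _] z0; exfalso; lra.
Qed.

(** Under the squared radius, the plane measure becomes a multiple of Lebesgue
measure on the half-line: this is polar coordinates, without angles. *)
Lemma sqn2_pushforward (A : set mR) : measurable A -> A `<=` `[0, +oo[ ->
  leb2 (sqn2 @^-1` A) = (disk_area%:E * mu A)%E.
Proof.
move=> mA A0.
pose nu := pushforward leb2 sqn2.
have k0' : 0 <= disk_area^-1 by rewrite invr_ge0 ltW// disk_area_gt0.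
pose kn := NngNum k0'.
have mN : measurable (`]-oo, 0[%classic : set mR) by [].
(* Uniqueness of Lebesgue measure is a statement about the whole line; the
   restriction to the negative half-line completes the pushforward. *)
pose lam := measure_add (mscale kn nu) (mrestr mu mN).
have lamE X : lam measurable_sqn2 X =
    (disk_area^-1%:E * leb2 (sqn2 @^-1` X) + mu (X `&` `]-oo, 0%R[%classic))%E.
  exact: measure_addE.
have E : mu A = lam measurable_sqn2 A.
  apply: lebesgue_measure_unique => // _ [[x y]] _ <-.
  rewrite [RHS]lamE.
  have [xy|yx] := ltP x y; last first.
    by rewrite set_itv_ge ?bnd_simp -?leNgt// set0I preimage_set0 !measure0 mule0 adde0.
  rewrite lebesgue_neg_part// annulus_measure// -EFinM.
  have -> : (disk_area^-1 * ((Num.max y 0 - Num.max x 0) * disk_area))%R =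
    Num.max y 0 - Num.max x 0.
    by rewrite mulrC mulfK// gt_eqF// disk_area_gt0.
  rewrite lebesgue_measure_itv /= lte_fin xy -EFinB -EFinD; congr EFin.
  by case: (ltP x 0) => x0; case: (ltP y 0) => y0; lra.
rewrite E lamE.
rewrite (_ : A `&` _ = set0) ?measure0 ?adde0; last first.
  rewrite -subset0 => z [/A0] /=; rewrite !in_itv /= andbT => z0.
  by rewrite ltNge z0.
rewrite muleA -EFinM mulfV ?mul1e//.
by rewrite gt_eqF// disk_area_gt0.
Qed.

End disk.

(** * Radial integration and slices of balls *)

Section radial.
Context {R : realType}.
Local Notation mu := (@lebesgue_measure R).
Local Notation mR := (measurableTypeR R).

Lemma integral_radial2 (h : mR -> \bar R) :
  measurable_fun setT h -> (forall x, 0 <= h x)%E ->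
  (\int[leb2]_x h (sqn2 x) =
   disk_area%:E * \int[mu]_(w in `[0%R, +oo[) h w)%E.
Proof.
move=> mh h0.
have mD : measurable (`[0%R, +oo[%classic : set mR) by [].
have k0 : 0 <= @disk_area R by rewrite ltW// disk_area_gt0.
pose kn := NngNum k0.
have H1 := @ge0_integral_mscale _ _ R mu _ mD kn h (measurable_funTS mh)
  (fun x _ => h0 x).
have H2 := @ge0_integral_pushforward _ _ _ _ R sqn2 measurable_sqn2 leb2 _ h mD
  (measurable_funTS mh) (fun x _ => h0 x).
rewrite -[RHS]H1.
transitivity (\int[leb2]_(x in sqn2 @^-1` `[0%R, +oo[) (h \o sqn2) x)%E.
  congr integral; apply/seteqP; split => // x _.
  by rewrite /= in_itv /= andbT sqn2_ge0.
rewrite -[LHS]H2; apply: eq_measure_integral => [|A mA AS]; first exact: measurable_sqn2.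
exact: sqn2_pushforward.
Qed.

Lemma FTC_continuous (f F : R -> R) (a b : R) : a <= b ->
  continuous f -> continuous F ->
  (forall x : R, a < x < b -> is_derive x 1 F (f x)) ->
  (\int[mu]_(x in `[a, b]) (f x)%:E = (F b - F a)%:E)%E.
Proof.
rewrite le_eqVlt => /predU1P[-> _ _ _|ab cf cF dF].
  by rewrite set_itv1 integral_set1 subrr.
rewrite (@continuous_FTC2 _ f F)//.
- exact: continuous_subspaceT.
- split.
  + by move=> x; rewrite in_itv /= => /dF[].
  + exact/cvg_at_right_filter/cF.
  + exact/cvg_at_left_filter/cF.
- by move=> x; rewrite in_itv /= => /dF ?; rewrite derive1E; exact: derive_val.
Qed.

Lemma continuous_sqrt_affine (k b : R) : continuous (fun x : R => Num.sqrt (k * x + b)).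
Proof.
move=> x; apply: continuous_comp; last exact: sqrt_continuous.
by apply: cvgD; [apply: cvgM; [exact: cvg_cst|exact: cvg_id]|exact: cvg_cst].
Qed.

Lemma is_derive_sqrt_affine (k b x : R) : 0 < k * x + b ->
  is_derive x 1 (fun x : R => Num.sqrt (k * x + b)) (k / (2 * Num.sqrt (k * x + b))).
Proof.
move=> h.
have H := is_derive1_sqrt h.
have G : is_derive x 1 (fun x : R => k * x + b) k.
  by apply: is_derive_eq; rewrite addr0 /GRing.scale /= mulr1.
have := @is_derive1_comp R Num.sqrt (fun x : R => k * x + b) x _ _ H G.
by rewrite mulrC.
Qed.

(** Inversion is discontinuous at 0, hence the detour by the power function of
exponent -1. *)
Lemma measurable_inv d (T : measurableType d) (f : T -> R) :
  (forall x, 0 <= f x) -> measurable_fun setT f ->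
  measurable_fun setT (fun x => (f x)^-1).
Proof.
move=> f0 mf.
rewrite (_ : (fun x => (f x)^-1) = (fun x => f x `^ (-1))); last first.
  by apply/funext => x; rewrite powR_inv1.
exact: (measurableT_comp (@measurable_powR R (-1)) mf).
Qed.

Lemma measurable_sqrt d (T : measurableType d) (f : T -> R) :
  measurable_fun setT f -> measurable_fun setT (fun x => Num.sqrt (f x)).
Proof.
exact: (measurableT_comp (continuous_measurable_fun (@sqrt_continuous R))).
Qed.

(** The primitive of (w + d^2)^(-1/2) is 2 (w + d^2)^(1/2).  The variable w is the
squared distance to the axis. *)
Lemma integral_inv_sqrt (W d : R) : d != 0 ->
  (\int[mu]_(w in `[0%R, +oo[)
    (\1_(`]-oo, W[%classic : set R) w * (Num.sqrt (w + d ^+ 2))^-1)%:E =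
   (if 0 < W then 2 * (Num.sqrt (W + d ^+ 2) - `|d|) else 0)%:E)%E.
Proof.
move=> d0.
have d2 : 0 < d ^+ 2 by rewrite exprn_even_gt0.
have [W0|W0] := ltP 0 W; last first.
  apply: integral0_eq => w; rewrite /= in_itv /= andbT => w0.
  rewrite indicE memNset ?mul0r// /= in_itv /= => wW; lra.
(* The absolute value makes the integrand continuous on the whole line. *)
transitivity (\int[mu]_(w in `[0%R, W]) (Num.sqrt (`|w| + d ^+ 2))^-1%:E)%E.
  transitivity (\int[mu]_(w in `[0%R, W[) (Num.sqrt (`|w| + d ^+ 2))^-1%:E)%E; last first.
    apply: integral_itv_bndo_bndc.
    apply/measurable_EFinP/measurable_funTS/measurable_inv => [x|].
      exact: sqrtr_ge0.
    apply: measurable_sqrt; apply: measurable_funD.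
      exact: normr_measurable.
    exact: measurable_cst.
  rewrite integral_mkcond [in RHS]integral_mkcond.
  apply: eq_integral => w _; rewrite /patch !mem_setE !in_itv /= andbT.
  have [w0|w0] //= := leP 0 w.
  rewrite indicE mem_setE in_itv /=.
  by case: ifP => wW; rewrite ?mul1r ?mul0r// ger0_norm.
pose F := fun w => 2 * Num.sqrt (1 * w + d ^+ 2).
transitivity (F W - F 0)%:E; last first.
  by rewrite /F mul1r mulr0 add0r sqrtr_sqr mulrBr.
apply: FTC_continuous.
- exact: ltW.
- move=> w; apply: cvgV.
    by rewrite gt_eqF// sqrtr_gt0; apply: (lt_le_trans d2); rewrite lerDr.
  apply: continuous_comp; last exact: sqrt_continuous.
  by apply: cvgD; [exact: norm_continuous|exact: cvg_cst].
- move=> w; apply: cvgM; first exact: cvg_cst.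
  exact: continuous_sqrt_affine.
- move=> w /andP[w0 wW].
  have h : 0 < 1 * w + d ^+ 2 by lra.
  have H := is_derive_sqrt_affine h.
  rewrite /F; apply: is_derive_eq; rewrite mul1r ger0_norm ?(ltW w0)//.
  have s0 : Num.sqrt (w + d ^+ 2) != 0 by rewrite gt_eqF// sqrtr_gt0; lra.
  by rewrite mul1r /GRing.scale /= invfM mulrA divff ?mul1r ?pnatr_eq0.
Qed.

Lemma measurable_enorm d (T : measurableType d) (f : T -> R3 R) :
  measurable_fun setT (fun x => (f x).1.1 : R) ->
  measurable_fun setT (fun x => (f x).1.2 : R) ->
  measurable_fun setT (fun x => (f x).2 : R) ->
  measurable_fun setT (fun x => enorm (f x)).
Proof.
move=> m1 m2 m3; apply: measurable_sqrt.
by apply: measurable_funD; [apply: measurable_funD|]; exact: measurable_funX.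
Qed.

Lemma measurable_fst1 : measurable_fun setT (fun x : mR * mR * mR => x.1.1).
Proof. exact: (measurableT_comp measurable_fst measurable_fst). Qed.

Lemma measurable_fst2 : measurable_fun setT (fun x : mR * mR * mR => x.1.2).
Proof. exact: (measurableT_comp measurable_snd measurable_fst). Qed.

Lemma measurable_enorm_id : measurable_fun setT (fun x : mR * mR * mR => enorm x).
Proof.
by apply: (@measurable_enorm _ (mR * mR * mR)%type (fun x => x));
  [exact: measurable_fst1|exact: measurable_fst2|exact: measurable_snd].
Qed.

Lemma enorm_ge0 (x : R3 R) : 0 <= enorm x.
Proof. exact: sqrtr_ge0. Qed.

Lemma measurable_eball (r : R) : measurable (eball r : set (mR * mR * mR)).
Proof.
rewrite (_ : eball r = setT `&` (@enorm R) @^-1` `]-oo, r[%classic); last first.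
  by rewrite setTI; apply/seteqP; split=> x; rewrite /eball /= in_itv.
by apply: measurable_enorm_id.
Qed.

(** Horizontal slices of a ball are disks. *)
Lemma sqn2_eball (r : R) (w : R * R) (z : R) : 0 < r ->
  eball r (w, z) <-> sqn2 w < r ^+ 2 - z ^+ 2.
Proof.
move=> r0; rewrite /eball /enorm /sqn2 /=.
have s0 : 0 <= w.1 ^+ 2 + w.2 ^+ 2 + z ^+ 2 by rewrite !addr_ge0// sqr_ge0.
rewrite ltrBrDr -(ltr_pXn2r (n := 2)) ?nnegrE ?sqrtr_ge0 ?(ltW r0)//.
by rewrite sqr_sqrtr.
Qed.

Lemma measurable_ball_kernel (r : R) (x : R3 R) :
  measurable_fun setT (fun y : mR * mR * mR =>
    (\1_(eball r) y * (enorm (x - y : R3 R))^-1)%:E : \bar R).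
Proof.
apply/measurable_EFinP/measurable_funM.
  by apply: measurable_indic; exact: measurable_eball.
apply: measurable_inv => [y|]; first exact: enorm_ge0.
apply: (@measurable_enorm _ (mR * mR * mR)%type (fun y => x - y : R3 R)) => /=;
  (apply: measurable_funB; first exact: measurable_cst).
- exact: measurable_fst1.
- exact: measurable_fst2.
- exact: measurable_snd.
Qed.

Lemma ball_kernel_ge0 (r : R) (x y : R3 R) :
  (0 <= (\1_(eball r) y * (enorm (x - y))^-1)%:E)%E.
Proof. by rewrite lee_fin mulr_ge0// ?invr_ge0 ?enorm_ge0// indicE. Qed.

(** On the plane at height z the kernel of a point of the axis depends only on the
distance to the axis, so the slice integral is one-dimensional and elementary.
The plane z = a, excluded here, is a null set. *)
Lemma ball_slice (r a z : R) : 0 < r -> z != a -> z ^+ 2 < r ^+ 2 ->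
  (\int[leb2]_w (\1_(eball r) (w, z) *
      (enorm ((0%R, 0%R, a) - (w, z) : R3 R))^-1)%:E =
   (disk_area * (2 * (Num.sqrt ((- (2 * a)) * z + (r ^+ 2 + a ^+ 2)) - `|a - z|)))%:E)%E.
Proof.
move=> r0 za zr.
have az : a - z != 0 by rewrite subr_eq0 eq_sym.
pose h (v : mR) := (\1_(`]-oo, (r ^+ 2 - z ^+ 2)%R[%classic : set R) v *
  (Num.sqrt (v + (a - z) ^+ 2))^-1)%:E.
transitivity (\int[leb2]_w h (sqn2 w))%E.
  apply: eq_integral => w _; congr EFin; rewrite /h; congr (_ * _).
    rewrite !indicE; congr ((nat_of_bool _)%:R).
    apply/idP/idP; rewrite !inE /= in_itv /=.
      by move/(sqn2_eball _ _ r0).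
    by case: w => ? ? H; apply/(sqn2_eball _ _ r0).
  by rewrite /enorm /= /sqn2 !sub0r !sqrrN.
rewrite integral_radial2//; last 2 first.
- apply/measurable_EFinP/measurable_funM; first exact: measurable_indic.
  apply: measurable_inv => [v|]; first exact: sqrtr_ge0.
  by apply: measurable_sqrt; apply: measurable_funD => //; exact: measurable_cst.
- by move=> v; rewrite lee_fin mulr_ge0// ?invr_ge0 ?sqrtr_ge0// indicE.
rewrite integral_inv_sqrt// -EFinM; congr EFin; congr (_ * _).
by rewrite subr_gt0 zr; congr (2 * (Num.sqrt _ - _)); ring.
Qed.

Lemma ball_slice_out (r a z : R) : 0 < r -> r ^+ 2 <= z ^+ 2 ->
  (\int[leb2]_w (\1_(eball r) (w, z) *
      (enorm ((0%R, 0%R, a) - (w, z) : R3 R))^-1)%:E = 0)%E.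
Proof.
move=> r0 zr; apply: integral0_eq => w _.
rewrite indicE memNset ?mul0r//= => /(sqn2_eball _ _ r0).
by have := sqn2_ge0 w; lra.
Qed.

Lemma integral_slab (r : R) (f : R -> R) : 0 < r -> measurable_fun setT f ->
  (\int[mu]_z (if (z ^+ 2 < r ^+ 2)%R then f z else 0%R)%:E =
   \int[mu]_(z in `[(- r)%R, r]) (f z)%:E)%E.
Proof.
move=> r0 mf; rewrite [RHS]integral_itv_bndoo; last first.
  exact/measurable_EFinP/measurable_funTS.
rewrite [RHS]integral_mkcond; apply: eq_integral => z _.
rewrite /patch mem_setE in_itv /=.
have -> : (z ^+ 2 < r ^+ 2) = (- r < z < r).
  by rewrite -ltr_norml -[RHS](@ltr_pXn2r _ 2) ?nnegrE ?(ltW r0)// real_normK// num_real.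
by case: ifP.
Qed.

Definition ball_vol (r : R) : R := disk_area * (4 / 3) * r ^+ 3.

Lemma eball_measure (r : R) : 0 < r -> leb3 (eball r) = (ball_vol r)%:E.
Proof.
move=> r0.
have mI : measurable_fun setT (fun y : mR * mR * mR => (\1_(eball r) y)%:E : \bar R).
  by apply/measurable_EFinP; apply: measurable_indic; exact: measurable_eball.
have -> : (leb3 (eball r) = \int[leb3]_y (\1_(eball r) y)%:E)%E.
  by rewrite integral_indic ?setIT//; exact: measurable_eball.
have I0 (y : mR * mR * mR) : (0 <= (\1_(eball r) y)%:E :> \bar R)%E.
  by rewrite lee_fin indicE.
rewrite (integral_leb3_slices mI I0).
transitivity (\int[mu]_z (disk_area%:E * (if (z ^+ 2 < r ^+ 2)%R then (r ^+ 2 - z ^+ 2)%R else 0%R)%:E))%E.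
  apply: eq_integral => z _.
  pose h (v : mR) : \bar R := (\1_(`]-oo, (r ^+ 2 - z ^+ 2)%R[%classic : set R) v)%:E.
  transitivity (\int[leb2]_w h (sqn2 w))%E.
    apply: eq_integral => w _; congr EFin; rewrite /h.
    rewrite !indicE; congr ((nat_of_bool _)%:R).
    apply/idP/idP; rewrite !inE /= in_itv /=.
      by move/(sqn2_eball _ _ r0).
    by case: w => ? ? H; apply/(sqn2_eball _ _ r0).
  rewrite integral_radial2//; last 2 first.
  - by apply/measurable_EFinP; exact: measurable_indic.
  - by move=> v; rewrite lee_fin indicE.
  congr (_ * _)%E; rewrite /h integral_indic//.
  have [zr|zr] := ltP (z ^+ 2) (r ^+ 2).
    rewrite (_ : _ `&` _ = `[0, r ^+ 2 - z ^+ 2[%classic); last first.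
      apply/seteqP; split=> v /=; rewrite !in_itv /= andbT; first by move=> [-> ->].
      by move=> /andP[-> ->].
    by rewrite [LHS]lebesgue_measure_itv /= lte_fin subr_gt0 zr sube0.
  rewrite (_ : _ `&` _ = set0) ?measure0//.
  rewrite -subset0 => v [] /=; rewrite !in_itv /= andbT; lra.
rewrite ge0_integralZl_EFin//; last 3 first.
- by move=> z _; case: ifP => // zr; rewrite lee_fin subr_ge0 ltW.
- apply/measurable_EFinP.
  apply: measurable_fun_ifT => //.
    exact: measurable_fun_ltr.
  by apply: measurable_funB; [exact: measurable_cst|exact: exprn_measurable].
- by rewrite ltW// disk_area_gt0.
rewrite (@integral_slab r (fun z => r ^+ 2 - z ^+ 2) r0); last first.
  by apply: measurable_funB; [exact: measurable_cst|exact: exprn_measurable].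
pose F (z : R) := r ^+ 2 * z - 3^-1 * z ^+ 3.
rewrite (_ : (\int[mu]_(z in _) _)%E = (F r - F (- r))%:E).
  by rewrite -EFinM /F /ball_vol; congr EFin; field.
apply: FTC_continuous.
- by lra.
- by move=> z; apply: cvgB; [exact: cvg_cst|exact: exprn_continuous].
- move=> z; apply: cvgB; (apply: cvgM; first exact: cvg_cst).
    exact: cvg_id.
  exact: exprn_continuous.
- move=> z _; rewrite /F; apply: is_derive_eq.
  by rewrite /GRing.scale /=; field.
Qed.

End radial.

(** * The potential of a ball *)

Section ball_potential.
Context {R : realType}.
Local Notation mu := (@lebesgue_measure R).
Local Notation mR := (measurableTypeR R).

Definition axis (a : R) : R3 R := (0, 0, a).

Definition ball_pot (r : R) (x : R3 R) : \bar R :=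
  (\int[leb3]_y (\1_(eball r) y * (enorm (x - y))^-1)%:E)%E.

Let prim (r a z : R) : R :=
  2 * (- ((3 * a)^-1 * ((- (2 * a) * z + (r ^+ 2 + a ^+ 2)) *
     Num.sqrt (- (2 * a) * z + (r ^+ 2 + a ^+ 2)))) - a * z + 2^-1 * z ^+ 2).

Let dens (r a z : R) : R :=
  2 * (Num.sqrt (- (2 * a) * z + (r ^+ 2 + a ^+ 2)) - (a - z)).

Lemma dens_ge (r a z : R) : 0 < r -> 0 < a -> z ^+ 2 < r ^+ 2 ->
  `|a - z| <= Num.sqrt (- (2 * a) * z + (r ^+ 2 + a ^+ 2)).
Proof.
move=> r0 a0 zr; rewrite -sqrtr_sqr ler_sqrt; last first.
  by have := sqr_ge0 (a - z); lra.
by lra.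
Qed.

Lemma continuous_dens r a : continuous (dens r a).
Proof.
move=> z; apply: cvgM; first exact: cvg_cst.
apply: cvgB; first exact: continuous_sqrt_affine.
by apply: cvgB; [exact: cvg_cst|exact: cvg_id].
Qed.

Lemma integral_dens (r a : R) : 0 < r -> 0 < a ->
  (\int[mu]_(z in `[(- r)%R, r]) (dens r a z)%:E = (prim r a r - prim r a (- r))%:E)%E.
Proof.
move=> r0 a0; apply: FTC_continuous.
- by lra.
- exact: continuous_dens.
- move=> z; apply: cvgM; first exact: cvg_cst.
  apply: cvgD; last by apply: cvgM; [exact: cvg_cst|exact: exprn_continuous].
  apply: cvgB; last by apply: cvgM; [exact: cvg_cst|exact: cvg_id].
  apply: cvgN; apply: cvgM; first exact: cvg_cst.
  apply: cvgM; last exact: continuous_sqrt_affine.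
  by apply: cvgD; [apply: cvgM; [exact: cvg_cst|exact: cvg_id]|exact: cvg_cst].
- move=> z /andP[rz zr].
  have zr2 : z ^+ 2 < r ^+ 2 by nra.
  have h : 0 < - (2 * a) * z + (r ^+ 2 + a ^+ 2) by have := sqr_ge0 (a - z); lra.
  have H := is_derive_sqrt_affine h.
  rewrite /prim; apply: is_derive_eq.
  rewrite /dens /GRing.scale /=.
  set s := Num.sqrt _.
  have sE : - (2 * a) * z + (r ^+ 2 + a ^+ 2) = s ^+ 2 by rewrite sqr_sqrtr ?ltW.
  have s0 : s != 0 by rewrite gt_eqF// sqrtr_gt0.
  have a0' : a != 0 by rewrite gt_eqF.
  by rewrite sE; field; rewrite s0 a0'.
Qed.

Lemma prim_diff (r a : R) : 0 < r -> 0 < a ->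
  prim r a r - prim r a (- r) =
  2 * ((3 * a)^-1 * ((r + a) ^+ 3 - (r - a) ^+ 2 * `|r - a|) - 2 * a * r).
Proof.
move=> r0 a0; rewrite /prim.
have -> : - (2 * a) * r + (r ^+ 2 + a ^+ 2) = (r - a) ^+ 2 by ring.
have -> : - (2 * a) * - r + (r ^+ 2 + a ^+ 2) = (r + a) ^+ 2 by ring.
rewrite !sqrtr_sqr (@ger0_norm _ (r + a)) ?addr_ge0 ?ltW//.
by field; rewrite gt_eqF.
Qed.

Lemma prim_le (r a : R) : 0 < r -> 0 < a ->
  prim r a r - prim r a (- r) <= 4 / 3 * r ^+ 3 / a.
Proof.
move=> r0 a0; rewrite prim_diff// ler_pdivlMr//.
have a0' : a != 0 by rewrite gt_eqF.
have [ra|ar] := leP r a.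
  rewrite ler0_norm ?subr_le0// le_eqVlt; apply/orP; left; apply/eqP.
  by field.
rewrite gtr0_norm ?subr_gt0// -subr_ge0.
rewrite [leRHS](_ : _ = 4 / 3 * (r - a) ^+ 3); last by field.
by rewrite mulr_ge0// exprn_ge0// subr_ge0 ltW.
Qed.

Lemma prim_eq (r a : R) : 0 < r -> r <= a ->
  prim r a r - prim r a (- r) = 4 / 3 * r ^+ 3 / a.
Proof.
move=> r0 ra; have a0 : 0 < a by lra.
rewrite prim_diff// ler0_norm ?subr_le0//.
by field; rewrite gt_eqF.
Qed.

Lemma ball_potE (r a : R) :
  (ball_pot r (axis a) = \int[mu]_z \int[leb2]_w (\1_(eball r) (w, z) *
      (enorm ((0%R, 0%R, a) - (w, z) : R3 R))^-1)%:E)%E.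
Proof.
exact: (integral_leb3_slices (measurable_ball_kernel r (axis a))
  (ball_kernel_ge0 r (axis a))).
Qed.

Lemma measurable_slice (r a : R) : measurable_fun setT
  (fun z : mR => \int[leb2]_w (\1_(eball r) (w, z) *
      (enorm ((0%R, 0%R, a) - (w, z) : R3 R))^-1)%:E)%E.
Proof.
exact: (measurable_slices_leb3 (measurable_ball_kernel r (axis a))
  (ball_kernel_ge0 r (axis a))).
Qed.

Lemma slice_ge0 (r a z : R) : (0 <= \int[leb2]_w (\1_(eball r) (w, z) *
      (enorm ((0%R, 0%R, a) - (w, z) : R3 R))^-1)%:E)%E.
Proof. by apply: integral_ge0 => w _; exact: ball_kernel_ge0. Qed.

Lemma integral_slab_scaled (r : R) (f : R -> R) : 0 < r ->
  continuous f -> (forall z, z ^+ 2 < r ^+ 2 -> 0 <= f z) ->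
  (\int[mu]_z (disk_area * (if (z ^+ 2 < r ^+ 2)%R then f z else 0%R))%:E =
   disk_area%:E * \int[mu]_(z in `[(- r)%R, r]) (f z)%:E)%E.
Proof.
move=> r0 cf f0.
have mf : measurable_fun setT f := continuous_measurable_fun cf.
rewrite -(integral_slab r0 mf).
under eq_integral do rewrite EFinM.
apply: ge0_integralZl_EFin => //.
- by move=> z _; case: ifP => // /f0; rewrite lee_fin.
- apply/measurable_EFinP; apply: measurable_fun_ifT => //.
  exact: measurable_fun_ltr.
- by rewrite ltW// disk_area_gt0.
Qed.

Lemma measurable_slab (r : R) (f : R -> R) : continuous f ->
  measurable_fun setT (fun z : mR => (disk_area * (if z ^+ 2 < r ^+ 2 then f z else 0))%:E : \bar R).
Proof.
move=> cf; apply/measurable_EFinP; apply: measurable_funM => //.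
apply: measurable_fun_ifT => //; last exact: continuous_measurable_fun.
exact: measurable_fun_ltr.
Qed.

Lemma ae_neq (a : R) (P : R -> Prop) : (forall z, z != a -> P z) ->
  {ae mu, forall z : mR, setT z -> P z}.
Proof.
move=> H; exists [set a]; split => //; first exact: lebesgue_measure_set1.
by move=> z /= nP; apply/eqP/negP => /negP/H Pz; apply: nP.
Qed.

Lemma slice_le (r a : R) (f : R -> R) : 0 < r ->
  continuous f -> (forall z, z ^+ 2 < r ^+ 2 -> 0 <= f z) ->
  (forall z, z ^+ 2 < r ^+ 2 ->
    2 * (Num.sqrt (- (2 * a) * z + (r ^+ 2 + a ^+ 2)) - `|a - z|) <= f z) ->
  (ball_pot r (axis a) <=
    disk_area%:E * \int[mu]_(z in `[(- r)%R, r]) (f z)%:E)%E.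
Proof.
move=> r0 cf f0 fle; rewrite ball_potE -integral_slab_scaled//.
have da : 0 <= @disk_area R by rewrite ltW// disk_area_gt0.
apply: ae_ge0_le_integral => //.
- by move=> z _; exact: slice_ge0.
- exact: measurable_slice.
- by move=> z _; rewrite lee_fin mulr_ge0//; case: ifP => // /f0.
- exact: measurable_slab.
- apply: (@ae_neq a) => z za.
  have [zr|zr] := ltP (z ^+ 2) (r ^+ 2).
    by rewrite ball_slice// lee_fin ler_wpM2l// fle.
  by rewrite ball_slice_out// mulr0.
Qed.

(** Inside the ball the potential at distance a stays below that of a point
charge.  Replacing the absolute value of a - z by the smaller a - z keeps a
single antiderivative for all heights, at the price of an inequality.  The
resulting bound is exactly vol / a if r <= a, and smaller by a multiple of
(r - a)^3 otherwise. *)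
Lemma ball_pot_le (r a : R) : 0 < r -> 0 < a ->
  (ball_pot r (axis a) <= (ball_vol r / a)%:E)%E.
Proof.
move=> r0 a0; have da : 0 <= @disk_area R by rewrite ltW// disk_area_gt0.
apply: (@le_trans _ _ (disk_area%:E * \int[mu]_(z in `[(- r)%R, r]) (dens r a z)%:E)%E).
  apply: slice_le => //.
  - exact: continuous_dens.
  - move=> z zr; have := dens_ge r0 a0 zr; have := ler_norm (a - z).
    by rewrite /dens; lra.
  - by move=> z zr; have := ler_norm (a - z); rewrite /dens; lra.
rewrite integral_dens// -EFinM lee_fin /ball_vol.
have := prim_le r0 a0; set p := _ - _ => ple.
apply: (@le_trans _ _ (disk_area * (4 / 3 * r ^+ 3 / a))); first exact: ler_wpM2l.
by rewrite !mulrA.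
Qed.

(** All heights z lie below a, so no absolute value is lost in the computation of
[ball_pot_le]. *)
Lemma ball_pot_eq (r a : R) : 0 < r -> r <= a ->
  ball_pot r (axis a) = (ball_vol r / a)%:E.
Proof.
move=> r0 ra; have a0 : 0 < a by lra.
rewrite ball_potE.
transitivity (disk_area%:E * \int[mu]_(z in `[(- r)%R, r]) (dens r a z)%:E)%E.
  rewrite -integral_slab_scaled//; last 2 first.
  - exact: continuous_dens.
  - move=> z zr; have := dens_ge r0 a0 zr; have := ler_norm (a - z).
    by rewrite /dens; lra.
  apply: eq_integral => z _; have [zr|zr] := ltP (z ^+ 2) (r ^+ 2).
    have za : z < a by nra.
    rewrite ball_slice ?lt_eqF// /dens ger0_norm// subr_ge0 ltW//.
  by rewrite ball_slice_out// mulr0.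
rewrite integral_dens// prim_eq// -EFinM /ball_vol; congr EFin.
by rewrite !mulrA.
Qed.

(** A crude bound at the center, of order r^2: it makes the singularity of the
kernel locally negligible. *)
Lemma ball_pot0_le (r : R) : 0 < r ->
  (ball_pot r (axis 0) <= (disk_area * (4 * r ^+ 2))%:E)%E.
Proof.
move=> r0; have da : 0 <= @disk_area R by rewrite ltW// disk_area_gt0.
apply: (@le_trans _ _ (disk_area%:E * \int[mu]_(z in `[(- r)%R, r]) (2 * r)%:E)%E).
  apply: slice_le => //.
  - exact: cst_continuous.
  - by move=> z _; rewrite mulr_ge0// ltW.
  - move=> z zr; rewrite mulr0 oppr0 mul0r add0r expr0n /= addr0 sqrtr_sqr.
    by rewrite gtr0_norm// ler_wpM2l// gerBl.
rewrite integral_cst//= lebesgue_measure_itv /= lte_fin.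
have -> : - r < r by lra.
by rewrite -EFinB -!EFinM lee_fin ler_wpM2l//; nra.
Qed.

End ball_potential.

(** * Layer cake decomposition and Newton's theorem *)

Section potential.
Context {R : realType}.
Local Notation mu := (@lebesgue_measure R).
Local Notation mR := (measurableTypeR R).
Local Notation M3 := (mR * mR * mR)%type.

Definition epot (f : R3 R -> R) (x : R3 R) : \bar R :=
  (\int[leb3]_y (f y * (enorm (x - y))^-1)%:E)%E.

Lemma measurable_invdist (x : R3 R) :
  measurable_fun setT (fun y : M3 => (enorm (x - y : R3 R))^-1 : R).
Proof.
apply: measurable_inv => [y|]; first exact: enorm_ge0.
apply: (@measurable_enorm _ _ M3 (fun y => x - y : R3 R)) => /=;
  (apply: measurable_funB; first exact: measurable_cst).
- exact: measurable_fst1.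
- exact: measurable_fst2.
- exact: measurable_snd.
Qed.

Lemma kernel_ge0 (x : R3 R) : 0 <= (enorm x)^-1.
Proof. by rewrite invr_ge0 enorm_ge0. Qed.

Section layer_cake.
Variables (f K : M3 -> R).
Hypotheses (mf : measurable_fun setT f) (f0 : forall y, 0 <= f y)
  (mK : measurable_fun setT K) (K0 : forall y, 0 <= K y).

Let level (t : R) : set M3 := [set y | t < f y].

(** f is the integral over t >= 0 of the indicators of its level sets; exchange
the two integrals. *)
Lemma layer_cake :
  (\int[leb3]_y (f y * K y)%:E =
   \int[mu]_(t in `[0%R, +oo[) \int[leb3]_y (\1_(level t) y * K y)%:E)%E.
Proof.
pose G (yt : M3 * mR) : \bar R :=
  ((if (0 <= yt.2) && (yt.2 < f yt.1) then 1 else 0) * K yt.1)%:E.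
have mG : measurable_fun setT G.
  apply/measurable_EFinP/measurable_funM; last first.
    exact: (measurableT_comp mK measurable_fst).
  apply: measurable_fun_ifT; [|exact: measurable_cst|exact: measurable_cst].
  apply: measurable_and.
    by apply: measurable_fun_ler; [exact: measurable_cst|exact: measurable_snd].
  apply: measurable_fun_ltr; first exact: measurable_snd.
  exact: (measurableT_comp mf measurable_fst).
have G0 yt : (0 <= G yt)%E.
  by rewrite lee_fin mulr_ge0//; case: ifP.
have H := @fubini_tonelli _ _ _ _ R (@sleb3 R) mu G mG G0.
transitivity (\int[sleb3]_y \int[mu]_t G (y, t))%E.
  apply: eq_integral => y _.
  pose I : set mR := `[0, f y[%classic.
  transitivity (\int[mu]_t ((K y)%:E * (\1_I t)%:E))%E.
    have mI : measurable_fun setT (fun t => (\1_I t)%:E : \bar R).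
      by apply/measurable_EFinP/measurable_indic; exact: measurable_itv.
    rewrite ge0_integralZl_EFin//.
    have -> : (\int[mu]_t (\1_I t)%:E = (f y)%:E)%E.
      rewrite integral_indic ?setIT//; last exact: measurable_itv.
      rewrite [LHS]lebesgue_measure_itv /= lte_fin; case: ltP => [_|fy].
        by rewrite sube0.
      by congr EFin; apply/eqP; rewrite eq_le fy f0.
    by rewrite mulrC EFinM.
  apply: eq_integral => t _; rewrite /G /= -EFinM mulrC indicE mem_setE in_itv /=.
  by case: ifP.
rewrite H [RHS]integral_mkcond; apply: eq_integral => t _.
rewrite /patch mem_setE in_itv /= andbT; have [t0|t0] := leP 0 t.
  apply: eq_integral => y _; rewrite /G /= t0 indicE mem_setE /=.
  by rewrite -[_ \in _]/(t < f y); case: ifP.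
by apply: integral0_eq => y _; rewrite /G /= leNgt t0 /= mul0r.
Qed.

Lemma measurable_layer : measurable_fun setT
  (fun t : mR => \int[leb3]_y (\1_(level t) y * K y)%:E)%E.
Proof.
pose G (yt : M3 * mR) : \bar R :=
  ((if yt.2 < f yt.1 then 1 else 0) * K yt.1)%:E.
have mG : measurable_fun setT G.
  apply/measurable_EFinP/measurable_funM; last first.
    exact: (measurableT_comp mK measurable_fst).
  apply: measurable_fun_ifT; [|exact: measurable_cst|exact: measurable_cst].
  apply: measurable_fun_ltr; first exact: measurable_snd.
  exact: (measurableT_comp mf measurable_fst).
have G0 yt : (0 <= G yt)%E.
  by rewrite lee_fin mulr_ge0//; case: ifP.
have := @measurable_fun_fubini_tonelli_G _ _ _ _ R (@sleb3 R) G mG G0.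
apply: eq_measurable_fun => t _; apply: eq_integral => y _.
rewrite /G /= indicE mem_setE /=.
by rewrite -[_ \in _]/(t < f y); case: ifP.
Qed.

End layer_cake.

Lemma enorm_axis (a : R) : enorm (axis a) = `|a|.
Proof. by rewrite /enorm /axis /= !expr0n /= !add0r sqrtr_sqr. Qed.

Lemma continuous_axis : continuous (@axis R).
Proof.
move=> a; have H1 : (fun=> (0, 0) : R * R) x @[x --> a] --> ((0, 0) : R * R).
  exact: cvg_cst.
have H2 : idfun x @[x --> a] --> a by exact: cvg_id.
exact: (cvg_pair H1 H2).
Qed.

Lemma symdec_axis (f : R3 R -> R) y : symmetric_decreasing f ->
  f y = f (axis (enorm y)).
Proof. by move=> [H _]; apply: H; rewrite enorm_axis ger0_norm// enorm_ge0. Qed.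

Lemma integral_indic_eball (r k : R) : 0 < r -> 0 <= k ->
  (\int[leb3]_y (\1_(eball r : set M3) y * k)%:E = (ball_vol r * k)%:E)%E.
Proof.
move=> r0 k0.
have mI : measurable_fun setT (fun y : M3 => (\1_(eball r : set M3) y)%:E : \bar R).
  by apply/measurable_EFinP; apply: measurable_indic; exact: measurable_eball.
transitivity (k%:E * \int[leb3]_y (\1_(eball r : set M3) y)%:E)%E.
  rewrite -(ge0_integralZl_EFin _ _ _ mI)//.
  by apply: eq_integral => y _; rewrite mulrC EFinM.
rewrite integral_indic ?setIT//; last exact: measurable_eball.
by rewrite [X in (_ * X)%E](eball_measure r0) -EFinM mulrC.
Qed.

Section newton.
Variables (f : R3 R -> R) (Rad : R).
Hypotheses (f_sd : symmetric_decreasing f) (f_cont : continuous f)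
  (f0 : forall y, 0 <= f y) (mf : measurable_fun [set: M3] f)
  (Rad0 : 0 <= Rad) (f_supp : forall y, Rad < enorm y -> f y = 0).

(** The radius is the supremum of the radii at which the density exceeds t.
Continuity makes the level set open, so that it is the open ball and not the
closed one. *)
Lemma level_ball (t : R) : 0 <= t ->
  exists r, [/\ 0 <= r, r <= Rad & [set y | t < f y] = eball r].
Proof.
move=> t0.
pose S : set R := [set s | 0 <= s /\ t < f (axis s)].
have Sdown s s' : 0 <= s' -> s' <= s -> S s -> S s'.
  move=> s'0 s's [s0 ts]; split => //; apply: (lt_le_trans ts).
  by apply: f_sd.2; rewrite !enorm_axis !ger0_norm.
have SRad : ubound S Rad.
  move=> s [s0 ts]; rewrite leNgt; apply/negP => Rs.
  by move: ts; rewrite f_supp ?enorm_axis ?ger0_norm// ltNge t0.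
have levelE : [set y | t < f y] = [set y | S (enorm y)].
  apply/seteqP; split => y /=; rewrite (symdec_axis y f_sd).
    by move=> ty; split => //; exact: enorm_ge0.
  by move=> [_].
have [[s1 Ss1]|/set0P/negP/negPn/eqP S0] := pselect (S !=set0); last first.
  exists 0; split => //; rewrite levelE S0; apply/seteqP; split => y //=.
  by rewrite /eball /= ltNge enorm_ge0.
have hS : has_sup S by split; [exists s1|exists Rad].
exists (sup S); split.
- by apply: (le_trans Ss1.1); apply: ub_le_sup => //; exists Rad.
- by apply: ge_sup => //; exists s1.
rewrite levelE; apply/seteqP; split => y /=; last first.
  rewrite /eball /= => ys; have e0 : 0 < sup S - enorm y by rewrite subr_gt0.
  have [s Ss] := sup_adherent e0 hS; rewrite subKr => ys'.
  by apply: (Sdown _ _ (enorm_ge0 y) (ltW ys')).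
move=> [_ ty]; rewrite /eball /=.
have : \forall s \near enorm y, t < f (axis s).
  have H : f (axis s) @[s --> enorm y] --> f (axis (enorm y)).
    by apply: continuous_comp; [exact: continuous_axis|exact: f_cont].
  exact: (cvgr_gt _ H).
move=> /nbhs_ballP[e /= e0 He].
apply: (@lt_le_trans _ _ (enorm y + e / 2)); first by rewrite ltrDl divr_gt0.
apply: ub_le_sup; first by exists Rad.
have ey := enorm_ge0 y.
split; first by rewrite addr_ge0// divr_ge0// ltW.
apply: He; rewrite /ball /= opprD addNKr normrN gtr0_norm ?divr_gt0//; lra.
Qed.

Lemma level_kernel_le (a t : R) : 0 < a -> 0 <= t ->
  (\int[leb3]_y (\1_([set y | (t < f y)%R] : set M3) y * (enorm (axis a - y))^-1)%:E <=
   \int[leb3]_y (\1_([set y | (t < f y)%R] : set M3) y * a^-1)%:E)%E.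
Proof.
move=> a0 t0; have [r [r0 _ ->]] := level_ball t0.
have [->|r_neq0] := eqVneq r 0.
  rewrite (_ : eball 0 = set0); last first.
    by rewrite -subset0 => y; rewrite /eball /= ltNge enorm_ge0.
  by rewrite !integral0_eq// => y _; rewrite indicE in_set0 mul0r.
have rp : 0 < r by rewrite lt_neqAle eq_sym r_neq0.
apply: (le_trans (ball_pot_le rp a0)).
by rewrite integral_indic_eball// invr_ge0 ltW.
Qed.

Lemma level_kernel_eq (a t : R) : 0 < a -> 0 <= t -> Rad <= a ->
  (\int[leb3]_y (\1_([set y | (t < f y)%R] : set M3) y * (enorm (axis a - y))^-1)%:E =
   \int[leb3]_y (\1_([set y | (t < f y)%R] : set M3) y * a^-1)%:E)%E.
Proof.
move=> a0 t0 Ra; have [r [r0 rR ->]] := level_ball t0.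
have [->|r_neq0] := eqVneq r 0.
  rewrite (_ : eball 0 = set0); last first.
    by rewrite -subset0 => y; rewrite /eball /= ltNge enorm_ge0.
  by rewrite !integral0_eq// => y _; rewrite indicE in_set0 mul0r.
have rp : 0 < r by rewrite lt_neqAle eq_sym r_neq0.
rewrite [LHS](ball_pot_eq rp (le_trans rR Ra)).
by rewrite integral_indic_eball// invr_ge0 ltW.
Qed.

(** By the layer cake decomposition the density is a superposition of balls, and
each of them satisfies the inequality. *)
Lemma newton_le (a : R) : 0 < a ->
  (epot f (axis a) <= \int[leb3]_y (f y * a^-1)%:E)%E.
Proof.
move=> a0; have ai : 0 <= a^-1 by rewrite invr_ge0 ltW.
have mc : measurable_fun [set: M3] (fun=> a^-1) by exact: measurable_cst.
rewrite /epot (layer_cake mf f0 (measurable_invdist _) (fun y => kernel_ge0 _)).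
rewrite (layer_cake mf f0 mc (fun=> ai)).
apply: ge0_le_integral => //.
- move=> t _; apply: integral_ge0 => y _.
  by rewrite lee_fin mulr_ge0 ?kernel_ge0 ?indicE.
- apply: measurable_funTS.
  by apply: measurable_layer => //; [exact: measurable_invdist|move=> y; exact: kernel_ge0].
- by apply: measurable_funTS; exact: measurable_layer.
- by move=> t; rewrite /= in_itv /= andbT => t0; exact: level_kernel_le.
Qed.

Lemma newton_eq (a : R) : 0 < a -> Rad <= a ->
  (epot f (axis a) = \int[leb3]_y (f y * a^-1)%:E)%E.
Proof.
move=> a0 Ra; have ai : 0 <= a^-1 by rewrite invr_ge0 ltW.
have mc : measurable_fun [set: M3] (fun=> a^-1) by exact: measurable_cst.
rewrite /epot (layer_cake mf f0 (measurable_invdist _) (fun y => kernel_ge0 _)).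
rewrite (layer_cake mf f0 mc (fun=> ai)).
apply: eq_integral => t; rewrite inE /= in_itv /= andbT => t0.
exact: level_kernel_eq.
Qed.

End newton.
End potential.

(** * Nonnegative integrable functions and bounded densities *)

Section integrals.
Context {R : realType}.
Local Notation mu := (@lebesgue_measure R).
Local Notation mR := (measurableTypeR R).
Local Notation M3 := (mR * mR * mR)%type.
Implicit Types f g w : R3 R -> R.

Definition nnL1 f : Prop :=
  [/\ measurable_fun [set: M3] f, forall x, 0 <= f x &
      (\int[leb3]_x (f x)%:E < +oo)%E].

Definition int3 f : R := fine (\int[leb3]_x (f x)%:E)%E.

Lemma int3E f : nnL1 f -> (\int[leb3]_x (f x)%:E = (int3 f)%:E)%E.
Proof.
move=> [mf f0 fy]; rewrite fineK// ge0_fin_numE//.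
by apply: integral_ge0 => x _; rewrite lee_fin.
Qed.

Lemma int3_ge0 f : (forall x, 0 <= f x) -> 0 <= int3 f.
Proof. by move=> f0; apply: fine_ge0; apply: integral_ge0 => x _; rewrite lee_fin. Qed.

Lemma eq_int3 f g : f =1 g -> int3 f = int3 g.
Proof. by move=> fg; rewrite /int3; congr fine; apply: eq_integral => x _; rewrite fg. Qed.

Lemma ge0_measE f : measurable_fun [set: M3] f ->
  measurable_fun [set: M3] (fun x => (f x)%:E : \bar R).
Proof. by move=> mf; exact/measurable_EFinP. Qed.

Lemma integral_lee f g : measurable_fun [set: M3] f -> measurable_fun [set: M3] g ->
  (forall x, 0 <= f x) -> (forall x, f x <= g x) ->
  (\int[leb3]_x (f x)%:E <= \int[leb3]_x (g x)%:E)%E.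
Proof.
move=> mf mg f0 fg; apply: ge0_le_integral => //.
- by move=> x _; rewrite lee_fin.
- exact: ge0_measE.
- exact: ge0_measE.
- by move=> x _; rewrite lee_fin.
Qed.

Lemma nnL1_le f g : nnL1 g -> measurable_fun [set: M3] f -> (forall x, 0 <= f x) ->
  (forall x, f x <= g x) -> nnL1 f.
Proof.
move=> [mg g0 gy] mf f0 fg; split => //.
by apply: le_lt_trans gy; exact: integral_lee.
Qed.

Lemma int3_le f g : nnL1 f -> nnL1 g -> (forall x, f x <= g x) -> int3 f <= int3 g.
Proof.
move=> Lf Lg fg; rewrite -lee_fin -!int3E//.
by move: Lf Lg => [? ? _] [? ? _]; exact: integral_lee.
Qed.

Lemma integralD3 f g : measurable_fun [set: M3] f -> measurable_fun [set: M3] g ->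
  (forall x, 0 <= f x) -> (forall x, 0 <= g x) ->
  (\int[leb3]_x (f x + g x)%:E = \int[leb3]_x (f x)%:E + \int[leb3]_x (g x)%:E)%E.
Proof.
move=> mf mg f0 g0.
apply: (@ge0_integralD _ _ _ leb3 setT measurableT (EFin \o f) (EFin \o g)).
- by move=> x _; rewrite lee_fin.
- exact: ge0_measE.
- by move=> x _; rewrite lee_fin.
- exact: ge0_measE.
Qed.

Lemma integralZ3 k f : 0 <= k -> measurable_fun [set: M3] f -> (forall x, 0 <= f x) ->
  (\int[leb3]_x (k * f x)%:E = k%:E * \int[leb3]_x (f x)%:E)%E.
Proof.
move=> k0 mf f0; rewrite -(ge0_integralZl_EFin _ _ _ (ge0_measE mf))// => x _.
by rewrite lee_fin.
Qed.

Lemma nnL1D f g : nnL1 f -> nnL1 g -> nnL1 (fun x => f x + g x).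
Proof.
move=> Lf Lg; have If := int3E Lf; have Ig := int3E Lg.
move: Lf Lg => [mf f0 _] [mg g0 _]; split.
- exact: measurable_funD.
- by move=> x; rewrite addr_ge0.
- by rewrite integralD3// If Ig -EFinD ltry.
Qed.

Lemma int3D f g : nnL1 f -> nnL1 g -> int3 (fun x => f x + g x) = int3 f + int3 g.
Proof.
move=> Lf Lg; apply: EFin_inj; rewrite -int3E; last exact: nnL1D.
rewrite EFinD -!int3E//; move: Lf Lg => [? ? _] [? ? _]; exact: integralD3.
Qed.

Lemma nnL1Z k f : 0 <= k -> nnL1 f -> nnL1 (fun x => k * f x).
Proof.
move=> k0 Lf; have If := int3E Lf.
move: Lf => [mf f0 _]; split.
- by apply: measurable_funM => //; exact: measurable_cst.
- by move=> x; rewrite mulr_ge0.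
- by rewrite integralZ3// If -EFinM ltry.
Qed.

Lemma int3Z k f : 0 <= k -> nnL1 f -> int3 (fun x => k * f x) = k * int3 f.
Proof.
move=> k0 Lf; apply: EFin_inj; rewrite -int3E; last exact: nnL1Z.
rewrite EFinM -!int3E//; move: Lf => [? ? _]; exact: integralZ3.
Qed.

Lemma nnL1_bounded f w (M : R) : nnL1 f -> measurable_fun [set: M3] w ->
  (forall x, 0 <= w x <= M) -> nnL1 (fun x => f x * w x).
Proof.
move=> Lf mw wM.
have M0 : 0 <= M by have /andP[a b] := wM (0, 0, 0); exact: le_trans b.
have [mf f0 _] := Lf.
apply: (nnL1_le (nnL1Z M0 Lf)).
- exact: measurable_funM.
- by move=> x; rewrite mulr_ge0//; have /andP[] := wM x.
- by move=> x; rewrite mulrC ler_wpM2r//; have /andP[] := wM x.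
Qed.

(** The class in which the calculus of variations is carried out: potentials of
bounded integrable densities are bounded and continuous, and such densities
are admissible for every exponent above 1. *)
Definition bdensity f : Prop := nnL1 f /\ exists M, forall x, f x <= M.

Lemma bdensityD f g : bdensity f -> bdensity g -> bdensity (fun x => f x + g x).
Proof.
move=> [Lf [M fM]] [Lg [N gN]]; split; first exact: nnL1D.
by exists (M + N) => x; rewrite lerD.
Qed.

Lemma bdensityZ k f : 0 <= k -> bdensity f -> bdensity (fun x => k * f x).
Proof.
move=> k0 [Lf [M fM]]; split; first exact: nnL1Z.
by exists (k * M) => x; rewrite ler_wpM2l.
Qed.

(** Translating and reflecting y moves the singularity to the center of the
ball. *)
Lemma local_kernel (x : R3 R) (r : R) : 0 < r ->
  (\int[leb3]_y (\1_(eball r) (x - y) * (enorm (x - y))^-1)%:E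
    <= (disk_area * (4 * r ^+ 2))%:E)%E.
Proof.
move=> r0; apply: le_trans (ball_pot0_le r0).
have mK : measurable_fun setT (fun y : M3 =>
    (\1_(eball r) y * (enorm (axis 0 - y : R3 R))^-1)%:E : \bar R).
  exact: measurable_ball_kernel.
have m1 : (-1 : R) != 0 by rewrite oppr_eq0 oner_eq0.
rewrite /ball_pot (ge0_integral_affine3 x.1.1 x.1.2 x.2 m1 mK (ball_kernel_ge0 r (axis 0))).
rewrite normrN1 expr1n mul1e.
rewrite (_ : (fun y : M3 => _) = (fun y : M3 =>
  (\1_(eball r) (- 1 * y.1.1 + x.1.1, - 1 * y.1.2 + x.1.2, - 1 * y.2 + x.2) *
   (enorm (axis 0 - (- 1 * y.1.1 + x.1.1, - 1 * y.1.2 + x.1.2, - 1 * y.2 + x.2)))^-1)%:E))//.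
apply/funext => y; congr EFin.
have -> : (- 1 * y.1.1 + x.1.1, - 1 * y.1.2 + x.1.2, - 1 * y.2 + x.2) = x - y.
  by rewrite !mulN1r -![- _ + _]addrC.
congr (_ * _^-1).
by rewrite /enorm /axis /= !sub0r !sqrrN.
Qed.

End integrals.

(** * Potentials and the Coulomb form *)

Section enorm_triangle.
Context {R : realType}.
Implicit Types x y z : R3 R.

Lemma enormN x : enorm (- x) = enorm x.
Proof. by rewrite /enorm /= !sqrrN. Qed.

Lemma enorm_subC x y : enorm (x - y) = enorm (y - x).
Proof. by rewrite -opprB enormN. Qed.

Lemma sqr_enorm x : enorm x ^+ 2 = x.1.1 ^+ 2 + x.1.2 ^+ 2 + x.2 ^+ 2.
Proof. by rewrite sqr_sqrtr// !addr_ge0// sqr_ge0. Qed.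

(** Cauchy-Schwarz, through Lagrange's identity for the three 2 x 2 minors. *)
Lemma enorm_triangle x y : enorm (x + y) <= enorm x + enorm y.
Proof.
rewrite -(@ler_pXn2r _ 2) ?nnegrE ?addr_ge0 ?enorm_ge0//.
rewrite sqrrD !sqr_enorm /=.
have CS : x.1.1 * y.1.1 + x.1.2 * y.1.2 + x.2 * y.2 <= enorm x * enorm y.
  apply: le_trans (ler_norm _) _.
  rewrite -(@ler_pXn2r _ 2) ?nnegrE ?mulr_ge0 ?enorm_ge0//.
  rewrite real_normK ?num_real// exprMn !sqr_enorm.
  have := sqr_ge0 (x.1.1 * y.1.2 - x.1.2 * y.1.1).
  have := sqr_ge0 (x.1.1 * y.2 - x.2 * y.1.1).
  have := sqr_ge0 (x.1.2 * y.2 - x.2 * y.1.2).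
  nra.
nra.
Qed.

Lemma enorm_le_sum x : enorm x <= `|x.1.1| + `|x.1.2| + `|x.2|.
Proof.
rewrite -(@ler_pXn2r _ 2) ?nnegrE ?enorm_ge0 ?addr_ge0// sqr_enorm.
rewrite -(real_normK (num_real x.1.1)) -(real_normK (num_real x.1.2)).
rewrite -(real_normK (num_real x.2)).
have := normr_ge0 x.1.1; have := normr_ge0 x.1.2; have := normr_ge0 x.2.
nra.
Qed.

End enorm_triangle.

Section pot.
Context {R : realType}.
Local Notation mu := (@lebesgue_measure R).
Local Notation mR := (measurableTypeR R).
Local Notation M3 := (mR * mR * mR)%type.
Implicit Types f g w : R3 R -> R.

Lemma measurable_invdist2 : measurable_fun setT
  (fun xy : M3 * M3 => (enorm (xy.1 - xy.2 : R3 R))^-1 : R).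
Proof.
apply: measurable_inv => [y|]; first exact: enorm_ge0.
apply: (@measurable_enorm _ _ (M3 * M3)%type (fun xy => xy.1 - xy.2 : R3 R)) => /=;
  apply: measurable_funB.
- exact: (measurableT_comp measurable_fst1 measurable_fst).
- exact: (measurableT_comp measurable_fst1 measurable_snd).
- exact: (measurableT_comp measurable_fst2 measurable_fst).
- exact: (measurableT_comp measurable_fst2 measurable_snd).
- exact: (measurableT_comp measurable_snd measurable_fst).
- exact: (measurableT_comp measurable_snd measurable_snd).
Qed.

Lemma measurable_epot f : measurable_fun [set: M3] f -> (forall x, 0 <= f x) ->
  measurable_fun [set: M3] (epot f).
Proof.
move=> mf f0.
pose G (xy : M3 * M3) : \bar R := (f xy.2 * (enorm (xy.1 - xy.2 : R3 R))^-1)%:E.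
have mG : measurable_fun setT G.
  apply/measurable_EFinP/measurable_funM; last exact: measurable_invdist2.
  exact: (measurableT_comp mf measurable_snd).
have G0 xy : (0 <= G xy)%E by rewrite lee_fin mulr_ge0// kernel_ge0.
exact: (@measurable_fun_fubini_tonelli_F _ _ _ _ R (@sleb3 R) G mG G0).
Qed.

Lemma measurable_local_kernel (x : R3 R) (r : R) : measurable_fun [set: M3]
  (fun y : M3 => \1_(eball r) (x - y : R3 R) * (enorm (x - y : R3 R))^-1 : R).
Proof.
apply: measurable_funM; last exact: measurable_invdist.
have H := measurable_affine3 (-1) x.1.1 x.1.2 x.2.
rewrite (_ : (fun y => _) = (\1_(eball r : set M3) : M3 -> R) \o
  (fun y : M3 => (-1 * y.1.1 + x.1.1, -1 * y.1.2 + x.1.2, - 1 * y.2 + x.2) : M3)).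
  by apply: measurableT_comp H; apply: measurable_indic; exact: measurable_eball.
apply/funext => y /=; congr (\1_(eball r) _).
by rewrite !mulN1r -![- _ + _]addrC.
Qed.

(** Near x the density is at most M and the kernel is integrable; away from x the
kernel is at most 1/r and the density is integrable. *)
Lemma epot_le f (M r : R) x : nnL1 f -> (forall y, f y <= M) -> 0 < r ->
  (epot f x <= (M * (disk_area * (4 * r ^+ 2)) + r^-1 * int3 f)%:E)%E.
Proof.
move=> Lf fM r0; have [mf f0 _] := Lf.
have M0 : 0 <= M := le_trans (f0 0) (fM 0).
have ri : 0 <= r^-1 by rewrite invr_ge0 ltW.
have loc0 y : 0 <= \1_(eball r) (x - y) * (enorm (x - y))^-1.
  by rewrite mulr_ge0 ?kernel_ge0 ?indicE.
apply: (@le_trans _ _ (\int[leb3]_y (M * (\1_(eball r) (x - y) * (enorm (x - y))^-1) + r^-1 * f y)%:E)%E).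
  apply: integral_lee.
  - by apply: measurable_funM => //; exact: measurable_invdist.
  - apply: measurable_funD; apply: measurable_funM => //; try exact: measurable_cst.
    exact: measurable_local_kernel.
  - by move=> y; rewrite mulr_ge0 ?kernel_ge0.
  - move=> y; have := kernel_ge0 (x - y); set k := _^-1 => k0.
    rewrite indicE; have [xr|xr] := boolP (x - y \in eball r).
      by rewrite mul1r -[leLHS]addr0 lerD// ?mulr_ge0// ler_wpM2r.
    rewrite mul0r mulr0 add0r mulrC ler_wpM2r//.
    move: xr; rewrite notin_setE /eball /= => /negP; rewrite -leNgt => xr.
    by rewrite lef_pV2// posrE (lt_le_trans r0).
rewrite integralD3//; last 4 first.
- by apply: measurable_funM; [exact: measurable_cst|exact: measurable_local_kernel].
- by apply: measurable_funM => //; exact: measurable_cst.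
- by move=> y; rewrite mulr_ge0.
- by move=> y; rewrite mulr_ge0.
rewrite !integralZ3//; last exact: measurable_local_kernel.
rewrite (int3E Lf) EFinD; apply: leeD; last by rewrite -EFinM.
by rewrite EFinM; apply: lee_wpmul2l; [rewrite lee_fin|exact: local_kernel].
Qed.

Definition pot f x : R := fine (epot f x).

Lemma potE f x : bdensity f -> (epot f x = (pot f x)%:E)%E.
Proof.
move=> [Lf [M fM]]; have [mf f0 _] := Lf.
rewrite fineK// ge0_fin_numE.
  by apply: le_lt_trans (epot_le x Lf fM ltr01) _; rewrite ltry.
by apply: integral_ge0 => y _; rewrite lee_fin mulr_ge0 ?kernel_ge0.
Qed.

Lemma pot_ge0 f x : (forall y, 0 <= f y) -> 0 <= pot f x.
Proof.
by move=> f0; apply: fine_ge0; apply: integral_ge0 => y _; rewrite lee_fin mulr_ge0 ?kernel_ge0.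
Qed.

Lemma pot_le f (M r : R) x : bdensity f -> (forall y, f y <= M) -> 0 < r ->
  pot f x <= M * (disk_area * (4 * r ^+ 2)) + r^-1 * int3 f.
Proof. by move=> gf fM r0; rewrite -lee_fin -potE//; apply: epot_le => //; case: gf. Qed.

Lemma measurable_pot f : bdensity f -> measurable_fun [set: M3] (pot f).
Proof.
move=> gf; have [[mf f0 _] _] := gf; apply/measurable_EFinP.
rewrite (_ : EFin \o _ = epot f); first exact: measurable_epot.
by apply/funext => x /=; rewrite potE.
Qed.

Lemma pot_bounded f : bdensity f -> exists M, forall x, 0 <= pot f x <= M.
Proof.
move=> gf; have [[mf f0 _] [M fM]] := gf.
exists (M * (disk_area * (4 * 1 ^+ 2)) + 1^-1 * int3 f) => x.
by rewrite pot_ge0//= pot_le.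
Qed.

Lemma nnL1_kernel f x : bdensity f -> nnL1 (fun y => f y * (enorm (x - y))^-1).
Proof.
move=> gf; have [[mf f0 _] _] := gf; split.
- by apply: measurable_funM => //; exact: measurable_invdist.
- by move=> y; rewrite mulr_ge0 ?kernel_ge0.
- by have := potE x gf; rewrite /epot => ->; rewrite ltry.
Qed.

Lemma pot_int3 f x : pot f x = int3 (fun y => f y * (enorm (x - y))^-1).
Proof. by []. Qed.

Lemma potD f g x : bdensity f -> bdensity g -> pot (fun y => f y + g y) x = pot f x + pot g x.
Proof.
move=> gf gg; rewrite !pot_int3 -int3D; [|exact: nnL1_kernel|exact: nnL1_kernel].
by apply: eq_int3 => y; rewrite mulrDl.
Qed.

Lemma potZ k f x : 0 <= k -> bdensity f -> pot (fun y => k * f y) x = k * pot f x.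
Proof.
move=> k0 gf; rewrite !pot_int3 -int3Z//; last exact: nnL1_kernel.
by apply: eq_int3 => y; rewrite mulrA.
Qed.

Definition coulomb_form f g : R := int3 (fun x => f x * pot g x).

Lemma nnL1_coulomb_form f g : bdensity f -> bdensity g -> nnL1 (fun x => f x * pot g x).
Proof.
move=> [Lf _] gg; have [M gM] := pot_bounded gg.
by apply: (nnL1_bounded Lf _ gM); exact: measurable_pot.
Qed.

Lemma coulomb_formDr f g h : bdensity f -> bdensity g -> bdensity h ->
  coulomb_form f (fun x => g x + h x) = coulomb_form f g + coulomb_form f h.
Proof.
move=> gf gg gh; rewrite /coulomb_form -int3D; [|exact: nnL1_coulomb_form|exact: nnL1_coulomb_form].
by apply: eq_int3 => x; rewrite potD// mulrDr.
Qed.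

Lemma coulomb_formZr k f g : 0 <= k -> bdensity f -> bdensity g ->
  coulomb_form f (fun x => k * g x) = k * coulomb_form f g.
Proof.
move=> k0 gf gg; rewrite /coulomb_form -int3Z//; last exact: nnL1_coulomb_form.
by apply: eq_int3 => x; rewrite potZ// mulrCA.
Qed.

Lemma coulomb_form_double f g : bdensity f -> bdensity g ->
  (\int[leb3]_x \int[leb3]_y (f x * g y / enorm (x - y))%:E = (coulomb_form f g)%:E)%E.
Proof.
move=> gf gg; rewrite -int3E; last exact: nnL1_coulomb_form.
have [[mf f0 _] _] := gf; have [[mg g0 _] _] := gg.
apply: eq_integral => x _; rewrite EFinM -potE// /epot.
rewrite -integralZ3//.
- by apply: eq_integral => y _; rewrite mulrA.
- by apply: measurable_funM => //; exact: measurable_invdist.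
- by move=> y; rewrite mulr_ge0 ?kernel_ge0.
Qed.

Lemma coulomb_formC f g : bdensity f -> bdensity g -> coulomb_form f g = coulomb_form g f.
Proof.
move=> gf gg; apply: EFin_inj.
apply: (etrans (esym (coulomb_form_double gf gg))).
apply: (etrans _ (coulomb_form_double gg gf)).
have [[mf f0 _] _] := gf; have [[mg g0 _] _] := gg.
pose G (xy : M3 * M3) : \bar R := (f xy.1 * g xy.2 / enorm (xy.1 - xy.2 : R3 R))%:E.
have mG : measurable_fun setT G.
  apply/measurable_EFinP/measurable_funM; last exact: measurable_invdist2.
  apply: measurable_funM.
    exact: (measurableT_comp mf measurable_fst).
  exact: (measurableT_comp mg measurable_snd).
have G0 xy : (0 <= G xy)%E by rewrite lee_fin mulr_ge0// ?kernel_ge0// mulr_ge0.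
apply: (etrans (@fubini_tonelli _ _ _ _ R (@sleb3 R) (@sleb3 R) G mG G0)).
apply: eq_integral => y _; apply: eq_integral => x _.
by rewrite /G /= enorm_subC (mulrC (f x)).
Qed.

(** [coulomb] is the interaction energy, which carries a factor 1/2 absent from the
bilinear form. *)
Lemma coulombE f : bdensity f -> (coulomb f = (2^-1 * coulomb_form f f)%:E)%E.
Proof. by move=> gf; rewrite /coulomb coulomb_form_double// -EFinM. Qed.

Lemma coulomb_form_ge0 f g : (forall x, 0 <= f x) -> (forall x, 0 <= g x) -> 0 <= coulomb_form f g.
Proof. by move=> f0 g0; apply: int3_ge0 => x; rewrite mulr_ge0// pot_ge0. Qed.

End pot.

(** * Continuity of potentials and dilations *)

Section pot_continuity.
Context {R : realType}.
Local Notation mR := (measurableTypeR R).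
Local Notation M3 := (mR * mR * mR)%type.
Implicit Types f g w : R3 R -> R.

(** Away from the singularity (s >= e) the kernel 1/s is Lipschitz.  The value
s' = 0, where the inverse is 0, has to be included. *)
Lemma inv_le_shift (s s' d e : R) : 0 < e -> e <= s -> 0 <= s' ->
  s' <= s + d -> s <= s' + d -> s^-1 <= s'^-1 + e ^- 2 * d.
Proof.
move=> e0 es s'0 h1 h2.
have s0 : 0 < s := lt_le_trans e0 es.
have d0 : 0 <= d by lra.
have e2 : 0 < e ^+ 2 by rewrite exprn_gt0.
have [s'E|s'N] := eqVneq s' 0.
  rewrite s'E invr0 add0r mulrC ler_pdivlMr// mulrC ler_pdivrMr//.
  rewrite s'E in h2; nra.
have s'p : 0 < s' by rewrite lt_neqAle eq_sym s'N.
rewrite -lerBlDl.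
rewrite (_ : s^-1 - s'^-1 = (s' - s) / (s * s')); last first.
  by field; rewrite ?gt_eqF.
rewrite ler_pdivrMr ?mulr_gt0// -mulrA ler_pdivlMl//.
have [ss|ss] := leP s' s.
  apply: (@le_trans _ _ 0); first by rewrite mulr_ge0_le0 ?sqr_ge0// subr_le0.
  by rewrite mulr_ge0//; apply: mulr_ge0; exact: ltW.
have H : e * e <= s * s' by rewrite ler_pM ?(ltW e0)// (le_trans es)// ltW.
have h3 : 0 <= s' - s by lra.
have h4 : s' - s <= d by lra.
apply: (@le_trans _ _ (e ^+ 2 * d)); first by rewrite ler_wpM2l// sqr_ge0.
by rewrite mulrC ler_wpM2l// expr2.
Qed.

(** The part of the density within e of x contributes O(e^2); the remaining kernel
is Lipschitz with constant e^-2. *)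
Lemma pot_shift f (M e : R) x x' : bdensity f -> (forall y, f y <= M) -> 0 < e ->
  pot f x <= pot f x' + (M * (disk_area * (4 * e ^+ 2)) + e ^- 2 * enorm (x - x') * int3 f).
Proof.
move=> gf fM e0; have [Lf _] := gf; have [mf f0 _] := Lf.
have M0 : 0 <= M := le_trans (f0 0) (fM 0).
have ei : 0 <= e ^- 2 by rewrite invr_ge0 exprn_ge0// ltW.
have dx := enorm_ge0 (x - x').
have loc0 y : 0 <= \1_(eball e) (x - y) * (enorm (x - y))^-1.
  by rewrite mulr_ge0 ?kernel_ge0 ?indicE.
have Lloc : nnL1 (fun y => \1_(eball e) (x - y) * (enorm (x - y))^-1).
  split => //; first exact: measurable_local_kernel.
  by apply: le_lt_trans (local_kernel x e0) _; rewrite ltry.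
have Iloc : int3 (fun y => \1_(eball e) (x - y) * (enorm (x - y))^-1) <= disk_area * (4 * e ^+ 2).
  by rewrite -lee_fin -int3E//; exact: local_kernel.
have L1 := nnL1_kernel x' gf.
have L2 := nnL1Z M0 Lloc.
have L3 := nnL1Z (mulr_ge0 ei dx) Lf.
rewrite !pot_int3.
apply: (@le_trans _ _ (int3 (fun y => f y * (enorm (x' - y))^-1) +
  (M * int3 (fun y => \1_(eball e) (x - y) * (enorm (x - y))^-1) +
   e ^- 2 * enorm (x - x') * int3 f))); last first.
  by rewrite lerD2l lerD2r ler_wpM2l.
rewrite -(int3Z M0 Lloc) -(int3Z (mulr_ge0 ei dx) Lf) -(int3D L2 L3) -(int3D L1 (nnL1D L2 L3)).
apply: int3_le; [exact: nnL1_kernel|exact: (nnL1D L1 (nnL1D L2 L3))|] => y.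
have k1 := kernel_ge0 (x' - y); have k2 := kernel_ge0 (x - y).
rewrite indicE; have [xr|xr] := boolP (x - y \in eball e).
  rewrite mul1r addrCA -[leLHS]addr0 lerD//; first by rewrite ler_wpM2r.
  by rewrite addr_ge0// mulr_ge0// mulr_ge0.
rewrite mul0r mulr0 add0r [X in _ <= _ + X]mulrC -mulrDr ler_wpM2l//.
move: xr; rewrite notin_setE /eball /= => /negP; rewrite -leNgt => xr.
apply: inv_le_shift => //; first exact: enorm_ge0.
- have -> : x' - y = (x - y) + (x' - x) by rewrite [RHS]addrC addrA subrK.
  by rewrite (enorm_subC x x'); exact: enorm_triangle.
- have -> : x - y = (x' - y) + (x - x') by rewrite [RHS]addrC addrA subrK.
  exact: enorm_triangle.
Qed.

(** Choose e in [pot_shift] with e^2 of order eps, then let the points be so close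
that the Lipschitz part is small as well. *)
Lemma pot_unif f : bdensity f -> forall eps, 0 < eps -> exists2 d, 0 < d &
  forall x x', enorm (x - x') < d -> `|pot f x - pot f x'| < eps.
Proof.
move=> gf eps eps0; have [Lf [M fM]] := gf; have [mf f0 _] := Lf.
have M0 : 0 <= M := le_trans (f0 0) (fM 0).
have A0 := @disk_area_gt0 R; have I0 := int3_ge0 f0.
have I1 : 0 < int3 f + 1 by lra.
pose c1 := M * disk_area * 4 + 1.
have c10 : 0 < c1 by rewrite /c1 ltr_wpDl// !mulr_ge0// ltW.
pose e2 := eps / (2 * c1).
have e20 : 0 < e2 by rewrite divr_gt0// mulr_gt0.
pose e := Num.sqrt e2.
have e0 : 0 < e by rewrite sqrtr_gt0.
have eE : e ^+ 2 = e2 by rewrite sqr_sqrtr// ltW.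
exists (eps * e2 / (2 * (int3 f + 1))).
  by apply: divr_gt0; exact: mulr_gt0.
move=> x x' xx'.
have main z z' : enorm (z - z') < eps * e2 / (2 * (int3 f + 1)) -> pot f z - pot f z' < eps.
  move=> zz'; rewrite ltrBlDl; apply: le_lt_trans (pot_shift z z' gf fM e0) _.
  rewrite ltrD2l eE [ltRHS](_ : _ = eps / 2 + eps / 2); last by field.
  apply: ler_ltD.
    rewrite /e2 [leLHS](_ : _ = (c1 - 1) * (eps / (2 * c1))); last by rewrite /c1; ring.
    rewrite mulrBl mul1r [leLHS](_ : _ = eps / 2 - eps / (2 * c1)); last first.
      by field; rewrite gt_eqF.
    by rewrite gerBl ltW// divr_gt0// mulr_gt0.
  rewrite -mulrA ltr_pdivrMl//.
  move: zz'; rewrite ltr_pdivlMr; last exact: mulr_gt0.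
  have := enorm_ge0 (z - z'); nra.
have h1 := main _ _ xx'.
have h2 : pot f x' - pot f x < eps by apply: main; rewrite enorm_subC.
by rewrite ltr_norml ltrNl opprB h1 h2.
Qed.

Lemma pot_continuous f : bdensity f -> continuous (pot f).
Proof.
move=> gf x; apply/cvgrPdist_lt => eps eps0.
have [d d0 dP] := pot_unif gf eps0.
have d3 : 0 < d / 3 by rewrite divr_gt0.
near=> y; apply: dP.
have : ball x (d / 3) y by near: y; exact: (nbhsx_ballx x _ d3).
move=> [[/= b1 b2] /= b3]; apply: le_lt_trans (enorm_le_sum _) _ => /=.
move: b1 b2 b3; rewrite /ball /=; lra.
Unshelve. all: by end_near.
Qed.

End pot_continuity.

Section dilations.
Context {R : realType}.
Local Notation mR := (measurableTypeR R).
Local Notation M3 := (mR * mR * mR)%type.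
Implicit Types f g w : R3 R -> R.

Definition dilation (l : R) (x : R3 R) : R3 R := (l * x.1.1, l * x.1.2, l * x.2).

Lemma measurable_dil l : measurable_fun [set: M3] (dilation l : M3 -> M3).
Proof.
have := measurable_affine3 l 0 0 0.
by apply: eq_measurable_fun => x _; rewrite !addr0.
Qed.

Lemma integral_dil l f : 0 < l -> measurable_fun [set: M3] f -> (forall x, 0 <= f x) ->
  (\int[leb3]_x (f x)%:E = (l ^+ 3)%:E * \int[leb3]_x (f (dilation l x))%:E)%E.
Proof.
move=> l0 mf f0.
have l1 : l != 0 by rewrite gt_eqF.
rewrite (ge0_integral_affine3 0 0 0 l1 (ge0_measE mf))//.
rewrite gtr0_norm//; congr (_ * _)%E; apply: eq_integral => x _.
by rewrite !addr0.
Qed.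

Lemma nnL1_dil l f : 0 < l -> nnL1 f -> nnL1 (fun x => f (dilation l x)).
Proof.
move=> l0 Lf; have [mf f0 fy] := Lf; split => //.
- exact: (measurableT_comp mf (measurable_dil l)).
- move: fy; rewrite (integral_dil l0 mf f0).
  by apply: contraTT; rewrite -!leNgt !leye_eq => /eqP ->; rewrite gt0_muley ?lte_fin ?exprn_gt0.
Qed.

Lemma int3_dil l f : 0 < l -> nnL1 f -> int3 (fun x => f (dilation l x)) = l ^- 3 * int3 f.
Proof.
move=> l0 Lf; have [mf f0 fy] := Lf.
have := integral_dil l0 mf f0; rewrite (int3E Lf) (int3E (nnL1_dil l0 Lf)) -EFinM => -[->].
by rewrite mulKf// gt_eqF// exprn_gt0.
Qed.

Lemma bdensity_dil l f : 0 < l -> bdensity f -> bdensity (fun x => f (dilation l x)).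
Proof. by move=> l0 [Lf [M fM]]; split; [exact: nnL1_dil|exists M]. Qed.

Lemma enorm_dil l x : 0 < l -> enorm (dilation l x) = l * enorm x.
Proof.
move=> l0; rewrite /enorm /= !exprMn -!mulrDr sqrtrM ?sqr_ge0// sqrtr_sqr.
by rewrite gtr0_norm.
Qed.

Lemma pot_dil l f x : 0 < l -> bdensity f ->
  pot (fun y => f (dilation l y)) x = l ^- 2 * pot f (dilation l x).
Proof.
move=> l0 gf; rewrite !pot_int3.
have -> : l ^- 2 * int3 (fun y => f y * (enorm (dilation l x - y))^-1) =
  l * (l ^- 3 * int3 (fun y => f y * (enorm (dilation l x - y))^-1)).
  by field; rewrite gt_eqF.
rewrite -(int3_dil l0 (nnL1_kernel (dilation l x) gf)) -int3Z ?ltW//; last first.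
  exact: (nnL1_dil l0 (nnL1_kernel (dilation l x) gf)).
apply: eq_int3 => y.
have -> : dilation l x - dilation l y = dilation l (x - y).
  by rewrite /dilation /= !mulrBr.
rewrite enorm_dil// invfM mulrCA; congr (_ * _).
by rewrite mulrA mulfV ?mul1r// gt_eqF.
Qed.

Lemma coulomb_form_dil l f : 0 < l -> bdensity f ->
  coulomb_form (fun x => f (dilation l x)) (fun x => f (dilation l x)) = l ^- 5 * coulomb_form f f.
Proof.
move=> l0 gf; rewrite /coulomb_form.
have -> : l ^- 5 * int3 (fun x => f x * pot f x) = l ^- 2 * (l ^- 3 * int3 (fun x => f x * pot f x)).
  by field; rewrite gt_eqF.
rewrite -(int3_dil l0 (nnL1_coulomb_form gf gf)) -int3Z; last 2 first.
- by rewrite invr_ge0 exprn_ge0// ltW.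
- exact: (nnL1_dil l0 (nnL1_coulomb_form gf gf)).
by apply: eq_int3 => x; rewrite pot_dil// mulrCA.
Qed.

End dilations.

(** * Energy of the Fermi ball *)

Section kinetic_profile.
Context {R : realType}.
Local Notation mR := (measurableTypeR R).
Local Notation M3 := (mR * mR * mR)%type.

(** g p is the kinetic energy of one particle of momentum p. *)
Definition dispersion (g : R -> R) : Prop :=
  [/\ continuous g, forall p, 0 <= p -> 0 <= g p &
      forall p p', 0 <= p -> p <= p' -> g p <= g p'].

(** The energy of a Fermi sea filled up to momentum b. *)
Definition ball_energy (g : R -> R) (b : R) : R :=
  int3 (fun p => \1_(eball b : set M3) p * g (enorm p)).

Lemma eball_le0 (b : R) : b <= 0 -> eball b = set0 :> set (R3 R).
Proof.
move=> b0; rewrite -subset0 => p; rewrite /eball /= => pb.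
by have := lt_le_trans pb b0; rewrite ltNge enorm_ge0.
Qed.

Lemma nnL1_indic_eball (b : R) : nnL1 (\1_(eball b : set M3)).
Proof.
split.
- by apply: measurable_indic; exact: measurable_eball.
- by move=> p; rewrite indicE.
- rewrite integral_indic ?setIT//; last exact: measurable_eball.
  have [b0|b0] := leP b 0; first by rewrite eball_le0// measure0.
  by rewrite [ltLHS](eball_measure b0) ltry.
Qed.

Lemma int3_indic_eball (b : R) : 0 <= b -> int3 (\1_(eball b : set M3)) = ball_vol b.
Proof.
rewrite le_eqVlt => /predU1P[<-|b0].
  rewrite eball_le0// /int3 integral0_eq ?fine0//; last by move=> p _; rewrite indic0.
  by rewrite /ball_vol expr0n mulr0.
rewrite /int3 integral_indic ?setIT//; last exact: measurable_eball.
by rewrite [X in fine X](eball_measure b0).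
Qed.

Section with_dispersion.
Variable g : R -> R.
Hypothesis dg : dispersion g.

Lemma nnL1_ball_energy (b : R) : nnL1 (fun p => \1_(eball b : set M3) p * g (enorm p)).
Proof.
have [cg g0 gmono] := dg.
have gb0 : 0 <= g `|b| by exact: g0.
apply: (nnL1_le (nnL1Z gb0 (nnL1_indic_eball b))).
- apply: measurable_funM.
    by apply: measurable_indic; exact: measurable_eball.
  exact: (measurableT_comp (continuous_measurable_fun cg) measurable_enorm_id).
- by move=> p; rewrite mulr_ge0 ?indicE// g0// enorm_ge0.
- move=> p; rewrite mulrC indicE; have [pb|_] := boolP (p \in _); last by rewrite !mulr0.
  rewrite ler_wpM2r// gmono ?enorm_ge0//; move: pb; rewrite inE /eball /= => pb.
  by rewrite (le_trans (ltW pb))// ler_norm.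
Qed.

(** As a function of the volume of the Fermi ball the energy is convex with
derivative g: inside the ball of radius a particles have energy at most g a,
outside at least g a, so passing from a to b costs at least g a per unit of
volume. *)
Lemma ball_energy_subgrad (a b : R) : 0 <= a -> 0 <= b ->
  ball_energy g a + g a * (ball_vol b - ball_vol a) <= ball_energy g b.
Proof.
have [cg g0 gmono] := dg; move=> a0 b0.
have ga : 0 <= g a by exact: g0.
rewrite mulrBr addrA lerBlDr -!int3_indic_eball// -!int3Z//; try exact: nnL1_indic_eball.
have La := nnL1_ball_energy a; have Lb := nnL1_ball_energy b.
have Ia := nnL1Z ga (nnL1_indic_eball a); have Ib := nnL1Z ga (nnL1_indic_eball b).
rewrite -(int3D La Ib) -(int3D Lb Ia).
apply: int3_le; [exact: (nnL1D La Ib)|exact: (nnL1D Lb Ia)|] => p.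
have p0 := enorm_ge0 p.
rewrite !indicE; case: (boolP (p \in eball a)); case: (boolP (p \in eball b));
  rewrite ?inE ?notin_setE /eball /= => pb pa; rewrite !(mul1r, mul0r, mulr1, mulr0, addr0, add0r)//.
- by apply: gmono => //; exact: ltW.
- by apply: gmono => //; rewrite leNgt; apply/negP.
Qed.

Lemma ball_energy0 : ball_energy g 0 = 0.
Proof.
rewrite /ball_energy eball_le0// /int3 integral0_eq ?fine0// => p _.
by rewrite indic0 mul0r.
Qed.

End with_dispersion.

Lemma ball_energy_sub (g h : R -> R) (b e : R) : dispersion g -> dispersion h ->
  0 <= b -> 0 <= e -> (forall p, 0 <= p -> p <= b -> h p <= g p + e) ->
  ball_energy h b <= ball_energy g b + e * ball_vol b.
Proof.
move=> dg dh b0 e0 hg; have [_ g0 _] := dg.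
have Lg := nnL1_ball_energy dg b; have Ie := nnL1Z e0 (nnL1_indic_eball b).
rewrite -int3_indic_eball// -(int3Z e0 (nnL1_indic_eball b)) -(int3D Lg Ie).
apply: int3_le; [exact: nnL1_ball_energy|exact: (nnL1D Lg Ie)|] => p.
rewrite indicE; have [pb|_] := boolP (p \in _); last by rewrite !mul0r mulr0 addr0.
rewrite !mul1r mulr1 hg ?enorm_ge0//.
by move: pb; rewrite inE => /ltW.
Qed.

Definition quad_disp (k p : R) : R := p ^+ 2 / k.

Lemma dispersion_quad (k : R) : 0 < k -> dispersion (quad_disp k).
Proof.
move=> k0; split.
- move=> p; apply: cvgM; [exact: exprn_continuous|exact: cvg_cst].
- by move=> p p0; rewrite /quad_disp divr_ge0 ?sqr_ge0 ?ltW.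
- move=> p p' p0 pp'; rewrite /quad_disp ler_wpM2r ?invr_ge0 ?(ltW k0)//.
  by rewrite ler_pXn2r ?nnegrE ?(le_trans p0).
Qed.

Lemma ball_energy_quad_scale (k b : R) : 0 < k -> 0 < b ->
  ball_energy (quad_disp k) b = b ^+ 5 * ball_energy (quad_disp k) 1.
Proof.
move=> k0 b0; have L := nnL1_ball_energy (dispersion_quad k0).
have := int3_dil b0 (L b).
rewrite (_ : int3 _ = b ^+ 2 * ball_energy (quad_disp k) 1).
  rewrite -/(ball_energy _ _) => H.
  have bN : b != 0 by rewrite gt_eqF.
  have -> : b ^+ 5 * ball_energy (quad_disp k) 1 = b ^+ 3 * (b ^+ 2 * ball_energy (quad_disp k) 1) by ring.
  by rewrite H mulrA mulfV ?mul1r// expf_neq0.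
rewrite /ball_energy -int3Z ?sqr_ge0//; apply: eq_int3 => p.
have -> : \1_(eball b : set M3) (dilation b p) = \1_(eball 1 : set M3) p :> R.
  rewrite !indicE; congr ((nat_of_bool _)%:R).
  apply/idP/idP; rewrite !inE /eball /= enorm_dil//.
    by rewrite -[ltRHS]mulr1 ltr_pM2l.
  by rewrite -[X in _ -> _ < X](mulr1 b) ltr_pM2l.
by rewrite enorm_dil// /quad_disp exprMn; ring.
Qed.

(** Letting h tend to 0, without limits: the device by which every first variation
below is extracted from a family of inequalities. *)
Lemma ge0_limit (X K h0 : R) : 0 < h0 ->
  (forall h, 0 < h -> h <= h0 -> 0 <= X + K * h) -> 0 <= X.
Proof.
move=> h00 H; rewrite leNgt; apply/negP => X0.
have K0 : 0 < `|K| + 1 by rewrite ltr_wpDl.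
pose h := Num.min h0 (- X / (2 * (`|K| + 1))).
have hp : 0 < h by rewrite lt_min h00 divr_gt0 ?oppr_gt0// mulr_gt0.
have := H h hp; rewrite ge_min lexx => /(_ isT).
have hX : h * (2 * (`|K| + 1)) <= - X.
  by rewrite -ler_pdivlMr ?mulr_gt0// ge_min lexx orbT.
have Kh : K * h <= `|K| * h by rewrite ler_wpM2r ?ler_norm// ltW.
nra.
Qed.

(** The two sides agree at b = 1, so the inequality forces their derivatives there
to coincide. *)
Lemma poly_touch (x y : R) :
  (forall b, 0 < b -> y * (b ^+ 3 - 1) <= x * (b ^+ 5 - 1)) -> 5 * x = 3 * y.
Proof.
move=> H; pose K := 26 * `|x| + 4 * `|y|.
have bnd (z q M : R) : `|q| <= M -> z * q <= M * `|z|.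
  by move=> qM; apply: le_trans (ler_norm _) _; rewrite normrM mulrC ler_wpM2r.
(* With b = 1 - h, then b = 1 + h; K bounds the remainders of second order. *)
apply/eqP; rewrite eq_le; apply/andP; split; rewrite -subr_ge0.
- apply: (@ge0_limit _ K (2^-1)) => // h h0 h1.
  have b0 : 0 < 1 - h by lra.
  have := H _ b0.
  rewrite (_ : (1 - h) ^+ 3 - 1 = - h * (3 + h * (- 3 + h))); last by ring.
  rewrite (_ : (1 - h) ^+ 5 - 1 = - h * (5 + h * (- 10 + h * (10 + h * (- 5 + h))))); last by ring.
  set q1 := - 10 + _; set q2 := - 3 + h.
  rewrite [leLHS]mulrCA [leRHS]mulrCA ler_nM2l ?oppr_lt0// => H1.
  have B1 : - x * q1 <= 26 * `|x|.
    by rewrite -normrN; apply: bnd; rewrite ler_norml /q1; apply/andP; split; nra.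
  have B2 : y * q2 <= 4 * `|y|.
    by apply: bnd; rewrite ler_norml /q2; apply/andP; split; lra.
  have := mulr_ge0 (ltW h0) (_ : 0 <= K - (- x * q1 + y * q2)).
  rewrite /K => /(_ ltac:(lra)); lra.
- apply: (@ge0_limit _ K 1) => // h h0 h1.
  have b0 : 0 < 1 + h by lra.
  have := H _ b0.
  rewrite (_ : (1 + h) ^+ 3 - 1 = h * (3 + h * (3 + h))); last by ring.
  rewrite (_ : (1 + h) ^+ 5 - 1 = h * (5 + h * (10 + h * (10 + h * (5 + h))))); last by ring.
  set q1 := 10 + _; set q2 := 3 + h.
  rewrite [leLHS]mulrCA [leRHS]mulrCA ler_pM2l// => H1.
  have B1 : x * q1 <= 26 * `|x|.
    by apply: bnd; rewrite ler_norml /q1; apply/andP; split; nra.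
  have B2 : - y * q2 <= 4 * `|y|.
    by rewrite -normrN; apply: bnd; rewrite ler_norml /q2; apply/andP; split; lra.
  have := mulr_ge0 (ltW h0) (_ : 0 <= K - (x * q1 + - y * q2)).
  rewrite /K => /(_ ltac:(lra)); lra.
Qed.

(** The factor 3/5 is found without integrating p^2: the energy scales as b^5, the
volume as b^3, and the subgradient inequality makes the two tangent at b = 1. *)
Lemma ball_energy_quad (k b : R) : 0 < k -> 0 <= b ->
  ball_energy (quad_disp k) b = 3 / 5 * (quad_disp k b * ball_vol b).
Proof.
move=> k0; rewrite le_eqVlt => /predU1P[<-|b0].
  by rewrite ball_energy0 /ball_vol expr0n /= !mulr0.
rewrite ball_energy_quad_scale//.
have H : 5 * ball_energy (quad_disp k) 1 = 3 * (k^-1 * ball_vol 1).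
  apply: poly_touch => c c0.
  have := ball_energy_subgrad (dispersion_quad k0) ler01 (ltW c0).
  rewrite (ball_energy_quad_scale k0 c0) /quad_disp /ball_vol.
  set E := ball_energy _ 1; set k' := k^-1; lra.
have -> : ball_energy (quad_disp k) 1 = 3 / 5 * (k^-1 * ball_vol 1) by lra.
rewrite /quad_disp /ball_vol; ring.
Qed.

End kinetic_profile.

(** * Dispersion relations and kinetic laws *)

Section dispersion_relations.
Context {R : realType}.

Definition rel_disp (m c p : R) : R :=
  Num.sqrt (c ^+ 2 * p ^+ 2 + m ^+ 2 * c ^+ 4) - m * c ^+ 2.

Section fixed.
Variables (m c : R).
Hypotheses (m0 : 0 < m) (c0 : 0 < c).

Let rad (p : R) := c ^+ 2 * p ^+ 2 + m ^+ 2 * c ^+ 4.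

Let rad_ge0 p : 0 <= rad p.
Proof. by rewrite addr_ge0// mulr_ge0// ?sqr_ge0// exprn_ge0// ltW. Qed.

Let sqrt_rad p : Num.sqrt (rad p) ^+ 2 = rad p.
Proof. by rewrite sqr_sqrtr. Qed.

Let mc2 : 0 < m * c ^+ 2.
Proof. by rewrite mulr_gt0// exprn_gt0. Qed.

(** The relation (D + m c^2)^2 = c^2 p^2 + m^2 c^4 free of square roots. *)
Lemma rel_disp_eq p : rel_disp m c p ^+ 2 + 2 * (m * c ^+ 2) * rel_disp m c p =
  c ^+ 2 * p ^+ 2.
Proof.
rewrite /rel_disp -/(rad p); have := sqrt_rad p; set S := Num.sqrt _ => SE.
rewrite (_ : _ + _ = S ^+ 2 - m ^+ 2 * c ^+ 4); last by ring.
by rewrite SE /rad; ring.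
Qed.

Lemma rel_disp_ge0 p : 0 <= rel_disp m c p.
Proof.
rewrite subr_ge0 -(@ler_pXn2r _ 2) ?nnegrE ?sqrtr_ge0 ?(ltW mc2)// sqrt_rad /rad.
by rewrite exprMn -exprM lerDr mulr_ge0 ?sqr_ge0.
Qed.

Lemma rel_disp_mono p p' : 0 <= p -> p <= p' -> rel_disp m c p <= rel_disp m c p'.
Proof.
move=> p0 pp'; rewrite lerD2r ler_sqrt; last exact: rad_ge0.
rewrite lerD2r ler_wpM2l ?sqr_ge0// ler_pXn2r// nnegrE (le_trans p0)//.
Qed.

Lemma dispersion_rel : dispersion (rel_disp m c).
Proof.
split; [|by move=> p _; exact: rel_disp_ge0|exact: rel_disp_mono].
move=> p; apply: cvgB; last exact: cvg_cst.
apply: continuous_comp; last exact: sqrt_continuous.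
apply: cvgD; last exact: cvg_cst.
by apply: cvgM; [exact: cvg_cst|exact: exprn_continuous].
Qed.

Lemma rel_disp_le p : rel_disp m c p <= quad_disp (2 * m) p.
Proof.
rewrite /quad_disp ler_pdivlMr ?mulr_gt0//.
have E := rel_disp_eq p; have D0 := rel_disp_ge0 p.
have c2 : 0 < c ^+ 2 by rewrite exprn_gt0.
rewrite -(ler_pM2l c2); nra.
Qed.

(** From p^2/2m = D + D^2/(2 m c^2), where D <= p^2/2m is used in the quadratic
term: the relativistic correction is O(c^-2) at bounded momentum. *)
Lemma quad_disp_le p : quad_disp (2 * m) p <= rel_disp m c p + p ^+ 4 / (8 * m ^+ 3 * c ^+ 2).
Proof.
have E := rel_disp_eq p; have D0 := rel_disp_ge0 p; have le := rel_disp_le p.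
set D := rel_disp m c p in E D0 le *.
have c2 : 0 < c ^+ 2 by rewrite exprn_gt0.
have cN : c != 0 by rewrite gt_eqF.
have mN : m != 0 by rewrite gt_eqF.
have D2 : D ^+ 2 <= (quad_disp (2 * m) p) ^+ 2 by rewrite ler_pXn2r// nnegrE (le_trans D0).
have -> : quad_disp (2 * m) p = D + D ^+ 2 / (2 * m * c ^+ 2).
  rewrite /quad_disp.
  have -> : p ^+ 2 = (D ^+ 2 + 2 * (m * c ^+ 2) * D) / c ^+ 2 by rewrite E; field.
  by field; rewrite cN mN.
rewrite lerD2l.
have -> : p ^+ 4 / (8 * m ^+ 3 * c ^+ 2) = (quad_disp (2 * m) p) ^+ 2 / (2 * m * c ^+ 2).
  by rewrite /quad_disp; field; rewrite cN mN.
by rewrite ler_wpM2r// invr_ge0 mulr_ge0// ltW// mulr_gt0.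
Qed.

(** Uniform in c at bounded momentum, this is how a bound on the energy becomes a
bound on the momentum.  It uses D <= c p in D^2 + 2 m c^2 D = c^2 p^2. *)
Lemma rel_disp_lower p : 0 <= p -> p ^+ 2 <= rel_disp m c p * (2 * m + p / c).
Proof.
move=> p0; have E := rel_disp_eq p; have D0 := rel_disp_ge0 p.
set D := rel_disp m c p in E D0 *.
have Dcp : D <= c * p.
  rewrite -(@ler_pXn2r _ 2) ?nnegrE ?mulr_ge0 ?(ltW c0)// exprMn -E lerDl.
  by rewrite mulr_ge0// mulr_ge0// ltW.
have c2 : 0 < c ^+ 2 by rewrite exprn_gt0.
rewrite -(ler_pM2l c2) -E.
have -> : c ^+ 2 * (D * (2 * m + p / c)) = (c * p) * D + 2 * (m * c ^+ 2) * D.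
  by field; rewrite gt_eqF.
by rewrite lerD2r expr2 ler_wpM2r.
Qed.

Lemma rel_disp_lip p p' : 0 <= p -> p <= p' -> rel_disp m c p' - rel_disp m c p <= c * (p' - p).
Proof.
move=> p0 pp'; rewrite /rel_disp opprB addrA subrK lerBlDr.
rewrite -/(rad p) -/(rad p').
have := sqrt_rad p; have := sqrt_rad p'; have := sqrtr_ge0 (rad p).
set S := Num.sqrt (rad p); set S' := Num.sqrt (rad p') => S0 S'E SE.
have cp : c * p <= S.
  rewrite -(@ler_pXn2r _ 2) ?nnegrE ?mulr_ge0 ?(ltW c0)// SE exprMn lerDl.
  by rewrite mulr_ge0 ?sqr_ge0// exprn_ge0// ltW.
have d0 : 0 <= c * (p' - p) by rewrite mulr_ge0 ?(ltW c0)// subr_ge0.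
rewrite -(@ler_pXn2r _ 2) ?nnegrE ?sqrtr_ge0 ?addr_ge0// S'E sqrrD SE /rad.
have H := ler_wpM2l d0 cp.
rewrite -subr_ge0.
have -> : (c * (p' - p)) ^+ 2 + c * (p' - p) * S *+ 2 + (c ^+ 2 * p ^+ 2 + m ^+ 2 * c ^+ 4) -
  (c ^+ 2 * p' ^+ 2 + m ^+ 2 * c ^+ 4) = 2 * (c * (p' - p) * S - c * (p' - p) * (c * p)) by ring.
by rewrite mulr_ge0// subr_ge0.
Qed.

End fixed.
End dispersion_relations.

Section kinetic_law.
Context {R : realType}.
Local Notation mR := (measurableTypeR R).
Local Notation M3 := (mR * mR * mR)%type.

(** J is the kinetic energy density as a function of the particle density, phi its
derivative.  Convexity is expressed by the subgradient inequality alone, which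
suffices for all variations; [law_unif] is uniform continuity of phi on bounded
intervals. *)
Record kinetic_law (J phi : R -> R) : Prop := Law {
  law0 : J 0 = 0;
  law_sub : forall s t, 0 <= s -> 0 <= t -> J s + phi s * (t - s) <= J t;
  law_ge0 : forall s, 0 <= s -> 0 <= phi s;
  law_mono : forall s t, 0 <= s -> s <= t -> phi s <= phi t;
  law_unif : forall S e, 0 < e -> exists2 d, 0 < d &
    forall s t, 0 <= s <= S -> 0 <= t <= S -> `|s - t| <= d -> `|phi s - phi t| <= e
}.

Variable q : R.
Hypothesis q0 : 0 < q.

Local Notation eta := (fermi_momentum q).

Lemma eta_ge0 s : 0 <= eta s.
Proof. exact: powR_ge0. Qed.

Lemma eta_cube s : 0 <= s -> eta s ^+ 3 = 6 * pi ^+ 2 * s / q.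
Proof.
move=> s0; rewrite /fermi_momentum -powR_mulrn ?powR_ge0// -powRrM mulVf// powRr1//.
by rewrite divr_ge0 ?(ltW q0)// mulr_ge0// mulr_ge0// sqr_ge0.
Qed.

Lemma eta_mono s t : 0 <= s -> s <= t -> eta s <= eta t.
Proof.
move=> s0 st; have t0 := le_trans s0 st.
rewrite -(@ler_pXn2r _ 3) ?nnegrE ?eta_ge0// !eta_cube//.
by rewrite ler_wpM2r ?invr_ge0 ?(ltW q0)// ler_wpM2l// mulr_ge0// sqr_ge0.
Qed.

(** The cube root is subadditive, which gives its uniform continuity including
at 0. *)
Lemma eta_sub s t : 0 <= s -> s <= t -> eta t - eta s <= eta (t - s).
Proof.
move=> s0 st; have t0 := le_trans s0 st; have d0 : 0 <= t - s by rewrite subr_ge0.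
have e1 := eta_ge0 s; have e2 := eta_ge0 (t - s).
rewrite lerBlDr -(@ler_pXn2r _ 3) ?nnegrE ?eta_ge0 ?addr_ge0//.
have -> : eta t ^+ 3 = eta (t - s) ^+ 3 + eta s ^+ 3.
  by rewrite !eta_cube//; field; rewrite gt_eqF.
rewrite -subr_ge0.
have -> : (eta (t - s) + eta s) ^+ 3 - (eta (t - s) ^+ 3 + eta s ^+ 3) =
  3 * (eta (t - s) * eta s * (eta (t - s) + eta s)) by ring.
by rewrite !mulr_ge0// addr_ge0.
Qed.

(** Equal to 1 when disk_area is replaced by pi: the prefactor q/(8 pi^3) is such
that the Fermi ball of radius eta(s) contains s particles. *)
Definition kfac : R := q / (8 * pi ^+ 3) * (disk_area * (4 / 3)) * (6 * pi ^+ 2 / q).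

Lemma kfac_gt0 : 0 < kfac.
Proof.
have p0 : 0 < pi :> R := pi_gt0 R; have A0 := @disk_area_gt0 R.
by rewrite /kfac !mulr_gt0// ?invr_gt0 ?mulr_gt0 ?exprn_gt0// divr_gt0.
Qed.

Lemma pref_ball_vol s : 0 <= s -> q / (8 * pi ^+ 3) * ball_vol (eta s) = kfac * s.
Proof. by move=> s0; rewrite /ball_vol eta_cube// /kfac !mulrA; ring. Qed.

Definition kinetic_density (g : R -> R) (s : R) : R := q / (8 * pi ^+ 3) * ball_energy g (eta s).

Definition fermi_level (g : R -> R) (s : R) : R := kfac * g (eta s).

Let pref_ge0 : 0 <= q / (8 * pi ^+ 3).
Proof.
by rewrite divr_ge0 ?(ltW q0)// mulr_ge0// exprn_ge0// ltW// pi_gt0.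
Qed.

(** The subgradient inequality for the energy of Fermi balls, since their
volume is proportional to the density; uniform continuity of the derivative
comes from that of the Fermi momentum. *)
Lemma kinetic_density_law (g : R -> R) : dispersion g ->
  (forall H, exists2 L, 0 < L & forall p p', 0 <= p -> p <= p' -> p' <= H ->
    g p' - g p <= L * (p' - p)) ->
  kinetic_law (kinetic_density g) (fermi_level g).
Proof.
move=> dg lip; have [cg g0 gmono] := dg; have k0 := kfac_gt0.
split.
- rewrite /kinetic_density (_ : eta 0 = 0) ?ball_energy0 ?mulr0//.
  by rewrite /fermi_momentum mulr0 mul0r powR0// invr_eq0.
- move=> s t s0 t0; rewrite /kinetic_density /fermi_level.
  have H := ball_energy_subgrad dg (eta_ge0 s) (eta_ge0 t).
  apply: le_trans (ler_wpM2l pref_ge0 H); rewrite [leRHS]mulrDr lerD2l.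
  rewrite [leRHS]mulrCA [X in _ <= _ * X]mulrBr !pref_ball_vol//.
  by rewrite le_eqVlt; apply/orP; left; apply/eqP; ring.
- by move=> s s0; rewrite mulr_ge0 ?(ltW k0)// g0// eta_ge0.
- by move=> s t s0 st; rewrite ler_wpM2l ?(ltW k0)// gmono ?eta_ge0// eta_mono.
- move=> S e e0; have [L L0 HL] := lip (eta S).
  pose b := e / (kfac * L).
  have b0 : 0 < b by rewrite divr_gt0// mulr_gt0.
  have p20 : 0 < 6 * pi ^+ 2 :> R by rewrite mulr_gt0// exprn_gt0// pi_gt0.
  exists (b ^+ 3 * q / (6 * pi ^+ 2)); first by rewrite divr_gt0// mulr_gt0// exprn_gt0.
  have main s t : 0 <= s -> s <= t -> t <= S -> t - s <= b ^+ 3 * q / (6 * pi ^+ 2) ->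
      fermi_level g t - fermi_level g s <= e.
    move=> s0 st tS ts; rewrite /fermi_level -mulrBr.
    have d0 : 0 <= t - s by rewrite subr_ge0.
    have eb : eta (t - s) <= b.
      rewrite -(@ler_pXn2r _ 3) ?nnegrE ?eta_ge0 ?(ltW b0)// eta_cube//.
      by rewrite ler_pdivrMr// mulrC -ler_pdivlMr.
    have h1 : g (eta t) - g (eta s) <= L * b.
      apply: le_trans (HL _ _ (eta_ge0 s) (eta_mono s0 st) (eta_mono (le_trans s0 st) tS)) _.
      by rewrite ler_wpM2l ?(ltW L0)//; apply: le_trans eb; exact: eta_sub.
    apply: le_trans (ler_wpM2l (ltW k0) h1) _.
    by rewrite /b le_eqVlt; apply/orP; left; apply/eqP; field; rewrite !gt_eqF.
  move=> s t /andP[s0 sS] /andP[t0 tS]; rewrite ler_norml => /andP[h1 h2].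
  have lmono s' t' : 0 <= s' -> s' <= t' -> fermi_level g s' <= fermi_level g t'.
    by move=> ? ?; rewrite ler_wpM2l ?(ltW k0)// gmono ?eta_ge0// eta_mono.
  have [st|ts] := leP s t.
    rewrite ler0_norm ?opprB; last by rewrite subr_le0 lmono.
    by apply: main => //; lra.
  rewrite ger0_norm; last by rewrite subr_ge0 lmono// ltW.
  by apply: main => //; exact: ltW.
Qed.

Lemma Rintegral_ball (g : R -> R) (b : R) :
  \int[leb3]_(p in (eball b : set M3)) g (enorm p) = ball_energy g b.
Proof.
rewrite Rintegral_mkcond /ball_energy /int3 /Rintegral; congr fine.
apply: eq_integral => p _; rewrite /patch indicE.
by case: ifP => _; rewrite ?mul1r ?mul0r.
Qed.

Lemma jmcE m c s : jmc q m c s = kinetic_density (rel_disp m c) s.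
Proof. by rewrite /jmc /kinetic_density -Rintegral_ball. Qed.

Lemma jinfE m s : jinf q m s = kinetic_density (quad_disp (2 * m)) s.
Proof. by rewrite /jinf /kinetic_density -Rintegral_ball. Qed.

Lemma law_c m c : 0 < m -> 0 < c -> kinetic_law (jmc q m c) (fermi_level (rel_disp m c)).
Proof.
move=> m0 c0; rewrite (_ : jmc q m c = kinetic_density (rel_disp m c)); last first.
  by apply/funext => s; exact: jmcE.
apply: kinetic_density_law; first exact: dispersion_rel.
by move=> H; exists c => // p p' p0 pp' _; exact: rel_disp_lip.
Qed.

Lemma law_inf m : 0 < m -> kinetic_law (jinf q m) (fermi_level (quad_disp (2 * m))).
Proof.
move=> m0; have m20 : 0 < 2 * m by rewrite mulr_gt0.
rewrite (_ : jinf q m = kinetic_density (quad_disp (2 * m))); last first.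
  by apply/funext => s; exact: jinfE.
apply: kinetic_density_law; first exact: dispersion_quad.
move=> H; exists ((`|H| + 1) / m); first by rewrite divr_gt0// ltr_wpDl.
move=> p p' p0 pp' p'H; rewrite /quad_disp -mulrBl ler_pdivrMr//.
have -> : (`|H| + 1) / m * (p' - p) * (2 * m) = 2 * (`|H| + 1) * (p' - p).
  by field; rewrite gt_eqF.
have := ler_norm H; nra.
Qed.

(** The nonrelativistic law is a power of exponent 5/3, so J(s) = (3/5) s J'(s). *)
Lemma jinf_quad m s : 0 < m -> 0 <= s ->
  jinf q m s = 3 / 5 * (s * fermi_level (quad_disp (2 * m)) s).
Proof.
move=> m0 s0; rewrite jinfE /kinetic_density ball_energy_quad ?mulr_gt0// ?eta_ge0//.
rewrite mulrCA; congr (_ * _); rewrite mulrCA pref_ball_vol// /fermi_level; ring.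
Qed.

Lemma jmc_le m c s : 0 < m -> 0 < c -> 0 <= s -> jmc q m c s <= jinf q m s.
Proof.
move=> m0 c0 s0; rewrite jmcE jinfE ler_wpM2l//.
have := ball_energy_sub (dispersion_quad (mulr_gt0 (ltr0Sn R 1) m0))
  (dispersion_rel m0 c0) (eta_ge0 s) (lexx 0).
rewrite mul0r addr0; apply => p p0 _; rewrite addr0.
exact: rel_disp_le.
Qed.

Lemma jinf_le m c s S : 0 < m -> 0 < c -> 0 <= s -> s <= S ->
  jinf q m s <= jmc q m c s + eta S ^+ 4 / (8 * m ^+ 3 * c ^+ 2) * (kfac * s).
Proof.
move=> m0 c0 s0 sS; rewrite jmcE jinfE -pref_ball_vol// [X in _ + X]mulrCA -mulrDr.
rewrite ler_wpM2l//.
have e0 : 0 <= eta S ^+ 4 / (8 * m ^+ 3 * c ^+ 2).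
  by rewrite divr_ge0 ?exprn_ge0 ?eta_ge0// mulr_ge0 ?sqr_ge0// mulr_ge0// exprn_ge0// ltW.
apply: (ball_energy_sub (dispersion_rel m0 c0) (dispersion_quad (mulr_gt0 (ltr0Sn R 1) m0)) (eta_ge0 s) e0).
move=> p p0 ps; apply: le_trans (quad_disp_le m0 c0 p) _.
rewrite lerD2l ler_wpM2r//.
  by rewrite invr_ge0 mulr_ge0 ?sqr_ge0// mulr_ge0// exprn_ge0// ltW.
by rewrite ler_pXn2r ?nnegrE ?eta_ge0// (le_trans ps)// eta_mono.
Qed.

Lemma fermi_level_inf_le m c s S : 0 < m -> 0 < c -> 0 <= s -> s <= S ->
  fermi_level (quad_disp (2 * m)) s <=
  fermi_level (rel_disp m c) s + kfac * (eta S ^+ 4 / (8 * m ^+ 3 * c ^+ 2)).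
Proof.
move=> m0 c0 s0 sS; rewrite /fermi_level -mulrDr ler_wpM2l ?(ltW kfac_gt0)//.
apply: le_trans (quad_disp_le m0 c0 _) _.
rewrite lerD2l ler_wpM2r//.
  by rewrite invr_ge0 mulr_ge0 ?sqr_ge0// mulr_ge0// exprn_ge0// ltW.
by rewrite ler_pXn2r ?nnegrE ?eta_ge0// eta_mono.
Qed.

End kinetic_law.

(** * Euler-Lagrange inequalities and the virial identity *)

Section boxes.
Context {R : realType}.
Local Notation mu := (@lebesgue_measure R).
Local Notation mR := (measurableTypeR R).
Local Notation M3 := (mR * mR * mR)%type.

(** A test density supported near a given point, on a box, which is a ball of the
product topology. *)
Lemma nbhs_box (x0 : R3 R) (P : R3 R -> Prop) : (\forall y \near x0, P y) ->
  exists B : set M3, [/\ measurable B, forall y, B y -> P y,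
    bdensity (\1_B : R3 R -> R) & 0 < int3 (\1_B : R3 R -> R)].
Proof.
move=> /nbhs_ballP[d /= d0 dP].
pose J (c : R) : set mR := `]c - d, c + d[%classic.
have mJ c : measurable (J c) by exact: measurable_itv.
have JE c : mu (J c) = (2 * d)%:E.
  rewrite lebesgue_measure_itv /= lte_fin.
  have -> : c - d < c + d by lra.
  by rewrite -EFinB; congr EFin; ring.
pose B : set M3 := (J x0.1.1 `*` J x0.1.2) `*` J x0.2.
have mB : measurable B by apply: measurableX => //; exact: measurableX.
have BE : leb3 B = ((2 * d) * (2 * d) * (2 * d))%:E.
  have -> : leb3 B = (leb2 (J x0.1.1 `*` J x0.1.2) * mu (J x0.2))%E.
    by apply: leb3X => //; exact: measurableX.
  by rewrite leb2X// !JE -!EFinM.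
have IB : (\int[leb3]_x (\1_B x : R)%:E = ((2 * d) * (2 * d) * (2 * d))%:E)%E.
  by rewrite integral_indic ?setIT.
exists B; split => //.
- move=> y [[/= h1 h2] h3]; apply: dP.
  rewrite /J /= !in_itv /= in h1 h2 h3.
  by split; [split|]; rewrite /ball /= ltr_norml; apply/andP; split; lra.
- split; last by exists 1 => x; rewrite indicE; case: (_ \in _).
  split; [exact: measurable_indic|by move=> x; rewrite indicE|by rewrite IB ltry].
- by rewrite /int3 IB /= !mulr_gt0.
Qed.

End boxes.

Section real_algebra.
Context {R : realType}.

(** Bookkeeping for one step of [el_integral].  The trial density is
(1 - ep t) rho + ep a, with t the ratio of the masses of a and rho; X and Z are
the integrals of a against phi of the old and the new density, P and Y those of
rho, and e bounds the variation of phi.  After division by ep only errors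
proportional to e remain. *)
Lemma el_algebra (kappa t e ep I N P C W Q X Y Z D Tf Tr : R) :
  0 < kappa -> 0 <= t -> 0 < e -> 0 < ep -> ep <= e -> t * N = I ->
  0 <= C -> 0 <= W -> 0 <= Q ->
  Z <= X + e * I -> P <= Y + e * N ->
  Tf + ep * t * Y <= Tr + ep * Z ->
  D = (1 - ep * t) ^+ 2 * C + 2 * ((1 - ep * t) * ep) * W + ep ^+ 2 * Q ->
  Tr - kappa * (2^-1 * C) <= Tf - kappa * (2^-1 * D) ->
  0 <= X - t * P + kappa * t * C - kappa * W + (2 * I + kappa * t * W) * e.
Proof.
move=> kappa0 t0 e0 ep0 epe tN C0 W0 Q0 H1 H2 H3 DE H4.
have H5 : kappa * (2^-1 * D) - kappa * (2^-1 * C) <= ep * (X + e * I - t * (P - e * N)).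
  have : ep * t * (P - e * N) <= ep * t * Y by rewrite ler_wpM2l ?mulr_ge0 ?(ltW ep0)//; lra.
  have : ep * Z <= ep * (X + e * I) by rewrite ler_wpM2l ?(ltW ep0).
  lra.
have H6 : kappa * (2^-1 * D) - kappa * (2^-1 * C) =
  ep * (kappa * (- t * C + W - ep * t * W) + 2^-1 * kappa * ep * (t ^+ 2 * C + Q)).
  by rewrite DE; field.
rewrite H6 ler_pM2l// in H5.
have H7 : 0 <= 2^-1 * kappa * ep * (t ^+ 2 * C + Q).
  by rewrite mulr_ge0 ?addr_ge0 ?mulr_ge0 ?sqr_ge0 ?(ltW ep0) ?(ltW kappa0).
have H8 : ep * (kappa * t * W) <= e * (kappa * t * W).
  by rewrite ler_wpM2r// mulr_ge0// mulr_ge0// ltW.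
have H9 : t * (e * N) = e * I by rewrite -tN; ring.
lra.
Qed.

(** The step ep must be small enough that the trial density is nonnegative and
that phi varies by at most e. *)
Lemma el_step (t e d K : R) : 0 <= t -> 0 < e -> 0 < d -> 0 < K ->
  exists ep, [/\ 0 < ep, ep <= 1, ep <= e, ep * t <= 1 & ep * K <= d].
Proof.
move=> t0 e0 d0 K0; have t10 : 0 < t + 1 by rewrite ltr_wpDl.
exists (Num.min (Num.min 1 e) (Num.min (t + 1)^-1 (d / K))).
set ep := Num.min _ _.
have ep0 : 0 < ep by rewrite !lt_min ltr01 e0 invr_gt0 t10 divr_gt0.
split => //; try by rewrite !ge_min lexx ?orbT.
  have : ep * (t + 1) <= 1 by rewrite -ler_pdivlMr// div1r !ge_min lexx !orbT.
  by apply: le_trans; rewrite ler_wpM2l ?(ltW ep0)// lerDl.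
by rewrite -ler_pdivlMr// !ge_min lexx !orbT.
Qed.

Lemma mix_sub (ep t r a : R) : (1 - ep * t) * r + ep * a - r = ep * (a - t * r).
Proof. by ring. Qed.

Lemma mix_mass (ep t n : R) : (1 - ep * t) * n + ep * (t * n) = n.
Proof. by ring. Qed.

Lemma mix_le (Jf Jr p ep t r a : R) :
  Jf + p * (ep * (t * r - a)) <= Jr -> Jf + ep * t * (r * p) <= Jr + ep * (a * p).
Proof. lra. Qed.

Lemma dist_le_sum (a b A B : R) : 0 <= a -> a <= A -> 0 <= b -> b <= B ->
  `|a - b| <= A + B + 1.
Proof. by move=> ? ? ? ?; rewrite ler_norml; apply/andP; split; lra. Qed.

Lemma cube_close (h l d : R) : 0 < h -> h <= 2^-1 -> h * 7 <= d ->
  (1 - h) ^+ 3 <= l -> l <= (1 + h) ^+ 3 -> [/\ 0 < l, l <= 8 & `|l - 1| <= d].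
Proof.
move=> h0 h1 hd ll lu; split.
- by apply: lt_le_trans ll; rewrite exprn_gt0//; lra.
- by apply: (le_trans lu); nra.
- by rewrite ler_norml; apply/andP; split; nra.
Qed.

Lemma cube_mono (h : R) : 0 < h -> h <= 2^-1 ->
  [/\ 0 < 1 - h, 0 < 1 + h & (1 - h) ^+ 3 <= (1 + h) ^+ 3].
Proof. by move=> h0 h1; split; nra. Qed.

(** One step of [virial] with dilation factor 1 + h: the inequality between the
energies is divided by h, and e controls what is left. *)
Lemma virial_up (h e l X Y T P N kC : R) : 0 < h -> h <= 1 -> h <= e ->
  l = (1 + h) ^+ 3 -> 0 <= N -> 0 <= kC ->
  X <= T + (l - 1) * Y -> Y <= P + e * N ->
  T - kC <= l^-1 * X - (1 + h) * kC ->
  0 <= 3 * (P - T) - kC + (4 * `|P - T| + 7 * N) * e.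
Proof.
move=> h0 h1 he lE N0 C0 HX HY Hmin.
have hp : 0 < 1 + h by lra.
have l0 : 0 < l by rewrite lE exprn_gt0.
have l1 : 1 <= l by rewrite lE; nra.
have H1 : l * (T - kC) <= X - l * ((1 + h) * kC).
  have := ler_wpM2l (ltW l0) Hmin.
  by rewrite [leRHS]mulrBr [X in _ <= X - _]mulrA mulfV ?mul1r// gt_eqF.
pose s := 3 + 3 * h + h ^+ 2.
have sE : l - 1 = h * s by rewrite lE /s; ring.
have s3 : 3 <= s by rewrite /s; have := sqr_ge0 h; lra.
have s7 : s <= 7 by rewrite /s; nra.
have s4 : s - 3 <= 4 * e by rewrite /s; nra.
have H2 : 0 <= h * (s * (Y - T) - l * kC).
  rewrite sE in HX.
  have -> : h * (s * (Y - T) - l * kC) =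
      T + h * s * Y - l * ((1 + h) * kC) - l * (T - kC) - (h * s - (l - 1)) * T.
    by ring.
  rewrite sE subrr mul0r subr0; lra.
rewrite pmulr_rge0// in H2.
have A := ler_norm (P - T); have A0 := normr_ge0 (P - T).
have B1 : s * (Y - T) <= s * (P - T + e * N) by rewrite ler_wpM2l//; lra.
have e0 : 0 <= e by lra.
have eN : 0 <= e * N by rewrite mulr_ge0.
have B2 : s * (e * N) <= 7 * (e * N) by rewrite ler_wpM2r.
have B3 : (s - 3) * (P - T) <= 4 * e * `|P - T|.
  apply: (@le_trans _ _ ((s - 3) * `|P - T|)); first by rewrite ler_wpM2l// subr_ge0.
  by rewrite ler_wpM2r.
have B4 : kC <= l * kC by rewrite ler_peMl.
lra.
Qed.

(** The counterpart of [virial_up] for the dilation factor 1 - h, which yields the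
opposite inequality in the limit. *)
Lemma virial_down (h e l X Y T P N kC : R) : 0 < h -> h <= 2^-1 -> h <= e ->
  l = (1 - h) ^+ 3 -> 0 <= N -> 0 <= kC ->
  X <= T + (l - 1) * Y -> P <= Y + e * N ->
  T - kC <= l^-1 * X - (1 - h) * kC ->
  0 <= kC - 3 * (P - T) + (4 * `|P - T| + 7 * N) * e.
Proof.
move=> h0 h1 he lE N0 C0 HX HY Hmin.
have hp : 0 < 1 - h by lra.
have l0 : 0 < l by rewrite lE exprn_gt0.
have l1 : l <= 1 by rewrite lE; nra.
have H1 : l * (T - kC) <= X - l * ((1 - h) * kC).
  have := ler_wpM2l (ltW l0) Hmin.
  by rewrite [leRHS]mulrBr [X in _ <= X - _]mulrA mulfV ?mul1r// gt_eqF.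
pose s := 3 - 3 * h + h ^+ 2.
have sE : l - 1 = - h * s by rewrite lE /s; ring.
have s3 : s <= 3 by rewrite /s; nra.
have s0 : 0 <= s by rewrite /s; nra.
have s4 : 3 - s <= 4 * e by rewrite /s; have := sqr_ge0 h; lra.
have H2 : 0 <= h * (l * kC - s * (Y - T)).
  rewrite sE in HX.
  have -> : h * (l * kC - s * (Y - T)) =
      T + - h * s * Y - l * ((1 - h) * kC) - l * (T - kC) - (- h * s - (l - 1)) * T.
    by ring.
  rewrite sE subrr mul0r subr0; lra.
rewrite pmulr_rge0// in H2.
have A := ler_norm (P - T); have A0 := normr_ge0 (P - T).
have B1 : s * (P - T - e * N) <= s * (Y - T) by rewrite ler_wpM2l//; lra.
have e0 : 0 <= e by lra.
have eN : 0 <= e * N by rewrite mulr_ge0.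
have B2 : s * (e * N) <= 7 * (e * N) by rewrite ler_wpM2r//; lra.
have B3 : (3 - s) * (P - T) <= 4 * e * `|P - T|.
  apply: (@le_trans _ _ ((3 - s) * `|P - T|)); first by rewrite ler_wpM2l// subr_ge0.
  by rewrite ler_wpM2r.
have B4 : l * kC <= kC by rewrite ler_piMl.
lra.
Qed.

End real_algebra.

Section variational.
Context {R : realType}.
Local Notation mR := (measurableTypeR R).
Local Notation M3 := (mR * mR * mR)%type.
Implicit Types f g : R3 R -> R.

Lemma bdensity_meas f : bdensity f -> measurable_fun [set: M3] f.
Proof. by move=> [[]]. Qed.
Lemma bdensity_ge0 f : bdensity f -> forall x, 0 <= f x.
Proof. by move=> [[]]. Qed.
Lemma bdensity_nnL1 f : bdensity f -> nnL1 f.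
Proof. by move=> []. Qed.

Lemma coulomb_form_comb (k l : R) f g : 0 <= k -> 0 <= l -> bdensity f -> bdensity g ->
  coulomb_form (fun x => k * f x + l * g x) (fun x => k * f x + l * g x) =
  k ^+ 2 * coulomb_form f f + 2 * (k * l) * coulomb_form g f + l ^+ 2 * coulomb_form g g.
Proof.
move=> k0 l0 gf gg.
have gk := bdensityZ k0 gf; have gl := bdensityZ l0 gg; have gkl := bdensityD gk gl.
rewrite coulomb_formDr// !coulomb_formZr// (coulomb_formC gkl gf)
  (coulomb_formC gkl gg) !coulomb_formDr// !coulomb_formZr//.
rewrite (coulomb_formC gf gg).
move: (coulomb_form f f) (coulomb_form g f) (coulomb_form g g) => A B D; ring.
Qed.

Variables (J phi : R -> R).
Hypothesis HJ : kinetic_law J phi.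

Lemma J_ge0 s : 0 <= s -> 0 <= J s.
Proof.
move=> s0; have := law_sub HJ (lexx 0) s0; rewrite (law0 HJ) add0r subr0.
by apply: le_trans; rewrite mulr_ge0// (law_ge0 HJ).
Qed.

Lemma J_le s : 0 <= s -> J s <= phi s * s.
Proof.
move=> s0; have := law_sub HJ s0 (lexx 0).
by rewrite (law0 HJ) sub0r mulrN subr_le0.
Qed.

Lemma J_mono s t : 0 <= s -> s <= t -> J s <= J t.
Proof.
move=> s0 st; have t0 := le_trans s0 st; apply: le_trans (law_sub HJ s0 t0).
by rewrite lerDl mulr_ge0 ?subr_ge0// (law_ge0 HJ).
Qed.

Lemma measurable_mono_comp (h : R -> R) f :
  (forall s t, 0 <= s -> s <= t -> h s <= h t) ->
  measurable_fun [set: M3] f -> (forall x, 0 <= f x) ->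
  measurable_fun [set: M3] (fun x => h (f x)).
Proof.
(* The function is monotone on nonnegative arguments only. *)
move=> hm mf f0; pose h' (s : R) := h (Num.max s 0).
have mh : measurable_fun [set: R] h'.
  apply: nondecreasing_measurable => // s t st; apply: hm.
    by rewrite le_max lexx orbT.
  by rewrite le_max2.
have := measurableT_comp mh mf; apply: eq_measurable_fun => x _.
by rewrite /h' /= max_l.
Qed.

Lemma bdensity_Ub f : bdensity f -> exists2 M, 0 <= M & forall x, 0 <= f x <= M.
Proof.
move=> [[_ f0 _] [M fM]]; exists M; first exact: le_trans (fM (0, 0, 0)).
by move=> x; rewrite f0 fM.
Qed.

Lemma nnL1_phi f g : bdensity f -> nnL1 g -> nnL1 (fun x => g x * phi (f x)).
Proof.
move=> gf Lg; have [M M0 fM] := bdensity_Ub gf.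
apply: (@nnL1_bounded _ _ _ (phi M) Lg).
  by apply: measurable_mono_comp (bdensity_meas gf) (bdensity_ge0 gf); exact: (law_mono HJ).
by move=> x; have /andP[f0 fl] := fM x; rewrite (law_ge0 HJ)// (law_mono HJ).
Qed.

Lemma nnL1_J f : bdensity f -> nnL1 (fun x => J (f x)).
Proof.
move=> gf; apply: (nnL1_le (nnL1_phi gf (bdensity_nnL1 gf))).
- by apply: measurable_mono_comp (bdensity_meas gf) (bdensity_ge0 gf); exact: J_mono.
- by move=> x; exact: J_ge0 (bdensity_ge0 gf x).
- by move=> x; rewrite mulrC; exact: J_le (bdensity_ge0 gf x).
Qed.

Lemma phi_shift f g h (e : R) : bdensity f -> bdensity g -> nnL1 h -> 0 <= e ->
  (forall x, phi (f x) <= phi (g x) + e) ->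
  int3 (fun x => h x * phi (f x)) <= int3 (fun x => h x * phi (g x)) + e * int3 h.
Proof.
move=> gf gg Lh e0 H; have Le := nnL1Z e0 Lh; have [_ h0 _] := Lh.
rewrite -(int3Z e0 Lh) -(int3D (nnL1_phi gg Lh) Le).
apply: int3_le; [exact: nnL1_phi|exact: (nnL1D (nnL1_phi gg Lh) Le)|] => x.
by rewrite (mulrC e) -mulrDr ler_wpM2l.
Qed.

Variables (kappa : R) (rho : R3 R -> R).
Hypotheses (kappa0 : 0 < kappa) (grho : bdensity rho) (N0 : 0 < int3 rho).

Let N := int3 rho.
Let T f := int3 (fun x => J (f x)).
Let P := int3 (fun x => rho x * phi (rho x)).
Let C := coulomb_form rho rho.

Hypothesis minimal : forall f, bdensity f -> int3 f = N ->
  T rho - kappa * (2^-1 * C) <= T f - kappa * (2^-1 * coulomb_form f f).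

(** First variation of the energy at rho in the direction a - t rho, which
preserves the mass.  The subgradient inequality is taken at the trial density,
and the uniform continuity of phi brings it back to rho. *)
Lemma el_integral (a : R3 R -> R) : bdensity a ->
  0 <= int3 (fun x => a x * phi (rho x)) - int3 a / N * P + kappa * (int3 a / N) * C
       - kappa * coulomb_form a rho.
Proof.
move=> ga.
have [M M0 rhoM] := bdensity_Ub grho; have [Ma Ma0 aM] := bdensity_Ub ga.
pose t := int3 a / N.
have Ia0 : 0 <= int3 a := int3_ge0 (bdensity_ge0 ga).
have t0 : 0 <= t by rewrite divr_ge0// ltW.
have tN : t * N = int3 a by rewrite /t divfK// gt_eqF.
have W0 : 0 <= coulomb_form a rho := coulomb_form_ge0 (bdensity_ge0 ga) (bdensity_ge0 grho).
have C0 : 0 <= C := coulomb_form_ge0 (bdensity_ge0 grho) (bdensity_ge0 grho).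
have Q0 : 0 <= coulomb_form a a := coulomb_form_ge0 (bdensity_ge0 ga) (bdensity_ge0 ga).
apply: (@ge0_limit _ _ (2 * int3 a + kappa * t * coulomb_form a rho) 1) => // e e0 _.
have [d d0 dP] := law_unif HJ (M + Ma) e0.
pose K := Ma + t * M + 1.
have K0 : 0 < K by rewrite ltr_wpDl// addr_ge0// mulr_ge0.
have [ep [ep0 ep1 epe ept epd]] := el_step t0 e0 d0 K0.
pose u := 1 - ep * t.
have u0 : 0 <= u by rewrite subr_ge0.
pose f x := u * rho x + ep * a x.
have gf : bdensity f by apply: bdensityD; apply: bdensityZ => //; exact: ltW.
have If : int3 f = N.
  have L1 := nnL1Z u0 (bdensity_nnL1 grho); have L2 := nnL1Z (ltW ep0) (bdensity_nnL1 ga).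
  rewrite (int3D L1 L2) (int3Z u0 (bdensity_nnL1 grho)) (int3Z (ltW ep0) (bdensity_nnL1 ga)).
  by rewrite -tN -/N; exact: mix_mass.
have fS x : 0 <= f x <= M + Ma.
  have /andP[r0 rM] := rhoM x; have /andP[a0 al] := aM x.
  have u1 : u <= 1 by rewrite /u gerBl mulr_ge0// ltW.
  rewrite addr_ge0 ?mulr_ge0 ?(ltW ep0)//= lerD//.
    by apply: le_trans rM; rewrite ler_piMl.
  by apply: le_trans al; rewrite ler_piMl.
have rS x : 0 <= rho x <= M + Ma.
  by have /andP[r0 rM] := rhoM x; rewrite r0 (le_trans rM)// lerDl.
have close x : `|f x - rho x| <= d.
  have /andP[r0 rM] := rhoM x; have /andP[a0 al] := aM x.
  have -> : f x - rho x = ep * (a x - t * rho x).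
    exact: mix_sub.
  rewrite normrM gtr0_norm//; apply: le_trans epd; rewrite ler_wpM2l ?(ltW ep0)//.
  have tr : t * rho x <= t * M by rewrite ler_wpM2l.
  have tr0 : 0 <= t * rho x by rewrite mulr_ge0.
  exact: dist_le_sum.
have phid x : `|phi (f x) - phi (rho x)| <= e by exact: dP.
have La := bdensity_nnL1 ga; have Lr := bdensity_nnL1 grho.
have up x : phi (f x) <= phi (rho x) + e.
  by rewrite -lerBlDl; apply: le_trans (phid x); exact: ler_norm.
have dn x : phi (rho x) <= phi (f x) + e.
  by rewrite -lerBlDl; apply: le_trans (phid x); rewrite distrC; exact: ler_norm.
have H1 := phi_shift gf grho La (ltW e0) up.
have H2 := phi_shift grho gf Lr (ltW e0) dn.
have H3 : T f + ep * t * int3 (fun x => rho x * phi (f x)) <=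
    T rho + ep * int3 (fun x => a x * phi (f x)).
  have ept0 : 0 <= ep * t by rewrite mulr_ge0// ltW.
  have A1 := nnL1Z ept0 (nnL1_phi gf Lr); have A2 := nnL1Z (ltW ep0) (nnL1_phi gf La).
  rewrite -(int3Z ept0 (nnL1_phi gf Lr)) -(int3Z (ltW ep0) (nnL1_phi gf La)).
  rewrite -(int3D (nnL1_J gf) A1) -(int3D (nnL1_J grho) A2).
  apply: int3_le; [exact: (nnL1D (nnL1_J gf) A1)|exact: (nnL1D (nnL1_J grho) A2)|] => x.
  have := law_sub HJ (bdensity_ge0 gf x) (bdensity_ge0 grho x).
  have -> : rho x - f x = ep * (t * rho x - a x).
    by rewrite -opprB mix_sub -mulrN opprB.
  exact: mix_le.
exact: (el_algebra kappa0 t0 e0 ep0 epe tN C0 W0 Q0 H1 H2 H3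
  (coulomb_form_comb u0 (ltW ep0) grho ga) (minimal gf If)).
Qed.

(** Multiplying the Euler-Lagrange equation kappa V = phi(rho) + mu by rho and
integrating gives this value. *)
Definition multiplier : R := (kappa * C - P) / N.

Lemma el_multiplier (a : R3 R -> R) : bdensity a ->
  kappa * coulomb_form a rho <= int3 (fun x => a x * phi (rho x)) + multiplier * int3 a.
Proof.
move=> ga; have := el_integral ga.
have -> : multiplier * int3 a = - (int3 a / N * P) + kappa * (int3 a / N) * C.
  rewrite /multiplier; move: (int3 a) C P => i c p; field; by rewrite gt_eqF.
by rewrite addrA subr_ge0.
Qed.

Hypothesis rho_cont : continuous rho.

Lemma phi_continuous : continuous (fun x => phi (rho x)).
Proof.
have [M M0 rhoM] := bdensity_Ub grho.
move=> x; apply/cvgrPdist_le => e e0.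
have [d d0 dP] := law_unif HJ M e0.
have : \forall y \near x, `|rho x - rho y| < d.
  by move: (@rho_cont x) => /cvgrPdist_lt /(_ _ d0).
by apply: filterS => y /ltW; exact: dP.
Qed.

Let h y := kappa * pot rho y - phi (rho y).

Let h_cont : continuous h.
Proof.
move=> x; apply: cvgB; last exact: phi_continuous.
by apply: cvgM; [exact: cvg_cst|exact: pot_continuous].
Qed.

(* The multiplier is split into its positive and negative parts, because only
   nonnegative functions are integrated and its sign is not yet known. *)
Let mp := Num.max multiplier 0.
Let mn := Num.max (- multiplier) 0.
Let mp0 : 0 <= mp. Proof. by rewrite le_max lexx orbT. Qed.
Let mn0 : 0 <= mn. Proof. by rewrite le_max lexx orbT. Qed.
Let mpn : multiplier = mp - mn.
Proof. by rewrite /mp /mn; case: (ltP multiplier 0); case: (ltP (- multiplier) 0); lra. Qed.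

(** If the inequality failed at x, it would fail by a fixed amount on a box around
x, and a test density on this box would contradict [el_multiplier]. *)
Lemma euler_lagrange_le x : kappa * pot rho x <= phi (rho x) + multiplier.
Proof.
rewrite -lerBlDl -/(h x) leNgt; apply/negP => hx.
pose eta := (h x - multiplier) / 2.
have eta0 : 0 < eta by rewrite divr_gt0// subr_gt0.
have near_h : \forall y \near x, multiplier + eta < h y.
  apply: (cvgr_gt _ (@h_cont x)).
  by rewrite /eta; move: (h x) multiplier hx => ? ? ?; lra.
have [B [mB BP gB IB]] := nbhs_box near_h.
have LB := bdensity_nnL1 gB.
have me0 : 0 <= mp + eta by rewrite addr_ge0// ltW.
have A1 := nnL1_phi grho LB; have A2 := nnL1Z me0 LB.
have A3 := nnL1Z (ltW kappa0) (nnL1_coulomb_form gB grho); have A4 := nnL1Z mn0 LB.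
have := int3_le (nnL1D A1 A2) (nnL1D A3 A4).
rewrite (int3D A1 A2) (int3D A3 A4) (int3Z me0 LB)
  (int3Z (ltW kappa0) (nnL1_coulomb_form gB grho)) (int3Z mn0 LB).
move=> H; have := el_multiplier gB; rewrite mpn leNgt => /negP; apply.
apply: (@lt_le_trans _ _ (int3 (fun y => \1_B y * phi (rho y)) +
  (mp + eta) * int3 (\1_B : R3 R -> R) - mn * int3 (\1_B : R3 R -> R))).
  rewrite -addrA ltrD2l -mulrBl ltr_pM2r//.
  by rewrite ltrD2r ltrDl.
rewrite lerBlDr; apply: H => y.
rewrite indicE; have [yB|_] := boolP (y \in B); last by rewrite !mul0r !mulr0.
rewrite !mul1r !mulr1; move: yB; rewrite inE => /BP; rewrite mpn /h.
by move: (pot rho y) (phi (rho y)) => ? ?; lra.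
Qed.

(** The nonnegative function rho (phi(rho) + mu - kappa V) has integral 0 by the
choice of mu, and it is continuous, so it vanishes everywhere. *)
Lemma euler_lagrange_ge x : 0 < rho x -> phi (rho x) + multiplier <= kappa * pot rho x.
Proof.
move=> rx; rewrite leNgt; apply/negP => wx.
pose w y := phi (rho y) + multiplier - kappa * pot rho y.
have w0 y : 0 <= w y by rewrite subr_ge0 euler_lagrange_le.
have wE y : w y = multiplier - h y by rewrite /w /h opprB addrA [multiplier + _]addrC.
have Lr := bdensity_nnL1 grho.
have A1 := nnL1_phi grho Lr; have A2 := nnL1Z mp0 Lr.
have A3 := nnL1Z (ltW kappa0) (nnL1_coulomb_form grho grho); have A4 := nnL1Z mn0 Lr.
have mw : measurable_fun [set: M3] w.
  apply: measurable_funB.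
    apply: measurable_funD; last exact: measurable_cst.
    by apply: measurable_mono_comp (bdensity_meas grho) (bdensity_ge0 grho); exact: (law_mono HJ).
  by apply: measurable_funM; [exact: measurable_cst|exact: measurable_pot].
have pw y : rho y * w y + (kappa * (rho y * pot rho y) + mn * rho y) =
    rho y * phi (rho y) + mp * rho y.
  by rewrite /w mpn; move: (rho y) (pot rho y) (phi _) => ? ? ?; ring.
have Lw : nnL1 (fun y => rho y * w y).
  apply: (nnL1_le (nnL1D A1 A2)).
  - by apply: measurable_funM => //; exact: bdensity_meas.
  - by move=> y; rewrite mulr_ge0// (bdensity_ge0 grho).
  - move=> y; rewrite -pw lerDl addr_ge0// mulr_ge0 ?(ltW kappa0)//.
      by rewrite mulr_ge0// ?pot_ge0// => *; exact: (bdensity_ge0 grho).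
    exact: (bdensity_ge0 grho).
have Iw : int3 (fun y => rho y * w y) = 0.
  have := eq_int3 pw.
  rewrite (int3D Lw (nnL1D A3 A4)) (int3D A3 A4) (int3D A1 A2).
  rewrite (int3Z mp0 Lr) (int3Z (ltW kappa0) (nnL1_coulomb_form grho grho)) (int3Z mn0 Lr).
  rewrite -/(coulomb_form rho rho) -/C -/P -/N.
  have MN : (mp - mn) * N = kappa * C - P by rewrite -mpn /multiplier divfK// gt_eqF.
  move: (int3 (fun y => rho y * w y)) MN => z MN; lra.
pose eta := rho x * w x / 2.
have wx0 : 0 < w x by rewrite subr_gt0.
have eta0 : 0 < eta by rewrite divr_gt0// mulr_gt0.
have near_w : \forall y \near x, eta < rho y * w y.
  have cw : rho y * w y @[y --> x] --> rho x * w x.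
    apply: cvgM; first exact: rho_cont.
    rewrite wE (_ : w = fun y => multiplier - h y); last by apply/funext => y; exact: wE.
    by apply: cvgB; [exact: cvg_cst|exact: h_cont].
  apply: (cvgr_gt _ cw); rewrite /eta ltr_pdivrMr// mulr_natr mulr2n.
  by rewrite ltrDl mulr_gt0.
have [B [mB BP gB IB]] := nbhs_box near_w.
have LB := bdensity_nnL1 gB.
have := int3_le (nnL1Z (ltW eta0) LB) Lw.
rewrite (int3Z (ltW eta0) LB) Iw => H.
have : eta * int3 (\1_B : R3 R -> R) <= 0.
  apply: H => y; rewrite indicE; have [yB|_] := boolP (y \in B).
    by rewrite mulr1; move: yB; rewrite inE => /BP/ltW.
  by rewrite mulr0 mulr_ge0// (bdensity_ge0 grho).
by rewrite leNgt mulr_gt0.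
Qed.

(** The trial density lam^3 rho(lam x) has mass N; its Coulomb energy is multiplied
by lam. *)
Lemma dilate_energy (lam : R) : 0 < lam ->
  T rho - kappa * (2^-1 * C) <=
  (lam ^+ 3)^-1 * int3 (fun x => J (lam ^+ 3 * rho x)) - lam * (kappa * (2^-1 * C)).
Proof.
move=> l0; have l3 : 0 < lam ^+ 3 by rewrite exprn_gt0.
pose f x := lam ^+ 3 * rho (dilation lam x).
have gd := bdensity_dil l0 grho.
have gf : bdensity f by apply: bdensityZ gd; exact: ltW.
have gl : bdensity (fun x => lam ^+ 3 * rho x) by apply: bdensityZ grho; exact: ltW.
have If : int3 f = N.
  rewrite (int3Z (ltW l3) (bdensity_nnL1 gd)) (int3_dil l0 (bdensity_nnL1 grho)).
  by rewrite mulrA mulfV ?mul1r// gt_eqF.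
have := minimal gf If.
have -> : T f = (lam ^+ 3)^-1 * int3 (fun x => J (lam ^+ 3 * rho x)).
  exact: (int3_dil l0 (nnL1_J gl)).
have -> : coulomb_form f f = lam * C.
  rewrite (coulomb_formZr (ltW l3) gf gd) (coulomb_formC gf gd) (coulomb_formZr (ltW l3) gd gd).
  rewrite (coulomb_form_dil l0 grho) -/C; move: C => z; field; by rewrite gt_eqF.
by rewrite (mulrCA _ lam) (mulrCA _ lam).
Qed.

Lemma dilate_kinetic (l : R) : 0 < l ->
  int3 (fun x => J (l * rho x)) <=
  T rho + (l - 1) * int3 (fun x => rho x * phi (l * rho x)).
Proof.
move=> l0; have gl : bdensity (fun x => l * rho x) by apply: bdensityZ grho; exact: ltW.
have Lr := bdensity_nnL1 grho; have A := nnL1_phi gl Lr.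
have sub x : J (l * rho x) + phi (l * rho x) * (rho x - l * rho x) <= J (rho x).
  exact: (law_sub HJ (bdensity_ge0 gl x) (bdensity_ge0 grho x)).
have [l1|l1] := leP 1 l.
  have l10 : 0 <= l - 1 by rewrite subr_ge0.
  rewrite -(int3Z l10 A) -(int3D (nnL1_J grho) (nnL1Z l10 A)).
  apply: int3_le; [exact: nnL1_J|exact: (nnL1D (nnL1_J grho) (nnL1Z l10 A))|] => x.
  have := sub x; move: (J (l * rho x)) (phi (l * rho x)) (J (rho x)) (rho x) => ? ? ? ?; lra.
have l10 : 0 <= 1 - l by rewrite subr_ge0 ltW.
rewrite -opprB mulNr lerBrDr -(int3Z l10 A) -(int3D (nnL1_J gl) (nnL1Z l10 A)).
apply: int3_le; [exact: (nnL1D (nnL1_J gl) (nnL1Z l10 A))|exact: nnL1_J|] => x.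
have := sub x; move: (J (l * rho x)) (phi (l * rho x)) (J (rho x)) (rho x) => ? ? ? ?; lra.
Qed.

Lemma dilate_phi (e : R) : 0 < e -> exists2 d, 0 < d & forall l, 0 < l -> l <= 8 -> `|l - 1| <= d ->
  int3 (fun x => rho x * phi (l * rho x)) <= P + e * N /\
  P <= int3 (fun x => rho x * phi (l * rho x)) + e * N.
Proof.
move=> e0; have [M M0 rhoM] := bdensity_Ub grho.
(* The densities compared are rho and l rho with l at most 8. *)
have [d d0 dP] := law_unif HJ (8 * M) e0.
have M1 : 0 < M + 1 by rewrite ltr_wpDl.
exists (d / (M + 1)); first exact: divr_gt0.
move=> l l0 l8 ld; have gl : bdensity (fun x => l * rho x) by apply: bdensityZ grho; exact: ltW.
have close x : `|phi (l * rho x) - phi (rho x)| <= e.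
  have /andP[r0 rM] := rhoM x; apply: dP.
  - by rewrite mulr_ge0 ?(ltW l0)//= ler_pM// ltW.
  - by rewrite r0 (le_trans rM)// ler_peMl//; lra.
  - have -> : l * rho x - rho x = (l - 1) * rho x by rewrite mulrBl mul1r.
    rewrite normrM (ger0_norm r0); move: ld; rewrite ler_pdivlMr//; apply: le_trans.
    by rewrite ler_wpM2l// (le_trans rM)// lerDl.
have Lr := bdensity_nnL1 grho; split.
  apply: (phi_shift gl grho Lr (ltW e0)) => x.
  by rewrite -lerBlDl; apply: le_trans (close x); exact: ler_norm.
apply: (phi_shift grho gl Lr (ltW e0)) => x.
by rewrite -lerBlDl; apply: le_trans (close x); rewrite distrC; exact: ler_norm.
Qed.

(** The energy of the dilated densities is minimal at dilation factor 1, and its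
derivative there is 3 (P - T) minus the Coulomb energy. *)
Lemma virial : 3 * (P - T rho) = kappa * (2^-1 * C).
Proof.
have C0 : 0 <= kappa * (2^-1 * C).
  by rewrite !mulr_ge0 ?(ltW kappa0)// coulomb_form_ge0// => x; exact: (bdensity_ge0 grho).
have Nge0 : 0 <= N := ltW N0.
have step e : 0 < e -> exists hh, [/\ 0 < hh, hh <= 2^-1, hh <= e &
    forall l, (1 - hh) ^+ 3 <= l -> l <= (1 + hh) ^+ 3 ->
     int3 (fun x => rho x * phi (l * rho x)) <= P + e * N /\
     P <= int3 (fun x => rho x * phi (l * rho x)) + e * N].
  move=> e0; have [d d0 dP] := dilate_phi e0.
  (* For 0 < h <= 1 both (1 + h)^3 and (1 - h)^3 differ from 1 by at most 7 h. *)
  exists (Num.min (Num.min 2^-1 e) (d / 7)); set hh := Num.min _ _.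
  have h0 : 0 < hh by rewrite !lt_min e0 invr_gt0 ltr0n/= divr_gt0.
  have h1 : hh <= 2^-1 by rewrite !ge_min lexx.
  have h2 : hh <= e by rewrite !ge_min lexx orbT.
  have h3 : hh * 7 <= d by rewrite -ler_pdivlMr// ge_min lexx orbT.
  split => // l ll lu.
  by have [] := cube_close h0 h1 h3 ll lu; exact: dP.
apply/eqP; rewrite eq_le -subr_ge0 -[_ && _]andbC -subr_ge0; apply/andP; split.
- apply: (@ge0_limit _ _ (4 * `|P - T rho| + 7 * N) 1) => // e e0 _.
  have [hh [h0 h1 h2 hP]] := step e e0.
  have [_ hp mono] := cube_mono h0 h1.
  have h1' : hh <= 1 by apply: le_trans h1 _; rewrite invf_le1 ?ler1n.
  have [Y1 _] := hP ((1 + hh) ^+ 3) mono (lexx _).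
  exact: (virial_up h0 h1' h2 erefl Nge0 C0 (dilate_kinetic (exprn_gt0 3 hp)) Y1 (dilate_energy hp)).
- apply: (@ge0_limit _ _ (4 * `|P - T rho| + 7 * N) 1) => // e e0 _.
  have [hh [h0 h1 h2 hP]] := step e e0.
  have [hp _ mono] := cube_mono h0 h1.
  have [_ Y1] := hP ((1 - hh) ^+ 3) (lexx _) mono.
  exact: (virial_down h0 h1 h2 erefl Nge0 C0 (dilate_kinetic (exprn_gt0 3 hp)) Y1 (dilate_energy hp)).
Qed.

End variational.

(** * Minimizers with a symmetric decreasing profile *)

Section admissibility.
Context {R : realType}.
Local Notation mR := (measurableTypeR R).
Local Notation M3 := (mR * mR * mR)%type.
Implicit Types f : R3 R -> R.

Lemma powR_le_lin (p M s : R) : 1 < p -> 0 <= s -> s <= M -> s `^ p <= M `^ (p - 1) * s.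
Proof.
move=> p1; rewrite le_eqVlt => /predU1P[<- _|s0 sM].
  by rewrite powR0 ?mulr0// gt_eqF// (lt_trans ltr01).
rewrite -mulr_powRB1 ?(ltW s0)//; last exact: lt_trans p1.
rewrite [leRHS]mulrC ler_wpM2l ?(ltW s0)// ge0_ler_powR ?nnegrE ?(ltW s0) ?subr_ge0 ?(ltW p1)//.
by rewrite (le_trans (ltW s0)).
Qed.

(** So all trial densities built from bounded ones compete in both minimization
problems, with exponents 4/3 and 5/3. *)
Lemma bdensity_admissible (p N : R) f : 1 < p -> bdensity f -> int3 f = N -> admissible p N f.
Proof.
move=> p1 gf fN; have [Lf _] := gf; have [mf f0 _] := Lf.
have [M M0 fM] := bdensity_Ub gf.
split; last by rewrite int3E// fN.
split => //.
- rewrite /finite_norm Lnorm1.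
  rewrite (_ : (\int[leb3]_x _)%E = (int3 f)%:E) ?ltry// -(int3E Lf).
  by apply: eq_integral => x _; rewrite /= ger0_norm.
- have Lp : nnL1 (fun x => f x `^ p).
    apply: (nnL1_le (nnL1Z (powR_ge0 M (p - 1)) Lf)).
    - exact: (measurableT_comp (@measurable_powR R p) mf).
    - by move=> x; exact: powR_ge0.
    - by move=> x; have /andP[? ?] := fM x; exact: powR_le_lin.
  rewrite /finite_norm unlock /=.
  rewrite (_ : (\int[leb3]_x _)%E = (int3 (fun x => f x `^ p))%:E).
    by rewrite poweR_EFin ltry.
  rewrite -(int3E Lp); apply: eq_integral => x _.
  by rewrite /= ger0_norm.
Qed.

(** A symmetric decreasing density is bounded by its value at the origin. *)
Lemma admissible_bdensity (p N r : R) f : admissible p N f -> regular_profile f r ->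
  bdensity f /\ int3 f = N.
Proof.
move=> [[mf f0 _ _] fN] [[_ sd] _ _]; split; last by rewrite /int3 fN.
split; first by split => //; rewrite fN ltry.
exists (f 0) => x; apply: sd.
by rewrite {1}/enorm /= expr0n /= !addr0 sqrtr0 enorm_ge0.
Qed.

Lemma energy_bdensity (J phi : R -> R) (kappa : R) f : kinetic_law J phi -> bdensity f ->
  (\int[leb3]_x (J (f x))%:E - kappa%:E * coulomb f)%E =
  (int3 (fun x => J (f x)) - kappa * (2^-1 * coulomb_form f f))%:E.
Proof.
move=> HJ gf; rewrite coulombE// (int3E (nnL1_J HJ gf)).
by rewrite -EFinM -EFinB.
Qed.

(** Minimality among admissible densities, restricted to bounded ones where the
energy is a real number. *)
Lemma minimizer_real (J phi : R -> R) (kappa p N r : R) (rho : R3 R -> R) :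
  kinetic_law J phi -> 1 < p -> admissible p N rho -> regular_profile rho r ->
  (\int[leb3]_x (J (rho x))%:E - kappa%:E * coulomb rho)%E =
   ereal_inf ((fun f => \int[leb3]_x (J (f x))%:E - kappa%:E * coulomb f)%E @` admissible p N) ->
  forall f, bdensity f -> int3 f = int3 rho ->
    int3 (fun x => J (rho x)) - kappa * (2^-1 * coulomb_form rho rho) <=
    int3 (fun x => J (f x)) - kappa * (2^-1 * coulomb_form f f).
Proof.
move=> HJ p1 adm reg Emin f gf If; have [gr Ir] := admissible_bdensity adm reg.
have H : (\int[leb3]_x (J (rho x))%:E - kappa%:E * coulomb rho <=
          \int[leb3]_x (J (f x))%:E - kappa%:E * coulomb f)%E.
  rewrite Emin; apply: ereal_inf_lbound; exists f => //.
  by apply: bdensity_admissible => //; rewrite If.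
by move: H; rewrite (energy_bdensity kappa HJ gr) (energy_bdensity kappa HJ gf) lee_fin.
Qed.

End admissibility.

Section profile.
Context {R : realType}.
Local Notation mR := (measurableTypeR R).
Local Notation M3 := (mR * mR * mR)%type.
Variables (J phi : R -> R) (kappa r : R) (rho : R3 R -> R).
Hypotheses (HJ : kinetic_law J phi) (phi0 : phi 0 = 0) (kappa0 : 0 < kappa)
  (grho : bdensity rho) (N0 : 0 < int3 rho) (reg : regular_profile rho r)
  (minimal : forall f, bdensity f -> int3 f = int3 rho ->
    int3 (fun x => J (rho x)) - kappa * (2^-1 * coulomb_form rho rho) <=
    int3 (fun x => J (f x)) - kappa * (2^-1 * coulomb_form f f)).

Let N := int3 rho.
Let rho0 : forall x, 0 <= rho x := bdensity_ge0 grho.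
Let sd : symmetric_decreasing rho. Proof. by case: reg. Qed.
Let rho_cont : continuous rho. Proof. by case: reg. Qed.
Let supp : support_radius rho r. Proof. by case: reg. Qed.

Lemma enorm_axis0 : enorm (axis 0 : R3 R) = 0.
Proof. by rewrite enorm_axis normr0. Qed.

Lemma rho_le_axis0 x : rho x <= rho (axis 0).
Proof. by apply: sd.2; rewrite enorm_axis0 enorm_ge0. Qed.

Lemma rho_axis0_gt0 : 0 < rho (axis 0).
Proof.
rewrite lt_neqAle rho0 andbT; apply/eqP => e.
move: N0; rewrite (_ : int3 rho = 0) ?ltxx//.
rewrite /int3 integral0_eq// => x _; congr EFin; apply/eqP.
by rewrite eq_le rho0 andbT e rho_le_axis0.
Qed.

Lemma enorm_le_radius x : rho x != 0 -> enorm x <= r.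
Proof.
move=> rx; have : [set y | enorm y <= r] x by rewrite -supp; apply: subset_closure.
by [].
Qed.

Lemma radius_ge0 : 0 <= r.
Proof.
apply: le_trans (enorm_le_radius (x := axis 0) _); first by rewrite enorm_ge0.
by rewrite gt_eqF// rho_axis0_gt0.
Qed.

(** Otherwise, by continuity, the density would be positive slightly beyond the
support. *)
Lemma rho_axis_radius : rho (axis r) = 0.
Proof.
apply/eqP/negPn/negP => h; have hp : 0 < rho (axis r) by rewrite lt_neqAle eq_sym h rho0.
have : \forall s \near r, 0 < rho (axis s).
  have H : rho (axis s) @[s --> r] --> rho (axis r).
    by apply: continuous_comp; [exact: continuous_axis|exact: rho_cont].
  exact: (cvgr_gt _ H).
move=> /nbhs_ballP[e /= e0 He].
have r0 := radius_ge0.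
have e20 : 0 < e / 2 by rewrite divr_gt0.
have : 0 < rho (axis (r + e / 2)).
  apply: He; rewrite /ball /= opprD addNKr normrN gtr0_norm//.
  by rewrite ltr_pdivrMr// ltr_pMr// ltr1n.
move=> /lt0r_neq0/enorm_le_radius; rewrite enorm_axis ger0_norm ?addr_ge0 ?(ltW e20)//.
by rewrite gerDl leNgt e20.
Qed.

Lemma radius_gt0 : 0 < r.
Proof.
rewrite lt_neqAle radius_ge0 andbT; apply/eqP => e.
by have := rho_axis_radius; rewrite -e => h; have := rho_axis0_gt0; rewrite h ltxx.
Qed.

Lemma rho_out y : r < enorm y -> rho y = 0.
Proof.
move=> ry; apply/eqP/negPn/negP => /enorm_le_radius.
by rewrite leNgt ry.
Qed.

Lemma newton_pot_le (a : R) : 0 < a -> pot rho (axis a) <= a^-1 * N.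
Proof.
move=> a0; have ai : 0 <= a^-1 by rewrite invr_ge0 ltW.
rewrite -lee_fin -potE//.
have := newton_le sd rho_cont rho0 (bdensity_meas grho) radius_ge0 rho_out a0.
under eq_integral do rewrite mulrC.
by rewrite (integralZ3 ai (bdensity_meas grho) rho0) (int3E (bdensity_nnL1 grho)) -EFinM.
Qed.

Lemma newton_pot_eq (a : R) : r <= a -> pot rho (axis a) = a^-1 * N.
Proof.
move=> ra; have a0 : 0 < a := lt_le_trans radius_gt0 ra.
have ai : 0 <= a^-1 by rewrite invr_ge0 ltW.
apply: EFin_inj; rewrite -potE//.
rewrite (newton_eq sd rho_cont rho0 (bdensity_meas grho) radius_ge0 rho_out a0 ra).
under eq_integral do rewrite mulrC.
by rewrite (integralZ3 ai (bdensity_meas grho) rho0) (int3E (bdensity_nnL1 grho)) -EFinM.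
Qed.

Let mult := multiplier phi kappa rho.

(** At distance r the density vanishes and V = N / r.  The Euler-Lagrange
inequality there bounds the multiplier from below.  For the other direction,
the edge is a limit of points with positive density, where mu <= kappa V. *)
Lemma multiplier_newton : mult = kappa * (r^-1 * N).
Proof.
apply/eqP; rewrite eq_le; apply/andP; split; last first.
  have := euler_lagrange_le HJ kappa0 grho N0 minimal rho_cont (axis r).
  by rewrite rho_axis_radius phi0 add0r newton_pot_eq.
rewrite -newton_pot_eq// leNgt; apply/negP => H.
have near_r : \forall y \near axis r, kappa * pot rho y < mult.
  have cw : kappa * pot rho y @[y --> axis r] --> kappa * pot rho (axis r).
    by apply: cvgM; [exact: cvg_cst|exact: pot_continuous].
  exact: (cvgr_lt _ cw).
have : closure [set x | rho x != 0] (axis r).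
  by rewrite supp /= enorm_axis ger0_norm// radius_ge0.
move=> /(_ _ near_r)[y [/= ry]]; apply/negP; rewrite -leNgt.
have ryp : 0 < rho y by rewrite lt_neqAle eq_sym ry rho0.
apply: le_trans (euler_lagrange_ge HJ kappa0 grho N0 minimal rho_cont ryp).
by rewrite lerDr (law_ge0 HJ).
Qed.

(** Euler-Lagrange equality at a point where the density is positive, with V at
most N / a and mu = kappa N / r. *)
Lemma phi_axis_le (a : R) : 0 < a -> 0 < rho (axis a) ->
  phi (rho (axis a)) <= kappa * N * (a^-1 - r^-1).
Proof.
move=> a0 ra.
have := euler_lagrange_ge HJ kappa0 grho N0 minimal rho_cont ra.
rewrite -/mult multiplier_newton => H.
have H2 := ler_wpM2l (ltW kappa0) (newton_pot_le a0).
rewrite mulrBr lerBrDr -!mulrA (mulrC N) (mulrC N).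
by apply: le_trans H2.
Qed.

(** At the origin the Euler-Lagrange equality bounds phi(rho(0)) by the potential,
which is estimated with the cut-off radius b, to be chosen later in terms of
rho(0) itself. *)
Lemma phi_top_le (b : R) : 0 < b ->
  phi (rho (axis 0)) <= kappa * (rho (axis 0) * (disk_area * (4 * b ^+ 2)) + b^-1 * N).
Proof.
move=> b0.
have := euler_lagrange_ge HJ kappa0 grho N0 minimal rho_cont rho_axis0_gt0.
rewrite -/mult multiplier_newton => H.
have H2 := ler_wpM2l (ltW kappa0) (pot_le (axis 0) grho rho_le_axis0 b0).
apply: le_trans H2; apply: le_trans H.
by rewrite lerDl !mulr_ge0 ?(ltW kappa0) ?invr_ge0 ?radius_ge0 ?(ltW N0).
Qed.

Lemma multiplier_mass :
  kappa * N * r^-1 * N = kappa * coulomb_form rho rho - int3 (fun x => rho x * phi (rho x)).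
Proof.
have := multiplier_newton; rewrite /mult /multiplier => E.
have NN : int3 rho != 0 by rewrite gt_eqF.
rewrite -[RHS](divfK NN) E.
by rewrite /N; move: (int3 rho) => n; ring.
Qed.

End profile.

(** * Comparison of the two multipliers *)

Section final_algebra.
Context {R : realType}.

(** With cut-off radius 1/eta the potential at the origin is at most of order eta,
whereas phi is at least of order min(eta^2, c eta).  For large c this bounds
eta. *)
Lemma top_momentum_le (eta g kf kappa w A N m c B : R) :
  0 < eta -> 0 < kf -> 0 < m -> 0 < c ->
  eta ^+ 2 <= g * (2 * m + eta / c) ->
  kf * g <= kappa * (w * eta ^+ 3 * (A * (4 * eta^-1 ^+ 2)) + eta * N) ->
  B = kappa * (4 * A * w + N) / kf -> 0 < B -> 2 * B <= c -> eta <= 4 * m * B.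
Proof.
move=> e0 k0 m0 c0 H1 H2 BE B0 Bc.
have eN : eta != 0 by rewrite gt_eqF.
have H3 : g <= B * eta.
  rewrite -(ler_pM2l k0); apply: le_trans H2 _.
  rewrite le_eqVlt; apply/orP; left; apply/eqP.
  by rewrite BE; field; rewrite eN gt_eqF.
have ec : eta / c <= eta / (2 * B).
  by rewrite ler_pM2l// lef_pV2// posrE// mulr_gt0.
have d0 : 0 <= 2 * m + eta / c by rewrite addr_ge0 ?divr_ge0 ?mulr_ge0 ?ltW.
have H4 : eta ^+ 2 <= B * eta * (2 * m + eta / (2 * B)).
  apply: le_trans H1 _; apply: (@le_trans _ _ (B * eta * (2 * m + eta / c))).
    by rewrite ler_wpM2r.
  by rewrite ler_wpM2l ?mulr_ge0 ?(ltW B0) ?(ltW e0)// lerD2l.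
have E : B * eta * (2 * m + eta / (2 * B)) = eta * (2 * m * B + eta / 2).
  by field; rewrite gt_eqF.
rewrite E expr2 ler_pM2l// in H4; lra.
Qed.

(** T, P and C are the kinetic energy, the integral of rho phi(rho) and the Coulomb
form, with suffix c or i for the two minimizers; Tt is the nonrelativistic
kinetic energy of rho_c.  The virial identities turn the multipliers into
combinations of T and P, and the hypotheses on Tt and Tc are the comparison of
the two kinetic laws. *)
Lemma multiplier_compare (mc mi Tc Pc Cc Ti Pi Ci Tt N d kappa : R) :
  mc = kappa * Cc - Pc -> mi = kappa * Ci - Pi ->
  3 * (Pc - Tc) = kappa * (2^-1 * Cc) -> 3 * (Pi - Ti) = kappa * (2^-1 * Ci) ->
  Ti = 3 / 5 * Pi ->
  Ti - kappa * (2^-1 * Ci) <= Tt - kappa * (2^-1 * Cc) ->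
  Tt <= Tc + d * N -> 5 / 3 * Tc <= Pc + d * N ->
  mc - mi <= 13 / 3 * (d * N).
Proof. move=> -> -> H1 H2 H3 H4 H5 H6; lra. Qed.

(** An energy of order c^-2 at a momentum bounded by H forces a momentum of order
1/c. *)
Lemma momentum_le (eta K c kf m g D H : R) : 0 < c -> 1 <= c -> 0 < kf -> 0 < m ->
  0 <= eta -> eta <= H -> 0 <= D ->
  eta ^+ 2 <= g * (2 * m + eta / c) -> kf * g <= D / c ^+ 2 -> 0 <= K ->
  K ^+ 2 = D * (2 * m + H) / kf -> eta <= K / c.
Proof.
move=> c0 c1 k0 m0 e0 eH D0 H1 H2 K0 KE.
have c20 : 0 < c ^+ 2 by rewrite exprn_gt0.
have H0 := le_trans e0 eH.
rewrite -(@ler_pXn2r _ 2) ?nnegrE ?divr_ge0 ?(ltW c0)//.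
rewrite expr_div_n KE; apply: le_trans H1 _.
have ecH : eta / c <= H.
  by apply: le_trans eH; rewrite ler_pdivrMr// ler_peMr.
have d0 : 0 <= 2 * m + eta / c by rewrite addr_ge0 ?divr_ge0 ?mulr_ge0 ?(ltW m0) ?(ltW c0).
have gD : g <= D / c ^+ 2 / kf by rewrite ler_pdivlMr// mulrC.
apply: (@le_trans _ _ (D / c ^+ 2 / kf * (2 * m + eta / c))); first by rewrite ler_wpM2r.
apply: (@le_trans _ _ (D / c ^+ 2 / kf * (2 * m + H))).
  by rewrite ler_wpM2l ?lerD2l// !divr_ge0 ?(ltW k0) ?(ltW c20).
rewrite le_eqVlt; apply/orP; left; apply/eqP; field.
by rewrite !gt_eqF.
Qed.

End final_algebra.

Section comparison.
Context {R : realType}.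
Variables (kappa q m N Ri : R) (rho_inf : R3 R -> R).
Hypotheses (kappa0 : 0 < kappa) (q0 : 0 < q) (m0 : 0 < m) (N0 : 0 < N)
  (min_inf : minimizer_inf kappa q m N rho_inf)
  (reg_inf : regular_profile rho_inf Ri).

Local Notation eta := (fermi_momentum q).
Local Notation kf := (kfac q).

Let phi_inf := fermi_level q (quad_disp (2 * m)).
Let Linf : kinetic_law (jinf q m) phi_inf := law_inf q0 m0.

Lemma density_of_momentum s : 0 <= s -> s = q / (6 * pi ^+ 2) * eta s ^+ 3.
Proof.
move=> s0; rewrite eta_cube//.
have p0 : 6 * pi ^+ 2 != 0 :> R by rewrite gt_eqF// mulr_gt0// exprn_gt0// pi_gt0.
move: (6 * pi ^+ 2) p0 => p p0; field; rewrite p0.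
by rewrite (gt_eqF q0).
Qed.

Lemma eta_zero : eta 0 = 0.
Proof. by rewrite /fermi_momentum mulr0 mul0r powR0// invr_eq0. Qed.

Lemma phi_inf0 : phi_inf 0 = 0.
Proof. by rewrite /phi_inf /fermi_level eta_zero /quad_disp expr0n /= mul0r mulr0. Qed.

Lemma phi_c0 c : fermi_level q (rel_disp m c) 0 = 0.
Proof.
rewrite /fermi_level eta_zero /rel_disp expr0n /= mulr0 add0r.
have -> : m ^+ 2 * c ^+ 4 = (m * c ^+ 2) ^+ 2 by ring.
rewrite sqrtr_sqr ger0_norm ?subrr ?mulr0//.
by rewrite mulr_ge0 ?sqr_ge0// ltW.
Qed.

Let ginf : bdensity rho_inf.
Proof. by case: min_inf => /admissible_bdensity /(_ reg_inf)[]. Qed.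

Let Iinf : int3 rho_inf = N.
Proof. by case: min_inf => /admissible_bdensity /(_ reg_inf)[]. Qed.

Let Ninf0 : 0 < int3 rho_inf. Proof. by rewrite Iinf. Qed.

Let pos53 : 0 < 5 / 3 :> R. Proof. lra. Qed.
Let pos133 : 0 <= 13 / 3 :> R. Proof. lra. Qed.
Let lt53 : 1 < 5 / 3 :> R. Proof. lra. Qed.
Let lt43 : 1 < 4 / 3 :> R. Proof. lra. Qed.

Let minr_inf : forall f, bdensity f -> int3 f = int3 rho_inf ->
    int3 (fun x => jinf q m (rho_inf x)) - kappa * (2^-1 * coulomb_form rho_inf rho_inf) <=
    int3 (fun x => jinf q m (f x)) - kappa * (2^-1 * coulomb_form f f).
Proof.
case: min_inf => adm E; exact: (minimizer_real Linf lt53 adm reg_inf E).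
Qed.

Lemma inf_kinetic (f : R3 R -> R) : bdensity f ->
  int3 (fun x => jinf q m (f x)) = 3 / 5 * int3 (fun x => f x * phi_inf (f x)).
Proof.
move=> gf; rewrite -(int3Z _ (nnL1_phi Linf gf (bdensity_nnL1 gf))); last by lra.
by apply: eq_int3 => x; apply: jinf_quad => //; exact: (bdensity_ge0 gf).
Qed.

Section fixed_c.
Variables (c Rc : R) (rho : R3 R -> R).
Hypotheses (c0 : 0 < c) (min_c : minimizer_c kappa q m c N rho)
  (reg_c : regular_profile rho Rc).

Let phi_c := fermi_level q (rel_disp m c).
Let Lc : kinetic_law (jmc q m c) phi_c := law_c q0 m0 c0.

Lemma bdensity_c : bdensity rho.
Proof. by case: min_c => /admissible_bdensity /(_ reg_c)[]. Qed.

Lemma mass_c : int3 rho = N.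
Proof. by case: min_c => /admissible_bdensity /(_ reg_c)[]. Qed.

Lemma mass_c_gt0 : 0 < int3 rho. Proof. by rewrite mass_c. Qed.

Lemma minr_c : forall f, bdensity f -> int3 f = int3 rho ->
    int3 (fun x => jmc q m c (rho x)) - kappa * (2^-1 * coulomb_form rho rho) <=
    int3 (fun x => jmc q m c (f x)) - kappa * (2^-1 * coulomb_form f f).
Proof.
case: min_c => adm E; exact: (minimizer_real Lc lt43 adm reg_c E).
Qed.

Lemma radius_c_gt0 : 0 < Rc.
Proof. exact: (radius_gt0 bdensity_c mass_c_gt0 reg_c). Qed.

(** Up to the factor 4 m this bounds the Fermi momentum of rho_c at the origin, for
c at least twice this constant. *)
Definition top_const : R :=
  kappa * (4 * disk_area * (q / (6 * pi ^+ 2)) + N) / kf.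

Lemma top_const_gt0 : 0 < top_const.
Proof.
have A0 := @disk_area_gt0 R; have p0 := pi_gt0 R; have k0 := kfac_gt0 q0.
rewrite /top_const divr_gt0// mulr_gt0// addr_gt0// !mulr_gt0//.
by rewrite invr_gt0 mulr_gt0// exprn_gt0.
Qed.

(** A bound on sup rho_c that does not depend on c. *)
Lemma eta_top_le : 2 * top_const <= c -> eta (rho (axis 0)) <= 4 * m * top_const.
Proof.
move=> Bc; have r0 := rho_axis0_gt0 bdensity_c mass_c_gt0 reg_c.
have e0 : 0 < eta (rho (axis 0)).
  rewrite /fermi_momentum powR_gt0// divr_gt0// mulr_gt0// mulr_gt0//.
  by rewrite exprn_gt0// pi_gt0.
(* The cut-off radius in [phi_top_le] is the inverse of the Fermi momentum. *)
have ei0 : 0 < (eta (rho (axis 0)))^-1 by rewrite invr_gt0.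
have := phi_top_le Lc (phi_c0 c) kappa0 bdensity_c mass_c_gt0 reg_c minr_c ei0.
rewrite {2}(density_of_momentum (ltW r0)) invrK mass_c => H.
exact: (top_momentum_le e0 (kfac_gt0 q0) m0 c0
  (rel_disp_lower m0 c0 (ltW e0)) H erefl top_const_gt0 Bc).
Qed.

Definition gap_const : R :=
  13 / 3 * (kf * ((4 * m * top_const) ^+ 4 / (8 * m ^+ 3)) * N).

Lemma gap_const_ge0 : 0 <= gap_const.
Proof.
have k0 := kfac_gt0 q0; have B0 := top_const_gt0.
have h1 : 0 <= 13 / 3 :> R by lra.
have h2 : 0 < 8 * m ^+ 3 by rewrite mulr_gt0// exprn_gt0.
have h3 : 0 < 4 * m * top_const by apply: mulr_gt0 => //; apply: mulr_gt0.
have h4 : 0 <= (4 * m * top_const) ^+ 4 / (8 * m ^+ 3).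
  by rewrite divr_ge0 ?exprn_ge0 ?(ltW h3) ?(ltW h2).
exact: (mulr_ge0 h1 (mulr_ge0 (mulr_ge0 (ltW k0) h4) (ltW N0))).
Qed.

(** The left-hand side is the difference of the two multipliers, by
[multiplier_newton].  Boundedness of rho_c makes the error of the
nonrelativistic approximation O(c^-2). *)
Lemma multiplier_gap : 2 * top_const <= c ->
  kappa * N * (Rc^-1 - Ri^-1) <= gap_const / N / c ^+ 2.
Proof.
move=> Bc; pose d := kf * (eta (rho (axis 0)) ^+ 4 / (8 * m ^+ 3 * c ^+ 2)).
have gc := bdensity_c; have Nc := mass_c_gt0; have k0 := kfac_gt0 q0.
have rS x : rho x <= rho (axis 0) := rho_le_axis0 reg_c x.
have r0 := bdensity_ge0 gc; have Lr := bdensity_nnL1 gc.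
have c20 : 0 < c ^+ 2 by rewrite exprn_gt0.
have m30 : 0 < 8 * m ^+ 3 by rewrite mulr_gt0// exprn_gt0.
have d0 : 0 <= d.
  by rewrite /d mulr_ge0 ?(ltW k0)// divr_ge0 ?exprn_ge0 ?eta_ge0// ltW// mulr_gt0.
have Mc := multiplier_mass Lc (phi_c0 c) kappa0 gc Nc reg_c minr_c.
have Mi := multiplier_mass Linf phi_inf0 kappa0 ginf Ninf0 reg_inf minr_inf.
have Vc := virial Lc kappa0 gc Nc minr_c.
have Vi := virial Linf kappa0 ginf Ninf0 minr_inf.
have Ki := inf_kinetic ginf.
have Emin := minr_inf gc (etrans mass_c (esym Iinf)).
have Tcmp : int3 (fun x => jinf q m (rho x)) <= int3 (fun x => jmc q m c (rho x)) + d * int3 rho.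
  rewrite -(int3Z d0 Lr) -(int3D (nnL1_J Lc gc) (nnL1Z d0 Lr)).
  apply: int3_le; [exact: (nnL1_J Linf gc)|exact: (nnL1D (nnL1_J Lc gc) (nnL1Z d0 Lr))|] => x.
  apply: le_trans (jinf_le q0 m0 c0 (r0 x) (rS x)) _.
  by rewrite lerD2l /d mulrA (mulrC kf).
have Pcmp : 5 / 3 * int3 (fun x => jmc q m c (rho x)) <=
    int3 (fun x => rho x * phi_c (rho x)) + d * int3 rho.
  have H1 : int3 (fun x => rho x * phi_inf (rho x)) <=
      int3 (fun x => rho x * phi_c (rho x)) + d * int3 rho.
    have A1 := nnL1_phi Lc gc Lr; have A2 := nnL1Z d0 Lr.
    rewrite -(int3Z d0 Lr) -(int3D A1 A2).
    apply: int3_le; [exact: (nnL1_phi Linf gc Lr)|exact: (nnL1D A1 A2)|] => x.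
    rewrite (mulrC d) -mulrDr ler_wpM2l//.
    exact: (fermi_level_inf_le q0 m0 c0 (r0 x) (rS x)).
  apply: le_trans H1.
  have -> : int3 (fun x => rho x * phi_inf (rho x)) = 5 / 3 * int3 (fun x => jinf q m (rho x)).
    by rewrite inf_kinetic//; move: (int3 _) => z; field.
  rewrite (ler_pM2l pos53).
  by apply: int3_le; [exact: (nnL1_J Lc gc)|exact: (nnL1_J Linf gc)|] => x; exact: jmc_le.
have main := multiplier_compare Mc Mi Vc Vi Ki Emin Tcmp Pcmp.
have : kappa * N * (Rc^-1 - Ri^-1) * N <= 13 / 3 * (d * N).
  rewrite Iinf mass_c in main; apply: le_trans main.
  by rewrite le_eqVlt; apply/orP; left; apply/eqP; ring.
rewrite -ler_pdivlMr// => /le_trans; apply.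
have H4 : eta (rho (axis 0)) ^+ 4 <= (4 * m * top_const) ^+ 4.
  have H := eta_top_le Bc.
  by rewrite ler_pXn2r ?nnegrE ?eta_ge0// (le_trans _ H) ?eta_ge0.
have -> : gap_const / N / c ^+ 2 =
    13 / 3 * (kf * ((4 * m * top_const) ^+ 4 / (8 * m ^+ 3 * c ^+ 2)) * N) / N.
  rewrite /gap_const; move: (4 * m * top_const) kf => z k; field.
  by rewrite (gt_eqF m0) (gt_eqF c0) (gt_eqF N0).
rewrite ler_wpM2r ?invr_ge0 ?(ltW N0)// (ler_wpM2l pos133)//.
rewrite ler_wpM2r ?(ltW N0)// /d (ler_wpM2l (ltW k0))// ler_wpM2r//.
by rewrite invr_ge0 ltW// mulr_gt0.
Qed.

End fixed_c.
End comparison.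

(** * Boundary layers *)

Section layers.
Context {R : realType}.
Variables (kappa q m N Ri : R) (rho_inf : R3 R -> R).
Hypotheses (kappa0 : 0 < kappa) (q0 : 0 < q) (m0 : 0 < m) (N0 : 0 < N)
  (min_inf : minimizer_inf kappa q m N rho_inf)
  (reg_inf : regular_profile rho_inf Ri).

Local Notation eta := (fermi_momentum q).
Local Notation kf := (kfac q).
Local Notation w := (q / (6 * pi ^+ 2)).
Local Notation B0 := (top_const kappa q N).

Let w0 : 0 < w.
Proof. by rewrite divr_gt0// mulr_gt0// exprn_gt0// pi_gt0. Qed.

Lemma density_le s K c : 0 <= s -> 0 < c -> eta s <= K / c -> s <= w * K ^+ 3 / c ^+ 3.
Proof.
move=> s0 c0 H; have -> : w * K ^+ 3 / c ^+ 3 = w * (K / c) ^+ 3.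
  by rewrite expr_div_n [RHS]mulrA.
rewrite [leLHS](density_of_momentum q0 s0) ler_wpM2l ?(ltW w0)//.
rewrite ler_pXn2r ?nnegrE ?eta_ge0//.
by apply: le_trans H; exact: eta_ge0.
Qed.

Lemma bound_ge0 K c : 0 <= K -> 0 < c -> 0 <= w * K ^+ 3 / c ^+ 3.
Proof.
move=> K0 c0; apply: divr_ge0; last by rewrite exprn_ge0// ltW.
by apply: mulr_ge0; [exact: ltW|exact: exprn_ge0].
Qed.

Definition gap : R := gap_const kappa q m N / N.

Lemma gap_ge0 : 0 <= gap.
Proof. by rewrite divr_ge0 ?(ltW N0)//; exact: gap_const_ge0. Qed.

(** Chosen so that phi_inf(s) <= gap / c^2 means eta(s) <= K_out / c. *)
Definition K_out : R := Num.sqrt (gap * (2 * m) / kf).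

Section fixed_c.
Variables (c Rc : R) (rho : R3 R -> R).
Hypotheses (c1 : 1 <= c) (cB : 2 * B0 <= c) (min_c : minimizer_c kappa q m c N rho)
  (reg_c : regular_profile rho Rc).

Let c0 : 0 < c := lt_le_trans ltr01 c1.
Let c20 : 0 < c ^+ 2. Proof. by rewrite exprn_gt0. Qed.

Let gi : bdensity rho_inf.
Proof. by case: min_inf => /admissible_bdensity /(_ reg_inf)[]. Qed.
Let Ii : int3 rho_inf = N.
Proof. by case: min_inf => /admissible_bdensity /(_ reg_inf)[]. Qed.

(** The density is at most its value at distance R_c, and there phi_inf is at most
the difference of the multipliers. *)
Lemma outer_layer x : Rc <= enorm x -> rho_inf x <= w * K_out ^+ 3 / c ^+ 3.
Proof.
move=> Rx.
have k0 := kfac_gt0 q0; have g0 := gap_ge0.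
have K0 : 0 <= K_out := sqrtr_ge0 _.
have Rc0 : 0 < Rc := radius_c_gt0 N0 min_c reg_c.
have [[_ sd] _ _] := reg_inf.
apply: (@le_trans _ _ (rho_inf (axis Rc))).
  by apply: sd; rewrite enorm_axis gtr0_norm.
have s0 := bdensity_ge0 gi (axis Rc).
have [sE|sN] := eqVneq (rho_inf (axis Rc)) 0.
  by rewrite sE; exact: bound_ge0.
have sp : 0 < rho_inf (axis Rc) by rewrite lt_neqAle eq_sym sN.
apply: density_le => //.
have Ni : 0 < int3 rho_inf by rewrite Ii.
case: min_inf => adm E.
have lt53 : 1 < 5 / 3 :> R by lra.
have minr := minimizer_real (law_inf q0 m0) lt53 adm reg_inf E.
have := phi_axis_le (law_inf q0 m0) (phi_inf0 q m) kappa0 gi Ni reg_inf minr Rc0 sp.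
rewrite Ii => H.
have G := multiplier_gap kappa0 q0 m0 N0 min_inf reg_inf c0 min_c reg_c cB.
have H2 := le_trans H G.
have e0 := eta_ge0 q (rho_inf (axis Rc)).
have K2 : K_out ^+ 2 = gap * (2 * m) / kf.
  by rewrite sqr_sqrtr// divr_ge0 ?(ltW k0)// mulr_ge0// mulr_ge0// ltW.
rewrite -(@ler_pXn2r _ 2) ?nnegrE ?divr_ge0 ?(ltW c0)// expr_div_n K2.
move: H2; rewrite /fermi_level /quad_disp -/gap mulrA ler_pdivrMr ?mulr_gt0// mulrC -ler_pdivlMr//.
by move=> /le_trans; apply; rewrite le_eqVlt; apply/orP; left; apply/eqP; ring.
Qed.

(** A lower bound for R_c: solve [multiplier_gap] for 1/R_c, with c replaced
by 1. *)
Definition radius_low : R := kappa * N / (kappa * N * Ri^-1 + gap).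

Lemma Ri_gt0 : 0 < Ri.
Proof. by apply: (radius_gt0 gi _ reg_inf); rewrite Ii. Qed.

Lemma radius_low_gt0 : 0 < radius_low.
Proof.
have kN : 0 < kappa * N by rewrite mulr_gt0.
by rewrite divr_gt0// ltr_wpDr ?gap_ge0// divr_gt0// Ri_gt0.
Qed.

Lemma radius_low_le : radius_low <= Rc.
Proof.
have Rc0 : 0 < Rc := radius_c_gt0 N0 min_c reg_c.
have kN : 0 < kappa * N by rewrite mulr_gt0.
have G := multiplier_gap kappa0 q0 m0 N0 min_inf reg_inf c0 min_c reg_c cB.
have gc : gap / c ^+ 2 <= gap.
  by rewrite ler_pdivrMr// ler_peMr ?gap_ge0// exprn_ege1.
have Y0 : 0 < kappa * N * Ri^-1 + gap.
  by rewrite ltr_wpDr ?gap_ge0// divr_gt0// Ri_gt0.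
rewrite /radius_low ler_pdivrMr// [leRHS]mulrC -ler_pdivrMr//.
have := le_trans G gc; rewrite mulrBr lerBlDr addrC; exact.
Qed.

Definition inner_const (K1 : R) : R :=
  kappa * N * (2 * K1 / radius_low ^+ 2).

Definition K_in (K1 : R) : R :=
  Num.sqrt (inner_const K1 * (2 * m + 4 * m * B0) / kf).

(** Within K_1/c^2 of the edge, 1/|x| - 1/R_c is O(c^-2), the radii being bounded
below; so phi_c(rho_c(x)) = O(c^-2). *)
Lemma inner_layer (K1 : R) x : 0 < K1 -> 2 * K1 / radius_low <= c ->
  Rc - K1 / c ^+ 2 <= enorm x -> enorm x < Rc ->
  rho x <= w * K_in K1 ^+ 3 / c ^+ 3.
Proof.
move=> K10 cK xl xu.
have k0 := kfac_gt0 q0; have r0 := radius_low_gt0; have rl := radius_low_le.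
have Rc0 : 0 < Rc := radius_c_gt0 N0 min_c reg_c.
have kN : 0 < kappa * N by rewrite mulr_gt0.
have Kc : K1 / c ^+ 2 <= radius_low / 2.
  rewrite ler_pdivrMr//; move: cK; rewrite ler_pdivrMr// => cK.
  have : c <= c ^+ 2 by rewrite expr2 ler_peMl// ltW.
  by move=> /(ler_wpM2r (ltW r0)); lra.
set a := enorm x in xl xu.
have al : radius_low / 2 <= a by lra.
have a0 : 0 < a by lra.
have gc := bdensity_c min_c reg_c; have Nc := mass_c_gt0 N0 min_c reg_c.
have [sdc _ _] := reg_c.
have -> : rho x = rho (axis a) by rewrite (symdec_axis x sdc).
have s0 := bdensity_ge0 gc (axis a).
have K0 : 0 <= K_in K1 := sqrtr_ge0 _.
have [sE|sN] := eqVneq (rho (axis a)) 0.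
  by rewrite sE; exact: bound_ge0.
have sp : 0 < rho (axis a) by rewrite lt_neqAle eq_sym sN.
apply: density_le => //.
have minr := minr_c q0 m0 c0 min_c reg_c.
have H := phi_axis_le (law_c q0 m0 c0) (phi_c0 q m0 c) kappa0 gc Nc reg_c minr a0 sp.
rewrite (mass_c min_c reg_c) in H.
have D0 : 0 <= inner_const K1.
  by rewrite /inner_const mulr_ge0 ?(ltW kN)// divr_ge0 ?sqr_ge0// mulr_ge0// ltW.
have B00 := top_const_gt0 kappa0 q0 N0.
have H0 : 0 <= 4 * m * B0 by rewrite mulr_ge0 ?(ltW B00)// mulr_ge0// ltW.
have KE : K_in K1 ^+ 2 = inner_const K1 * (2 * m + 4 * m * B0) / kf.
  by rewrite sqr_sqrtr// divr_ge0 ?(ltW k0)// mulr_ge0// addr_ge0// mulr_ge0// ltW.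
have etaH : eta (rho (axis a)) <= 4 * m * B0.
  apply: le_trans (eta_top_le kappa0 q0 m0 N0 c0 min_c reg_c cB).
  by apply: eta_mono => //; exact: (rho_le_axis0 reg_c).
apply: (momentum_le c0 c1 k0 m0 (eta_ge0 _ _) etaH D0
  (rel_disp_lower m0 c0 (eta_ge0 _ _)) _ K0 KE).
apply: le_trans H _; rewrite /inner_const -!mulrA (ler_pM2l kappa0) (ler_pM2l N0).
have -> : a^-1 - Rc^-1 = (Rc - a) / (a * Rc) by field; rewrite !gt_eqF.
have aR : radius_low ^+ 2 / 2 <= a * Rc.
  have -> : radius_low ^+ 2 / 2 = radius_low / 2 * radius_low by field.
  have rh : 0 <= radius_low / 2 by apply: divr_ge0 => //; exact: ltW.
  exact: (ler_pM rh (ltW r0) al rl).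
have r2 : 0 < radius_low ^+ 2 / 2 by rewrite divr_gt0// exprn_gt0.
apply: (@le_trans _ _ (K1 / c ^+ 2 / (radius_low ^+ 2 / 2))).
  have d0 : 0 <= Rc - a by rewrite subr_ge0 ltW.
  rewrite ler_pM ?invr_ge0 ?mulr_ge0 ?(ltW a0) ?(ltW Rc0)//; first by lra.
  by rewrite lef_pV2// posrE mulr_gt0.
by rewrite le_eqVlt; apply/orP; left; apply/eqP; field; rewrite !gt_eqF.
Qed.

End fixed_c.
End layers.

Theorem theorem1p4 (R : realType) (kappa q Nstar m N : R)
  (kappa_gt0 : 0 < kappa) (q_ge1 : 1 <= q)
  (Nstar_opt : is_N_star kappa q Nstar)
  (m_gt0 : 0 < m) (N_gt0 : 0 < N)
  (rho : R -> R3 R -> R) (Rc : R -> R)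
  (rho_min : forall c : R,
     0 < N `^ (2 / 3) -> N `^ (2 / 3) < c * Nstar `^ (2 / 3) ->
     minimizer_c kappa q m c N (rho c) /\ regular_profile (rho c) (Rc c))
  (rho_inf : R3 R -> R) (R_inf : R)
  (rho_inf_min : minimizer_inf kappa q m N rho_inf /\
                 regular_profile rho_inf R_inf)
  (K1 : R) (K1_gt0 : 0 < K1)
  (balls : \forall c \near +oo,
     eball (Rc c - K1 / c ^+ 2) `<=` eball (Rc c) /\
     eball (Rc c) `<=` eball R_inf) :
  exists C : R, 0 < C /\
    \forall c \near +oo,
      (forall x, x \in eball R_inf `\` eball (Rc c) ->
         rho_inf x <= C / c ^+ 3) /\
      (forall x, x \in eball (Rc c) `\` eball (Rc c - K1 / c ^+ 2) ->
         rho c x <= C / c ^+ 3).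
Proof.
have q0 : 0 < q by exact: lt_le_trans q_ge1.
have [min_inf reg_inf] := rho_inf_min.
have [Ns0 _ _] := Nstar_opt.
have w0 : 0 < q / (6 * pi ^+ 2) by rewrite divr_gt0// mulr_gt0// exprn_gt0// pi_gt0.
pose Ko := K_out kappa q m N; pose Ki := K_in kappa q m N R_inf K1.
have Ko0 : 0 <= Ko by exact: sqrtr_ge0.
have Ki0 : 0 <= Ki by exact: sqrtr_ge0.
pose C := q / (6 * pi ^+ 2) * (Ko ^+ 3 + Ki ^+ 3) + 1.
have CE (c K : R) : 0 < c -> K ^+ 3 <= Ko ^+ 3 + Ki ^+ 3 ->
    q / (6 * pi ^+ 2) * K ^+ 3 / c ^+ 3 <= C / c ^+ 3.
  move=> c0 HK; rewrite ler_wpM2r ?invr_ge0 ?exprn_ge0 ?(ltW c0)//.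
  by rewrite /C ler_wpDr// ler_wpM2l// ltW.
exists C; split.
  by rewrite ltr_wpDl// mulr_ge0 ?(ltW w0)// addr_ge0// exprn_ge0.
near=> c.
have c1 : 1 <= c by near: c; apply: nbhs_pinfty_ge; exact: num_real.
have cB : 2 * top_const kappa q N <= c by near: c; apply: nbhs_pinfty_ge; exact: num_real.
have cK : 2 * K1 / radius_low kappa q m N R_inf <= c by near: c; apply: nbhs_pinfty_ge; exact: num_real.
have cN : N `^ (2 / 3) / Nstar `^ (2 / 3) < c by near: c; apply: nbhs_pinfty_gt; exact: num_real.
have c0 : 0 < c by exact: lt_le_trans c1.
have [|| min_c reg_c] := rho_min c.
- exact: powR_gt0.
- by rewrite -ltr_pdivrMr// powR_gt0.
split=> x; rewrite inE => -[].
- rewrite /eball /= => _ /negP; rewrite -leNgt => Rx.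
  apply: le_trans (outer_layer kappa_gt0 q0 m_gt0 N_gt0 min_inf reg_inf c1 cB min_c reg_c Rx) _.
  by apply: CE => //; rewrite lerDl exprn_ge0.
- rewrite /eball /= => xu /negP; rewrite -leNgt => xl.
  apply: le_trans (inner_layer kappa_gt0 q0 m_gt0 N_gt0 min_inf reg_inf c1 cB min_c reg_c K1_gt0 cK xl xu) _.
  by apply: CE => //; rewrite lerDr exprn_ge0.
Unshelve. all: by end_near.
Qed.
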